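(* Let $\Omega,d,N,T,\mathcal D,A,\boldsymbol f,s,\boldsymbol u,\gamma,C_f,\boldsymbol\rho_0$ satisfy the structural assumptions listed in the context, let $\varepsilon>0$, let $\mathcal T_h$ be a mesh of $\Omega$ and $0=t_0<\dots<t_{N_t}=T$ a partition of $(0,T)$ with steps $\tau_n=t_n-t_{n-1}$. Then, for $n=0,\dots,N_t-1$, there exists a solution $\boldsymbol w_h^{\varepsilon,n+1}\in\mathcal S_p(\mathcal T_h)^N$ (with associated $\underline{\boldsymbol\sigma}_h^{\varepsilon,n+1}\in\boldsymbol{\mathcal M}_p(\mathcal T_h)^N$) of the $(n+1)$-th step of the fully discrete regularized LDG--backward Euler scheme described in the context.
   Context: **Structural assumptions.** $d\in\{1,2,3\}$, $N\in\mathbb N$, $T>0$, $\Omega\subset\mathbb R^d$ is a bounded polytopic domain with Lipschitz boundary. $\mathcal D\subset(0,\infty)^N$ is a bounded domain; $A\in C^0(\overline{\mathcal D};\mathbb R^{N\times N})$, $\boldsymbol f\in C^0(\overline{\mathcal D};\mathbb R^N)$. There is a convex function $s\in C^2(\mathcal D;(0,\infty))\cap C^0(\overline{\mathcal D};(0,\infty))$ with $s':\mathcal D\to\mathbb R^N$ invertible and $\boldsymbol u:=(s')^{-1}\in C^1(\mathbb R^N;\mathcal D)$, and constants $\gamma>0$, $C_f\ge0$ with $\boldsymbol z\cdot(s''(\boldsymbol\rho)A(\boldsymbol\rho)\boldsymbol z)\ge\gamma|\boldsymbol z|^2$ for all $\boldsymbol z\in\mathbb R^N$, $\boldsymbol\rho\in\mathcal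 D$, and $\boldsymbol f(\boldsymbol\rho)\cdot s'(\boldsymbol\rho)\le C_f$ for all $\boldsymbol\rho\in\mathcal D$. The initial datum $\boldsymbol\rho_0\in L^\infty(\Omega)^N$ satisfies $\boldsymbol\rho_0(\boldsymbol x)\in\mathcal D$ for a.e. $\boldsymbol x\in\Omega$. For $N\times d$ matrices, $P:Q=\mathrm{tr}(Q^{\sf T}P)$; products such as $A\,\underline{\boldsymbol\sigma}$ are matrix products ($N\times N$ times $N\times d$). **Mesh and spaces.** $\mathcal T_h$ is a conforming simplicial mesh of $\Omega$ with mesh size $h=\max_K h_K$, $h_K=\mathrm{diam}\,K$, belonging for $d=2,3$ to a shape-regular family ($\Upsilon h_K\le\varrho_K$ for all $K$, $\varrho_K$ the inradius, $\Upsilon>0$ independent of $h$). $\mathcal F_h^{\mathcal I}$, $\mathcal F_h^{\mathcal N}$ are the sets of interior and boundary facets; integrals over $\mathcal F_h^\star$ are sums of facet integrals. For a fixed polynomial degree $p$, $\mathcal S_p(\mathcal T_h)$ is the space of functions that are polynomials of degree $\le p$ on each $K\in\mathcal T_h$ (no continuity), and $\boldsymbol{\mathcal M}_p(\mathcal T_h)=\mathcal S_p(\mathcal T_h)^d$; elements of $\boldsymbol{\mathcal M}_p(\mathcal T_h)^N$ are $N\times d$ matrix valued. For $F=\partial K_1\cap\partial K_2\in\mathcal F_h^{\mathcal I}$ with a fixed unit normal $\underline n_F$ pointing out of $K_1$ and a fixed weight $\alpha_F\in[0,1]$: $[\![\mu]\!]_{\sf N}=(\mu_{|K_1}-\mu_{|K_2})\underline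 n_F$ for scalar $\mu$ (componentwise for vectors $\boldsymbol\mu$), $[\![\underline\psi]\!]_{\sf N}=(\underline\psi_{|K_1}-\underline\psi_{|K_2})\cdot\underline n_F$ for $d$-vector valued $\underline\psi$, $\{\!\{\mu\}\!\}_{\alpha_F}=(1-\alpha_F)\mu_{|K_1}+\alpha_F\mu_{|K_2}$. $\mathsf h=\eta^{-1}\min\{h_{K_1},h_{K_2}\}$ on $F$, with a constant $\eta>0$ independent of $h$, and $\eta_F=\mathsf h_{|F}^{-1}\|A\|_{L^\infty(\mathcal D)^{N\times N}}$. **Forms.** For $w_h,\lambda_h\in\mathcal S_p(\mathcal T_h)$, $\underline\psi_h\in\boldsymbol{\mathcal M}_p(\mathcal T_h)$, $$b_h(w_h,\underline\psi_h)=-\int_{\mathcal F_h^{\mathcal I}}\{\!\{w_h\}\!\}_{\alpha_F}[\![\underline\psi_h]\!]_{\sf N}\,dS-\int_{\mathcal F_h^{\mathcal N}}w_h\underline\psi_h\cdot\underline n_\Omega\,dS+\sum_{K\in\mathcal T_h}\int_Kw_h\nabla\cdot\underline\psi_h\,d\boldsymbol x,\qquad s_h(w_h,\lambda_h)=\int_{\mathcal F_h^{\mathcal I}}\eta_F[\![w_h]\!]_{\sf N}\cdot[\![\lambda_h]\!]_{\sf N}\,dS .$$ For $\boldsymbol v_h\in\mathcal S_p(\mathcal T_h)^N$ let $\underline{\boldsymbol\zeta}_h(\boldsymbol v_h)\in\boldsymbol{\mathcal M}_p(\mathcal T_h)^N$ be defined by $\int_\Omega\underline{\boldsymbol\zeta}_h(\boldsymbol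 v_h):\underline{\boldsymbol\psi}_h\,d\boldsymbol x=\sum_{i=1}^Nb_h(v_{h,i},\underline\psi_{h,i})$ for all $\underline{\boldsymbol\psi}_h\in\boldsymbol{\mathcal M}_p(\mathcal T_h)^N$. Let $c_h$ be a symmetric positive definite bilinear form on $\mathcal S_p(\mathcal T_h)$ depending only on the space discretization, and $\boldsymbol c_h(\boldsymbol w_h,\boldsymbol v_h)=\sum_{i=1}^Nc_h(w_{h,i},v_{h,i})$. **Fully discrete scheme.** Let $\Pi_p^0$ be the $L^2(\Omega)$-orthogonal projection onto $\mathcal S_p(\mathcal T_h)^N$. Set $\boldsymbol\rho_h^{\varepsilon,0}=\Pi_p^0\boldsymbol\rho_0$ and $\boldsymbol\rho_h^{\varepsilon,n}=\boldsymbol u(\boldsymbol w_h^{\varepsilon,n})$ for $n\ge1$, where $\boldsymbol w_h^{\varepsilon,n}$ is a solution of the previous step. The $(n+1)$-th step ($n=0,\dots,N_t-1$) reads: find $(\boldsymbol w,\underline{\boldsymbol\sigma})=(\boldsymbol w_h^{\varepsilon,n+1},\underline{\boldsymbol\sigma}_h^{\varepsilon,n+1})\in\mathcal S_p(\mathcal T_h)^N\times\boldsymbol{\mathcal M}_p(\mathcal T_h)^N$ such that $$\int_\Omega A(\boldsymbol u(\boldsymbol w))^{\sf T}s''(\boldsymbol u(\boldsymbol w))\underline{\boldsymbol\sigma}:\underline{\boldsymbol\varphi}_h\,d\boldsymbol x=\int_\Omega A(\boldsymbol u(\boldsymbol w))^{\sf T}\underline{\boldsymbol\zeta}_h(\boldsymbol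 w):\underline{\boldsymbol\varphi}_h\,d\boldsymbol x\quad\forall\underline{\boldsymbol\varphi}_h\in\boldsymbol{\mathcal M}_p(\mathcal T_h)^N,$$ $$\varepsilon\tau_{n+1}\boldsymbol c_h(\boldsymbol w,\boldsymbol\lambda_h)+\int_\Omega(\boldsymbol u(\boldsymbol w)-\boldsymbol\rho_h^{\varepsilon,n})\cdot\boldsymbol\lambda_h\,d\boldsymbol x+\tau_{n+1}\int_\Omega A(\boldsymbol u(\boldsymbol w))\underline{\boldsymbol\sigma}:\underline{\boldsymbol\zeta}_h(\boldsymbol\lambda_h)\,d\boldsymbol x+\tau_{n+1}\sum_{i=1}^Ns_h(w_i,\lambda_{h,i})=\tau_{n+1}\int_\Omega\boldsymbol f(\boldsymbol u(\boldsymbol w))\cdot\boldsymbol\lambda_h\,d\boldsymbol x\quad\forall\boldsymbol\lambda_h\in\mathcal S_p(\mathcal T_h)^N.$$ *)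

(* Defs.v *)
From HB Require Import structures.
From mathcomp Require Import all_boot all_order all_algebra.
From mathcomp Require Import all_classical all_reals all_analysis.

Set Implicit Arguments.
Unset Strict Implicit.
Unset Printing Implicit Defensive.
Import Order.TTheory GRing.Theory Num.Theory.
Import numFieldNormedType.Exports.
Local Open Scope classical_set_scope.
Local Open Scope ring_scope.

Section lebesgue_tuple.
Context {R : realType}.
Local Open Scope ereal_scope.
Local Notation R' := (measurableTypeR R).

(* Lebesgue measure on R^n, by integrating the measures of the sections; on
   R^0 it is the Dirac mass at the only point. *)
Fixpoint lebesgue_tuple (n : nat) : set (n.-tuple R') -> \bar R :=
  match n return set (n.-tuple R') -> \bar R with
  | 0%N => fun A => \d_([tuple] : 0.-tuple R') A
  | m.+1 => fun A =>
      \int[@lebesgue_measure R]_x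
        lebesgue_tuple [set t : m.-tuple R' | A (cons_tuple x t)]
  end.

Let uncurried_cons n (p : R' * n.-tuple R') : n.+1.-tuple R' :=
  cons_tuple p.1 p.2.

Let measurable_uncurried_cons n :
  measurable_fun [set: R' * n.-tuple R'] (@uncurried_cons n).
Proof.
have := @measurable_cons _ _ (R' * n.-tuple R')%type R' fst n snd
  measurable_fst measurable_snd.
apply: eq_measurable_fun => -[x t] _ /=; exact: val_inj.
Qed.

Let measurable_uncons n :
  measurable_fun [set: n.+1.-tuple R'] (fun t => (thead t, behead_tuple t)).
Proof.
apply/measurable_fun_pairP; split; first exact: measurable_tnth.
have := @measurable_behead _ R' n.
by apply: eq_measurable_fun => t _ /=; exact: val_inj.
Qed.

Section step.
Variables (n : nat) (mu : {sigma_finite_measure set (n.-tuple R') -> \bar R}).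

Let nu : {measure set (n.+1.-tuple R') -> \bar R} :=
  measure_function_pushforward__canonical__measure_function_Measure
    ((@lebesgue_measure R \x mu) : {measure set (R' * n.-tuple R')%type -> \bar R})
    (@measurable_uncurried_cons n).

Let sigma_finite_nu : sigma_finite setT nu.
Proof.
have /sigma_finiteP[F [FT ndF Foo]] :=
  sigma_finiteT (@lebesgue_measure R : {sigma_finite_measure set R' -> \bar R}).
have /sigma_finiteP[G [GT ndG Goo]] := sigma_finiteT mu.
exists (fun k => (fun t : n.+1.-tuple R' => (thead t, behead_tuple t)) @^-1`
                 (F k `*` G k)).
  apply/seteqP; split => // t _.
  set x := thead t; set y := behead_tuple t.
  have [k _ Fx] : (\bigcup_k F k) x by rewrite -FT.
  have [l _ Gy] : (\bigcup_k G k) y by rewrite -GT.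
  exists (maxn k l) => //; split.
  - by have /subsetPset := ndF _ _ (leq_maxl k l); exact.
  - by have /subsetPset := ndG _ _ (leq_maxr k l); exact.
move=> k; have [mF oF] := Foo k; have [mG oG] := Goo k; split.
  rewrite -[X in measurable X]setTI; apply: measurable_uncons => //.
  exact: measurableX.
rewrite /nu /= /pushforward -comp_preimage (_ : _ \o _ = id).
  rewrite preimage_id product_measure1E//.
  by rewrite lte_mul_pinfty// ge0_fin_numE.
by apply/funext => -[x t]; congr pair => //; exact: val_inj.
Qed.

Lemma lebesgue_tuple_step : @lebesgue_tuple n = mu ->
  exists mu' : {sigma_finite_measure set (n.+1.-tuple R') -> \bar R},
    @lebesgue_tuple n.+1 = mu'.
Proof.
move=> IH.
pose b := Measure_isSigmaFinite.Build _ _ _ nu sigma_finite_nu.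
pose mu' : {sigma_finite_measure set (n.+1.-tuple R') -> \bar R} :=
  HB.pack (nu : set _ -> \bar R) nu b.
exists mu'.
apply/funext => A; rewrite /= IH /pushforward /product_measure1.
apply: eq_integral => x _ /=; congr (mu _).
by apply/seteqP; split => t /=; rewrite /xsection /= inE.
Qed.

End step.

Lemma lebesgue_tuple_ex n :
  exists mu : {sigma_finite_measure set (n.-tuple R') -> \bar R},
    @lebesgue_tuple n = mu.
Proof.
elim: n => [|n [mu]]; first by exists \d_([tuple] : 0.-tuple R').
exact: lebesgue_tuple_step.
Qed.

Section instances.
Variable n : nat.
Local Notation leb := (@lebesgue_tuple n).

Let leb0 : leb set0 = 0.
Proof. by have [mu ->] := lebesgue_tuple_ex n; exact: measure0. Qed.

Let leb_ge0 A : 0 <= leb A.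
Proof. by have [mu ->] := lebesgue_tuple_ex n; exact: measure_ge0. Qed.

Let leb_sigma_additive : semi_sigma_additive leb.
Proof.
by have [mu ->] := lebesgue_tuple_ex n; exact: measure_semi_sigma_additive.
Qed.

HB.instance Definition _ := isMeasure.Build _ _ _ leb
  leb0 leb_ge0 leb_sigma_additive.

Let leb_sigma_finite : sigma_finite setT leb.
Proof. by have [mu ->] := lebesgue_tuple_ex n; exact: sigma_finiteT. Qed.

HB.instance Definition _ := Measure_isSigmaFinite.Build _ _ _ leb
  leb_sigma_finite.

End instances.
End lebesgue_tuple.
Arguments lebesgue_tuple {R} n.

Section integration.
Variable R : realType.

Definition row_of_tuple n (t : n.-tuple (measurableTypeR R)) : 'rV[R]_n :=
  \row_i (tnth t i : R).

Definition integral_on n (D : set 'rV[R]_n) (g : 'rV[R]_n -> R) : R :=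
  \int[lebesgue_tuple n]_(t in [set t | D (row_of_tuple t)])
    g (row_of_tuple t).

Definition ae_on n (D : set 'rV[R]_n) (P : 'rV[R]_n -> Prop) : Prop :=
  {ae lebesgue_tuple n, forall t, D (row_of_tuple t) -> P (row_of_tuple t)}.

Definition essentially_bounded n (D : set 'rV[R]_n) (g : 'rV[R]_n -> R) :=
  measurable_fun [set t | D (row_of_tuple t)] (g \o @row_of_tuple n) /\
  exists m : R, ae_on D (fun x => `|g x| <= m).

(* The norm of a matrix is the library's one (largest modulus of an entry). *)
Definition Linfty_norm N (D : set 'cV[R]_N) (B : 'cV[R]_N -> 'M[R]_N) : R :=
  inf [set m : R | 0 <= m /\
    ae_on [set x : 'rV[R]_N | D x^T] (fun x => `|B x^T| <= m)].

End integration.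

Section calculus.
Variable R : realType.

(* P : Q; for columns or rows it is the Euclidean inner product. *)
Definition frob m n (P Q : 'M[R]_(m, n)) : R := \tr (Q^T *m P).

Definition enorm m n (P : 'M[R]_(m, n)) : R := Num.sqrt (frob P P).

Definition C1_on (V W : normedModType R) (U : set V) (g : V -> W) : Prop :=
  forall x, U x ->
    differentiable g x /\ forall v, {for x, continuous (fun y => 'D_v g y)}.

Definition C2_on (V W : normedModType R) (U : set V) (g : V -> W) : Prop :=
  C1_on U g /\ forall v, C1_on U (fun y => 'D_v g y).

Definition grad N (s : 'cV[R]_N -> R) (rho : 'cV[R]_N) : 'cV[R]_N :=
  \col_i 'D_(delta_mx i 0) s rho.

Definition hess N (s : 'cV[R]_N -> R) (rho : 'cV[R]_N) : 'M[R]_N :=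
  \matrix_(i, j) 'D_(delta_mx i 0) (fun r => 'D_(delta_mx j 0) s r) rho.

Definition divergence n (psi : 'rV[R]_n -> 'rV[R]_n) (x : 'rV[R]_n) : R :=
  \sum_(k < n) 'D_(delta_mx 0 k) (fun y => psi y 0 k) x.

Definition polynomial_fun n (p : nat) (g : 'rV[R]_n -> R) : Prop :=
  exists c : {ffun 'I_n -> 'I_p.+1} -> R, forall x,
    g x = \sum_(a : {ffun 'I_n -> 'I_p.+1} | (\sum_i a i <= p)%N)
            c a * \prod_i x 0 i ^+ a i.

End calculus.

Section geometry.
Variable R : realType.

Definition domain (V : topologicalType) (D : set V) : Prop :=
  [/\ open D, connected D & D !=set0].

(* Convex hull of the points v i for which A i holds. *)
Definition hull (I : finType) n (A : pred I) (v : I -> 'rV[R]_n) :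
    set 'rV[R]_n :=
  [set x | exists l : I -> R,
    [/\ forall i, 0 <= l i, forall i, ~~ A i -> l i = 0,
        \sum_i l i = 1 & x = \sum_i l i *: v i]].

Definition polytopic n (Omega : set 'rV[R]_n) : Prop :=
  exists (m k : nat) (v : 'I_m -> 'I_k -> 'rV[R]_n),
    closure Omega = \bigcup_i hull predT (v i).

(* Near each boundary point, Omega lies on one side of the graph, in the
   direction nu, of a Lipschitz function phi of the component orthogonal
   to nu. *)
Definition lipschitz_boundary n (Omega : set 'rV[R]_n) : Prop :=
  forall x, (closure Omega `\` Omega) x ->
  exists (r L : R) (nu : 'rV[R]_n) (phi : 'rV[R]_n -> R),
    [/\ 0 < r, frob nu nu = 1,
        forall y z, `|phi y - phi z| <= L * enorm (y - z) &
        forall y, enorm (y - x) < r ->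
          (Omega y <-> phi (y - frob y nu *: nu) < frob y nu)].

Definition diam n (D : set 'rV[R]_n) : R :=
  sup [set enorm (x - y) | x in D & y in D].

Definition inradius n (D : set 'rV[R]_n) : R :=
  sup [set r : R | 0 <= r /\
    exists x, [set y | enorm (y - x) <= r] `<=` D].

(* The space dimension is d.+1, so that simplices have d.+2 vertices and
   facets d.+1. *)
Record mesh (d : nat) := Mesh {
  cell : finType;
  vertex : cell -> 'I_d.+2 -> 'rV[R]_d.+1 }.

Section mesh_theory.
Variables (d : nat) (M : mesh d).

Definition simplex (K : cell M) : set 'rV[R]_d.+1 := hull predT (vertex K).

(* (K, i) stands for the facet of K opposite to its vertex number i; an
   interior facet is thus represented by two such pairs. *)
Definition facet : finType := (cell M * 'I_d.+2)%type.

Definition facet_set (F : facet) : set 'rV[R]_d.+1 :=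
  hull (predC1 F.2) (vertex F.1).

Definition conforming_mesh (Omega : set 'rV[R]_d.+1) : Prop :=
  [/\ forall K : cell M,
        \matrix_(k < d.+1, l < d.+1)
          (vertex K (lift ord0 k) 0 l - vertex K ord0 0 l) \in unitmx,
      closure Omega = \bigcup_K simplex K,
      forall K K' : cell M, K != K' ->
        interior (simplex K) `&` interior (simplex K') = set0 &
      forall K K' : cell M, exists A B : pred 'I_d.+2,
        simplex K `&` simplex K' = hull A (vertex K) /\
        simplex K `&` simplex K' = hull B (vertex K')].

Definition shape_regular (Upsilon : R) : Prop :=
  forall K : cell M,
    Upsilon * diam (simplex K) <= inradius (simplex K).

Definition facet_normal (F : facet) : 'rV[R]_d.+1 :=
  let v := vertex F.1 in
  get [set nu | [/\ frob nu nu = 1,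
    forall j k, j != F.2 -> k != F.2 -> frob (v j - v k) nu = 0 &
    forall j, j != F.2 -> frob (v F.2 - v j) nu < 0]].

(* Surface integral, by the affine parametrization of the facet by the unit
   simplex of R^d, with the Gramian as area element; for d = 0 it is the
   value at the point. *)
Definition facet_integral (F : facet) (g : 'rV[R]_d.+1 -> R) : R :=
  let v (k : 'I_d.+1) := vertex F.1 (lift F.2 k) in
  let E : 'M[R]_(d, d.+1) :=
    \matrix_(k < d, l < d.+1) (v (lift ord0 k) 0 l - v ord0 0 l) in
  Num.sqrt (\det (E *m E^T)) *
  integral_on [set t : 'rV[R]_d | (forall k, 0 <= t 0 k) /\
                                  \sum_k t 0 k <= 1]
              (fun t => g (v ord0 + t *m E)).

(* On the interior facet shared by K1 and K2, the cell called K1 in the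
   conventions for jumps and averages is the one with [is_first K1 K2], and the
   weight of the average is [weight K1 K2]; [penalty] is the constant eta. *)
Record flux := Flux {
  is_first : rel (cell M);
  weight : cell M -> cell M -> R;
  penalty : R }.

Definition admissible_flux (fx : flux) : Prop :=
  [/\ forall K K' : cell M, K != K' -> is_first fx K K' = ~~ is_first fx K' K,
      forall K K' : cell M, 0 <= weight fx K K' <= 1 &
      0 < penalty fx].

Definition interior_facet (fx : flux) (F : facet * facet) : Prop :=
  [/\ F.1.1 != F.2.1, facet_set F.1 = facet_set F.2 & is_first fx F.1.1 F.2.1].

Definition boundary_facet (Omega : set 'rV[R]_d.+1) (F : facet) : Prop :=
  facet_set F `<=` closure Omega `\` Omega.

Definition interior_integral (fx : flux)
    (g : facet * facet -> 'rV[R]_d.+1 -> R) : R :=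
  \sum_(F : facet * facet | `[< interior_facet fx F >])
    facet_integral F.1 (g F).

Definition boundary_integral (Omega : set 'rV[R]_d.+1)
    (g : facet -> 'rV[R]_d.+1 -> R) : R :=
  \sum_(F : facet | `[< boundary_facet Omega F >]) facet_integral F (g F).

End mesh_theory.
End geometry.
Arguments Mesh {R d}.
Arguments Flux {R d M}.

Section ldg.
Variables (R : realType) (d : nat) (M : mesh R d).
Implicit Types (K : cell M) (x : 'rV[R]_d.+1).

(* A piecewise defined matrix-valued function: [w K] is its branch on the
   cell K, defined on the whole space so that it has traces on the facets
   of K. *)
Definition broken (m n : nat) : Type := cell M -> 'rV[R]_d.+1 -> 'M[R]_(m, n).

Definition scalar_broken : Type := cell M -> 'rV[R]_d.+1 -> R.

Definition Sp (p : nat) (w : scalar_broken) : Prop :=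
  forall K, polynomial_fun p (w K).

(* N x n matrices with entries in S_p(T_h): S_p(T_h)^N for n = 1 and
   M_p(T_h)^N for n = d.+1. *)
Definition Sp_mx (p m n : nat) (w : broken m n) : Prop :=
  forall i j, Sp p (fun K x => w K x i j).

Definition component N (w : broken N 1) (i : 'I_N) : scalar_broken :=
  fun K x => w K x i 0.

Definition row_component N (psi : broken N d.+1) (i : 'I_N) : broken 1 d.+1 :=
  fun K x => row i (psi K x).

Variable Omega : set 'rV[R]_d.+1.

Definition integral_Omega (g : scalar_broken) : R :=
  \sum_K integral_on (Omega `&` simplex K) (g K).

Variable fx : flux M.

Definition b_h (w : scalar_broken) (psi : broken 1 d.+1) : R :=
  - interior_integral fx (fun F x =>
      let K1 := F.1.1 in let K2 := F.2.1 in
      let a := weight fx K1 K2 in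
      ((1 - a) * w K1 x + a * w K2 x) *
      frob (psi K1 x - psi K2 x) (facet_normal F.1))
  - boundary_integral Omega (fun F x =>
      w F.1 x * frob (psi F.1 x) (facet_normal F))
  + \sum_K integral_on (simplex K) (fun x => w K x * divergence (psi K) x).

(* [normA] is the L^infty norm of the diffusion matrix A. *)
Definition eta_F (normA : R) (F : facet M * facet M) : R :=
  ((penalty fx)^-1 *
     Num.min (diam (simplex F.1.1)) (diam (simplex F.2.1)))^-1 * normA.

Definition s_h (normA : R) (w lambda : scalar_broken) : R :=
  interior_integral fx (fun F x =>
    let K1 := F.1.1 in let K2 := F.2.1 in let n := facet_normal F.1 in
    eta_F normA F *
    frob ((w K1 x - w K2 x) *: n) ((lambda K1 x - lambda K2 x) *: n)).

Definition zeta_h (p N : nat) (v : broken N 1) : broken N d.+1 :=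
  get [set z : broken N d.+1 | Sp_mx p z /\
    forall psi : broken N d.+1, Sp_mx p psi ->
      integral_Omega (fun K x => frob (z K x) (psi K x)) =
      \sum_i b_h (component v i) (row_component psi i)].

Definition L2_projection (p N : nat) (g : 'rV[R]_d.+1 -> 'cV[R]_N) :
    broken N 1 :=
  get [set q : broken N 1 | Sp_mx p q /\
    forall lambda : broken N 1, Sp_mx p lambda ->
      integral_Omega (fun K x => frob (q K x) (lambda K x)) =
      integral_Omega (fun K x => frob (g x) (lambda K x))].

Record spd_form (p : nat) (c : scalar_broken -> scalar_broken -> R) : Prop := {
  spd_linear : forall (a : R) (v w z : scalar_broken),
    Sp p v -> Sp p w -> Sp p z ->
    c (fun K x => a * v K x + w K x) z = a * c v z + c w z;
  spd_symmetric : forall v w : scalar_broken, Sp p v -> Sp p w -> c v w = c w v;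
  spd_positive : forall v : scalar_broken, Sp p v -> v <> (fun _ _ => 0) ->
    0 < c v v }.

Section scheme.
Variables (N p : nat).
Variables (D : set 'cV[R]_N) (A : 'cV[R]_N -> 'M[R]_N).
Variables (f u : 'cV[R]_N -> 'cV[R]_N) (s : 'cV[R]_N -> R).
Variable c_h : scalar_broken -> scalar_broken -> R.

Definition discrete_density (rho0 : 'rV[R]_d.+1 -> 'cV[R]_N)
    (w : nat -> broken N 1) (n : nat) : broken N 1 :=
  if n is 0%N then L2_projection p rho0 else fun K x => u (w n K x).

Definition scheme_step (eps tau : R) (rho : broken N 1)
    (w : broken N 1) (sigma : broken N d.+1) : Prop :=
  [/\ Sp_mx p w, Sp_mx p sigma,
      forall phi : broken N d.+1, Sp_mx p phi ->
        integral_Omega (fun K x =>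
          frob ((A (u (w K x)))^T *m hess s (u (w K x)) *m sigma K x)
               (phi K x)) =
        integral_Omega (fun K x =>
          frob ((A (u (w K x)))^T *m zeta_h p w K x) (phi K x)) &
      forall lambda : broken N 1, Sp_mx p lambda ->
        eps * tau * (\sum_i c_h (component w i) (component lambda i))
        + integral_Omega (fun K x =>
            frob (u (w K x) - rho K x) (lambda K x))
        + tau * integral_Omega (fun K x =>
            frob (A (u (w K x)) *m sigma K x) (zeta_h p lambda K x))
        + tau * (\sum_i s_h (Linfty_norm D A)
                   (component w i) (component lambda i))
        = tau * integral_Omega (fun K x =>
            frob (f (u (w K x))) (lambda K x))].

End scheme.
End ldg.

Section assumptions.
Variables (R : realType) (d N : nat).

Definition polytopic_lipschitz_domain (Omega : set 'rV[R]_d.+1) : Prop :=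
  [/\ domain Omega, bounded_set Omega, polytopic Omega
    & lipschitz_boundary Omega].

Record structural_assumptions (D : set 'cV[R]_N) (A : 'cV[R]_N -> 'M[R]_N)
    (f : 'cV[R]_N -> 'cV[R]_N) (s : 'cV[R]_N -> R)
    (u : 'cV[R]_N -> 'cV[R]_N) (gamma Cf : R) : Prop := {
  D_domain : domain D;
  D_bounded : bounded_set D;
  D_positive : forall rho, D rho -> forall i, 0 < rho i 0;
  A_continuous : {within closure D, continuous A};
  f_continuous : {within closure D, continuous f};
  s_convex : convex_function D s;
  s_C2 : C2_on D s;
  s_continuous : {within closure D, continuous s};
  s_positive : forall rho, closure D rho -> 0 < s rho;
  u_grad : forall rho, D rho -> u (grad s rho) = rho;
  u_in_D : forall w, D (u w);
  grad_u : forall w, grad s (u w) = w;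
  u_C1 : C1_on setT u;
  gamma_positive : 0 < gamma;
  Cf_nonneg : 0 <= Cf;
  coercivity : forall (z rho : 'cV[R]_N), D rho ->
    gamma * enorm z ^+ 2 <= frob z (hess s rho *m A rho *m z);
  f_bound : forall rho, D rho -> frob (f rho) (grad s rho) <= Cf }.

Definition admissible_datum (Omega : set 'rV[R]_d.+1) (D : set 'cV[R]_N)
    (rho0 : 'rV[R]_d.+1 -> 'cV[R]_N) : Prop :=
  (forall i, essentially_bounded Omega (fun x => rho0 x i 0)) /\
  ae_on Omega (fun x => D (rho0 x)).

Definition time_partition (T : R) (Nt : nat) (t : nat -> R) : Prop :=
  [/\ t 0%N = 0, t Nt = T & forall n, (n < Nt)%N -> t n < t n.+1].

End assumptions.

(* Main.v *)
(* The coefficients of w and sigma in bases of the discrete spaces are taken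
   together as the unknown z of a finite system G(z) = 0 with G continuous. In
   the pairing of G(z) with z, which tests the balance equation with w and tau
   times the flux equation with sigma, the coupling terms in zeta_h(w) cancel.
   What remains is bounded below by
     eps tau c_h(w, w) + tau gamma |sigma|^2 - K1 |z| - K2,
   because hess s is symmetric, u is bounded and f . s' <= C_f. As c_h and the
   L^2 product are positive definite on polynomials, the pairing is positive for
   |z| large, and a zero of G exists by Brouwer's theorem. The latter is obtained
   from Scarf's combinatorial lemma on linear orders, which needs no
   triangulation and is a parity count. *)
Require Import Defs.
From mathcomp Require Import all_boot all_order all_algebra.

Set Implicit Arguments.
Unset Strict Implicit.
Unset Printing Implicit Defensive.

(** * Scarf's lemma *)

Section Scarf.
Variables (V I : finType) (rank : I -> V -> nat) (col : V -> I).
Hypothesis rank_inj : forall i, injective (rank i).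
Implicit Types (S T : {set V}) (C D : {set I}).

(** As [u] maps all of R^N into D, the unknown w is unconstrained, and w equals [grad s] at u(w):
    this is how the bound on f against the entropy gradient controls the source term tested with w.
    The coercivity of [hess s] times A controls only sigma, and the jump stabilization is merely
    nonnegative, so control of w rests on the eps-regularization. The time difference grows linearly
    in the coefficients of w and is dominated by that quadratic term. Only continuity of the
    previous density enters its estimate, which covers the first step, where an L^2 projection may
    leave D. Keeping sigma as an unknown avoids inverting a mass matrix that depends on w.
    Continuity of G rests on compactness, as the integrands are jointly continuous in coefficients
    and position. The zero is sought on a simplex rather than a ball because a labelled simplex grid
    leads directly to a complementarity problem, whose solutions with positive weights are zeros. *)

Definition below i y S := [forall x in S, rank i y <= rank i x].
(** Scarf's dominant sets: for nonempty S, no point of V lies strictly above the minima of S in all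
    the orders of C at once. *)
Definition dominates C S := [forall y, [exists i in C, below i y S]].

Lemma belowP i y S :
  reflect (forall x, x \in S -> rank i y <= rank i x) (below i y S).
Proof. exact: forall_inP. Qed.

Lemma dominatesP C S :
  reflect (forall y, exists2 i, i \in C & below i y S) (dominates C S).
Proof. by apply: (iffP forallP) => H y; apply/exists_inP; apply: H. Qed.

Lemma dominates_sub C C' S S' :
  C \subset C' -> S' \subset S -> dominates C S -> dominates C' S'.
Proof.
move=> CC' S'S /dominatesP H; apply/dominatesP => y.
have [i iC /belowP iy] := H y; exists i; first exact: subsetP iC.
by apply/belowP => x xS'; apply: iy; apply: (subsetP S'S).
Qed.

Definition owner x0 S i := [arg min_(x < x0 in S) rank i x].

Lemma owner_in x0 S i : x0 \in S -> owner x0 S i \in S.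
Proof. by move=> x0S; rewrite /owner; case: arg_minnP. Qed.

Lemma owner_below x0 S i : x0 \in S -> below i (owner x0 S i) S.
Proof.
by move=> x0S; rewrite /owner; case: arg_minnP => // x _ H; apply/belowP.
Qed.

Lemma below_owner x0 S i x :
  x0 \in S -> x \in S -> below i x S -> owner x0 S i = x.
Proof.
move=> x0S xS /belowP H; apply: (@rank_inj i); apply/eqP; rewrite eqn_leq.
rewrite H ?owner_in // andbT.
by have /belowP := owner_below i x0S; apply.
Qed.

Lemma belowNowner x0 S i y :
  x0 \in S -> ~~ below i y S = (rank i (owner x0 S i) < rank i y).
Proof.
move=> x0S; rewrite ltnNge; congr (~~ _); apply/belowP/idP => [|H x xS].
  by apply; rewrite owner_in.
by apply: leq_trans H _; have /belowP := owner_below i x0S; apply.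
Qed.

(** Dominance applied to a point of S itself makes this point the minimum of S in some order of C.
    So the owner map is a bijection for a cell, and for a door with points exactly two indices share
    an owner. *)
Lemma owner_onto x0 S C :
  x0 \in S -> dominates C S -> owner x0 S @: C = S.
Proof.
move=> x0S /dominatesP H; apply/setP => x; apply/imsetP/idP.
  by case=> i _ ->; rewrite owner_in.
move=> xS; have [i iC ix] := H x; exists i => //.
by rewrite (below_owner x0S xS ix).
Qed.

(** Cells play the role of the maximal simplices of a triangulation and doors that of their facets;
    a door is turned into a cell by adding a point or by dropping an index. *)
Definition is_cell (p : {set V} * {set I}) :=
  dominates p.2 p.1 && (#|p.1| == #|p.2|).
Definition door (q : {set V} * {set I}) :=
  dominates q.2 q.1 && (#|q.2| == #|q.1|.+1).
Definition incident (p q : {set V} * {set I}) :=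
  (q.1 \subset p.1) && (p.2 \subset q.2).

(** The sizes of the four sets satisfy #|q.1| <= #|p.1| = #|p.2| <= #|q.2| = #|q.1| + 1, so exactly
    one of the two inclusions is strict, and by one element. *)
Lemma incidentP p q : is_cell p -> door q -> incident p q ->
  (p.1 = q.1 /\ exists2 i, i \in q.2 & p.2 = q.2 :\ i) \/
  (p.2 = q.2 /\ exists2 y, y \notin q.1 & p.1 = y |: q.1).
Proof.
case: p q => [S C] [T D] /andP[_ /= /eqP cp] /andP[_ /= /eqP cq] /andP[/= TS CD].
have [eT|nT] := eqVneq S T.
  left; split=> //; subst T.
  have /cards1P[i Ei] : #|D :\: C| == 1.
    by rewrite cardsD (setIidPr CD) cq -cp subSnn.
  have /setDP[iD iC] : i \in D :\: C by rewrite Ei set11.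
  exists i => //; apply/eqP; rewrite eqEcard; apply/andP; split.
    apply/subsetP=> k kC; rewrite !inE (subsetP CD) // andbT.
    by apply: contraNneq iC => <-.
  by have := cardsD1 i D; rewrite iD cq -cp add1n => -[<-].
right; have TpS : T \proper S by rewrite properEneq eq_sym nT.
have ltTS := proper_card TpS.
have eCD : C = D.
  by apply/eqP; rewrite eqEcard CD /= cq -cp.
split=> //; subst D.
have /cards1P[y Ey] : #|S :\: T| == 1.
  by rewrite cardsD (setIidPr TS) cp cq subSnn.
have : y \in S :\: T by rewrite Ey set11.
case/setDP=> yS yT; exists y => //.
by rewrite -Ey setUC -{1}(setIidPr TS) setID.
Qed.

(* The obstructions to the dominance of T once the index i is dropped. *)
Definition escape T D i := [set y | [forall k in D :\ i, ~~ below k y T]].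

Definition cell_of T D i : {set V} * {set I} :=
  if [pick y in escape T D i] is Some y0
  then ([arg max_(y > y0 in escape T D i) rank i y] |: T, D)
  else (T, D :\ i).

Lemma escapeP T D i y :
  reflect (forall k, k \in D -> k != i -> ~~ below k y T) (y \in escape T D i).
Proof.
rewrite inE; apply: (iffP forall_inP) => H k.
  by move=> kD ki; apply: H; rewrite !inE ki.
by rewrite !inE => /andP[ki kD]; apply: H.
Qed.

Lemma below_escape T D i y : dominates D T -> y \in escape T D i -> below i y T.
Proof.
move=> /dominatesP/(_ y)[k kD ky] /escapeP H.
by have [<- //|ki] := eqVneq k i; have := H _ kD ki; rewrite ky.
Qed.

Lemma belowU1 i y x T : below i y (x |: T) = (rank i y <= rank i x) && below i y T.
Proof.
apply/belowP/andP => [H|[yx /belowP H] z /setU1P[->//|/H//]].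
by split; [apply: H; rewrite setU11|apply/belowP=> z zT; apply: H; rewrite setU1r].
Qed.

(* Either no point escapes and i can be dropped, or the escaping point with
   the highest rank for i is added. *)
Lemma cell_of_cell T D i : door (T, D) -> i \in D ->
  (forall y, y \in escape T D i -> y \notin T) ->
  is_cell (cell_of T D i) && incident (cell_of T D i) (T, D).
Proof.
case/andP=> /= dTD /eqP cD iD ET; rewrite /cell_of; case: pickP => [y0 y0E|E0].
  case: arg_maxnP => //= y yE ymax.
  have yT := ET _ yE.
  rewrite /is_cell /incident /= cardsU1 yT cD add1n eqxx subsetUr subxx !andbT.
  apply/dominatesP => z; have [zE|] := boolP (z \in escape T D i).
    by exists i => //; rewrite belowU1 ymax //=; apply: below_escape zE.
  (* If z does not escape, it is below T in some order k other than i. In that order y lies above a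
     point of T, hence above z, and adding y keeps z dominated. *)
  rewrite inE negb_forall_in => /exists_inP[k]; rewrite !inE negbK => /andP[ki kD] kz.
  exists k => //; rewrite belowU1 kz andbT.
  move/escapeP : (yE) => /(_ k kD ki); rewrite /below negb_forall_in.
  case/exists_inP => x xT; rewrite -ltnNge => /ltnW; apply: leq_trans.
  by move/belowP: kz; apply.
rewrite /is_cell /incident /= subxx subsetDl andbT /=.
have := cardsD1 i D; rewrite iD cD add1n => -[<-]; rewrite eqxx andbT.
rewrite andbT; apply/dominatesP => y; have := E0 y; rewrite inE => /negbT.
by rewrite negb_forall_in => /exists_inP[k kD]; rewrite negbK; exists k.
Qed.

(** Dominance of p decides the case: with i dropped no point can escape, and with an escaping point
    added every other escaping point must be below it in the order i, so it is the maximum. *)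
Lemma cell_of_uniq p T D i : door (T, D) -> is_cell p -> incident p (T, D) ->
  i \in D ->
  p.1 = T /\ p.2 = D :\ i \/
  (exists2 y, y \in escape T D i & p.1 = y |: T) /\ p.2 = D ->
  p = cell_of T D i.
Proof.
case: p => [S C] dq /andP[/= /dominatesP pd _] _ iD /=.
rewrite /cell_of; case=> [[ES EC]|[[x xE ES] EC]]; case: pickP => [y0 y0E|E0]; subst.
- have [k kD ky] := pd y0; move: y0E; rewrite inE => /forall_inP/(_ k kD).
  by rewrite ky.
- by [].
- case: arg_maxnP => // y yE ymax; suff -> : x = y by [].
  apply: (@rank_inj i); apply/eqP; rewrite eqn_leq (ymax x xE : _ <= _) /=.
  have [k kD ky] := pd y; have [ki|ki] := eqVneq k i.
    by move: ky; rewrite ki belowU1 => /andP[].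
  by move/escapeP: yE => /(_ k kD ki); move: ky; rewrite belowU1 => /andP[_ ->].
- by have := E0 x; rewrite xE.
Qed.

(** The owner map sends D onto T, which has one element less, so precisely two indices i and j
    collide. Freeing either of them gives one cell, and no other index can be freed. *)
Lemma door_degree T D x0 : x0 \in T -> door (T, D) ->
  #|[set p | is_cell p && incident p (T, D)]| = 2.
Proof.
move=> x0T dq; have /andP[/= dTD /eqP cD] := dq.
pose f := owner x0 T; have fD : f @: D = T by apply: owner_onto.
have [i [j [iD jD ij fij]]] : exists i j, [/\ i \in D, j \in D, i != j & f i = f j].
  have : ~~ [forall i in D, forall j in D, (f i == f j) ==> (i == j)].
    apply/negP => H; have : #|f @: D| = #|D|.
      apply: card_in_imset => i j iD jD fij.
      by move/forall_inP: H => /(_ i iD)/forall_inP/(_ j jD); rewrite fij eqxx => /eqP.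
    by rewrite fD cD => /eqP; rewrite eq_sym eqn_leq ltnn.
  rewrite negb_forall_in => /exists_inP[i iD]; rewrite negb_forall_in.
  move=> /exists_inP[j jD]; rewrite negb_imply => /andP[/eqP fij ij].
  by exists i, j.
have fDi k l : k \in D -> l \in D -> k != l -> f k = f l ->
    f @: (D :\ k) = T /\ {in D :\ k &, injective f}.
  move=> kD lD kl fkl; have E : f @: (D :\ k) = T.
    rewrite -[RHS]fD; apply/setP => x; apply/imsetP/imsetP => -[m].
      by rewrite !inE => /andP[_ mD] ->; exists m.
    move=> mD ->; have [->|mk] := eqVneq m k; last by exists m; rewrite // !inE mk.
    by exists l => //; rewrite !inE eq_sym kl.
  split=> //; apply/imset_injP; rewrite E; have := cardsD1 k D.
  by rewrite kD cD add1n => -[->].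
have escT k l : k \in D -> l \in D -> k != l -> f k = f l ->
    forall y, y \in escape T D k -> y \notin T.
  move=> kD lD kl fkl y /escapeP yE; apply/negP => yT.
  have [E _] := fDi k l kD lD kl fkl.
  move: yT; rewrite -E => /imsetP[m]; rewrite !inE => /andP[mk mD] Em.
  by have := yE m mD mk; rewrite Em owner_below.
have /andP[ci ii] := cell_of_cell dq iD (escT i j iD jD ij fij).
have ji : j != i by rewrite eq_sym.
have /andP[cj ij'] := cell_of_cell dq jD (escT j i jD iD ji (esym fij)).
suff -> : [set p | is_cell p && incident p (T, D)] =
    [set cell_of T D i; cell_of T D j].
  (* The two cells differ: a point added in both would escape for i and for j, against the dominance
     of T. *)
  rewrite cards2; suff -> : cell_of T D i != cell_of T D j by [].
  apply/eqP; rewrite /cell_of.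
  case: pickP => [y0 y0E|E0]; case: pickP => [y1 y1E|E1].
  - case: arg_maxnP => // y yE _; case: arg_maxnP => // z zE _ [Ey].
    have yz : y = z.
      have : y \in z |: T by rewrite -Ey setU11.
      by rewrite !inE (negPf (escT i j iD jD ij fij _ yE)) orbF => /eqP.
    subst z; have /dominatesP/(_ y)[k kD ky] := dTD.
    have [ki|ki] := eqVneq k i.
      by move/escapeP: zE => /(_ k kD); rewrite ki ij => /(_ isT); rewrite -ki ky.
    by move/escapeP: yE => /(_ k kD ki); rewrite ky.
  - case=> _ E; have : j \in D by [].
    by rewrite E !inE eqxx.
  - case=> _ E; have : i \in D by [].
    by rewrite -E !inE eqxx.
  - case=> E; have : i \in D :\ j by rewrite !inE ij.
    by rewrite -E !inE eqxx.
apply/setP => p; rewrite in_set2 inE; apply/idP/idP; last first.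
  by case/orP=> /eqP ->; [rewrite ci ii|rewrite cj ij'].
(* Conversely, an incident cell has a bijective owner map, so the index that is dropped, or the one
   owned by the added point, must be i or j. *)
case/andP=> cp ip; have [[E1 [k kD E2]]|[E2 [y yT E1]]] := incidentP cp dq ip.
  have kij : (k == i) || (k == j).
    apply/negPn/negP; rewrite negb_or => /andP[ki kj].
    have /andP[dp /eqP cpE] := cp.
    have x0p : x0 \in p.1 by rewrite E1.
    have Ep := owner_onto x0p dp; have : {in p.2 &, injective (owner x0 p.1)}.
      by apply/imset_injP; rewrite Ep cpE.
    move=> /(_ i j); rewrite E1 E2 !inE !(eq_sym _ k) ki kj iD jD => /(_ isT isT fij)/eqP.
    by rewrite (negPf ij).
  by case/orP: kij => /eqP Ek; apply/orP; [left|right]; apply/eqP;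
    apply: cell_of_uniq => //; left; rewrite E2 Ek.
rewrite /= in E1 E2 yT.
have /andP[dp /eqP cpE] := cp.
have yp : y \in p.1 by rewrite E1 setU11.
have x0p : x0 \in p.1 by rewrite E1 setU1r.
have Ep := owner_onto x0p dp.
have gi : {in p.2 &, injective (owner x0 p.1)} by apply/imset_injP; rewrite Ep cpE.
have : y \in owner x0 p.1 @: p.2 by rewrite Ep.
case/imsetP=> k kp yk; rewrite E2 in kp.
(* Only k changes its owner when y is added; in all other orders y is not below T, which means that
   y escapes for k. *)
have gf m : m \in D -> m != k -> owner x0 p.1 m = f m /\ ~~ below m y T.
  move=> mD mk; have gT : owner x0 p.1 m \in T.
    have := owner_in m x0p; rewrite {2}E1 => /setU1P[E|//].
    by move: mk; rewrite (gi m k) ?E2 ?eqxx // E.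
  have gb := owner_below m x0p.
  have gfm : f m = owner x0 p.1 m.
    by apply: below_owner => //; move: gb; rewrite {2}E1 belowU1 => /andP[].
  split=> //; rewrite (belowNowner _ _ x0T) -/f gfm.
  rewrite ltn_neqAle; apply/andP; split.
    by apply/eqP => /(@rank_inj m) E; move: yT; rewrite -E gT.
  by move/belowP: gb; apply.
have yE : y \in escape T D k by apply/escapeP => m mD mk; case: (gf m mD mk).
have kij : (k == i) || (k == j).
  apply/negPn/negP; rewrite negb_or => /andP[ki kj].
  have := gi i j; rewrite E2 => /(_ iD jD).
  have [-> _] := gf i iD (contraNneq (fun e => introT eqP (esym e)) ki).
  have [-> _] := gf j jD (contraNneq (fun e => introT eqP (esym e)) kj).
  by move=> /(_ fij)/eqP; rewrite (negPf ij).
by case/orP: kij => /eqP Ek; apply/orP; [left|right]; apply/eqP;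
  apply: cell_of_uniq => //; right; rewrite ?E2; split=> //; exists y; rewrite -?Ek.
Qed.

(** The odd door of the parity count: dropping [i0] would leave no index, and an empty index set
    dominates nothing once V has a point. Only the maximum of the order [i0] can be added. *)
Lemma first_door_degree (v0 : V) i0 :
  #|[set p | is_cell p && incident p (set0, [set i0])]| = 1.
Proof.
have dq : door (set0, [set i0]).
  rewrite /door /= cards0 cards1 eqxx andbT; apply/dominatesP => y.
  by exists i0; rewrite ?set11 //; apply/belowP => x; rewrite inE.
have E0 y : y \in escape set0 [set i0] i0.
  by apply/escapeP => k /set1P ->; rewrite eqxx.
have /andP[c1 i1] : is_cell (cell_of set0 [set i0] i0) &&
    incident (cell_of set0 [set i0] i0) (set0, [set i0]).
  by apply: cell_of_cell; rewrite ?set11 // => y _; rewrite in_set0.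
apply/eqP/cards1P; exists (cell_of set0 [set i0] i0).
apply/setP => p; rewrite in_set1 inE; apply/idP/eqP => [|->]; last by rewrite c1 i1.
case/andP=> cp ip; have [[E1 [k]]|[E2 [y _ E1]]] := incidentP cp dq ip.
  rewrite [_.2]/= => /set1P -> E2; have /andP[/dominatesP/(_ v0)[k' k'p _] _] := cp.
  by move: k'p; rewrite E2 /= !inE; case: eqP.
apply: cell_of_uniq; rewrite ?set11 //; right; split=> //.
by exists y; rewrite ?E0.
Qed.

(** Such a T has at least #|S| - 1 points, so it is S or S without one point. If the colours of S
    are exactly C, only the points of colour other than [i0] form such a set; otherwise the
    admissible sets come in a pair or do not exist. *)
Lemma facet_parity (i0 : I) S C : #|S| = #|C| ->
  odd #|[set T in powerset S | [&& C \subset i0 |: col @: T,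
      i0 \notin col @: T & #|col @: T| == #|T|]]| = (col @: S == C).
Proof.
move=> cSC; set F := [set T in _ | _].
have inF T : T \in F -> [/\ T \subset S, C \subset i0 |: col @: T,
    i0 \notin col @: T & {in T &, injective col}].
  by rewrite inE powersetE => /and4P[? ? ? /imset_injP].
have Fin T : T \subset S -> C \subset i0 |: col @: T -> i0 \notin col @: T ->
    {in T &, injective col} -> T \in F.
  by move=> ? ? ? /imset_injP ?; rewrite inE powersetE; apply/and4P.
have [ESC|NSC] := eqVneq (col @: S) C.
  have injS : {in S &, injective col} by apply/imset_injP; rewrite ESC cSC.
  suff -> : F = [set [set x in S | col x != i0]] by rewrite cards1.
  apply/setP => T; rewrite in_set1; apply/idP/eqP => [/inF[TS CT iT injT]|->].
    apply/setP => x; rewrite inE; apply/idP/andP => [xT|[xS xi0]].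
      rewrite (subsetP TS) //; split=> //; apply: contraNneq iT => <-.
      exact: imset_f.
    have : col x \in i0 |: col @: T by apply: (subsetP CT); rewrite -ESC imset_f.
    rewrite !inE (negPf xi0) /= => /imsetP[y yT xy].
    by rewrite (injS x y) // (subsetP TS).
  apply: Fin; first by apply/subsetP => x; rewrite inE => /andP[].
  - rewrite -ESC; apply/subsetP => j /imsetP[x xS ->]; rewrite !inE.
    by case: eqVneq => //= xi0; apply: imset_f; rewrite inE xS.
  - by apply/imsetP => -[x]; rewrite inE => /andP[_ /negPf xi0] /esym/eqP; rewrite xi0.
  - by move=> x y; rewrite !inE => /andP[xS _] /andP[yS _]; apply: injS.
have [/set0Pn[T TF]|/negPn/eqP ->] := boolP (F != set0); last by rewrite cards0.
have [TS CT iT injT] := inF T TF.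
have cardF T' : T' \in F -> #|S| <= #|T'|.+1.
  case/inF => _ CT' iT' injT'; rewrite cSC; apply: leq_trans (subset_leq_card CT') _.
  by rewrite cardsU1 iT' (card_in_imset injT').
suff [T1 [T2 [T12 EF]]] : exists T1 T2, T1 != T2 /\ F = [set T1; T2].
  by rewrite EF cards2 T12.
have faces T' : T' \in F -> T' = S \/ exists2 x, x \in S & T' = S :\ x.
  move=> T'F; have [T'S _ _ _] := inF T' T'F; have cT' := cardF T' T'F.
  have [->|nS] := eqVneq T' S; first by left.
  right; have ltT' : T' \proper S by rewrite properEneq nS.
  have /cards1P[x Ex] : #|S :\: T'| == 1.
    rewrite cardsD (setIidPr T'S) eqn_leq leq_subLR addn1 cT'.
    by rewrite subn_gt0 proper_card.
  exists x; first by have /setDP[] : x \in S :\: T' by rewrite Ex set11.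
  by rewrite -Ex setDDr setDv set0U (setIidPr T'S).
have nSD x : x \in S -> S != S :\ x.
  by move=> xS; apply/eqP => E; move: (xS); rewrite E !inE eqxx.
have [SF|SNF] := boolP (S \in F).
  (* If S itself is admissible, then [i0] lies in C, exactly one point x of S has a colour outside
     C, and x is the only point that can be removed. *)
  have [_ CS iS injS] := inF S SF.
  have i0C : i0 \in C.
    apply: contraNT NSC => i0C; rewrite eq_sym eqEcard (card_in_imset injS) cSC leqnn.
    rewrite andbT; apply/subsetP => j jC; have := subsetP CS j jC.
    by rewrite !inE; case: eqP => // ji; rewrite -ji jC in i0C.
  have /cards1P[x Ex] : #|[set y in S | col y \notin C]| == 1.
    have -> : #|[set y in S | col y \notin C]| = #|col @: S :\: C|.
      rewrite -(card_in_imset (f := col)); last first.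
        by move=> u v; rewrite !inE => /andP[uS _] /andP[vS _]; apply: injS.
      apply: eq_card => j; rewrite !inE; apply/imsetP/andP.
        by case=> y; rewrite inE => /andP[yS yC] ->; rewrite imset_f.
      by case=> jC /imsetP[y yS jy]; exists y => //; rewrite inE yS -jy.
    rewrite cardsD (card_in_imset injS); suff -> : col @: S :&: C = C :\ i0.
      by rewrite cSC (cardsD1 i0) i0C add1n subSnn.
    apply/setP => j; rewrite !inE; case: eqVneq => [->|ji]; first by rewrite (negPf iS).
    apply/andP/idP => [[]//|jC]; split=> //.
    by have := subsetP CS j jC; rewrite !inE (negPf ji).
  have Dx y : y \in S -> (S :\ y \in F) = (y == x).
    move=> yS; transitivity (y \in [set x]); last by rewrite inE.
    rewrite -Ex inE yS /=; apply/idP/idP => [/inF[_ CSy _ _]|yC].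
      apply/negP => /(subsetP CSy); rewrite !inE => /orP[/eqP E|].
        by move: iS; rewrite -E imset_f.
      case/imsetP => z; rewrite !inE => /andP[zy zS] /(injS _ _ yS zS) E.
      by rewrite E eqxx in zy.
    apply: Fin; first exact: subsetDl.
    - apply/subsetP => j jC; have := subsetP CS j jC; rewrite !inE => /orP[->//|].
      case/imsetP => z zS jz; apply/orP; right; rewrite jz; apply: imset_f.
      by rewrite !inE zS andbT; apply: contraNneq yC => <-; rewrite -jz.
    - by apply: contra iS; apply/subsetP/imsetS/subsetDl.
    - by move=> u v; rewrite !inE => /andP[_ uS] /andP[_ vS]; apply: injS.
  have /setIdP[xS _] : x \in [set y in S | col y \notin C] by rewrite Ex set11.
  exists S, (S :\ x); split; first exact: nSD.
  apply/setP => T'; rewrite in_set2; apply/idP/orP => [T'F|[/eqP->//|/eqP->]].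
    have [->|[y yS ET']] := faces T' T'F; first by left.
    by right; rewrite ET' -(eqP (_ : y == x)) // -Dx // -ET'.
  by rewrite Dx.
have [E|[x xS ET]] := faces T TF; first by rewrite -E TF in SNF.
(* Here S without x is admissible but S is not, so x shares its colour with exactly one other point,
   and removing that point instead gives the partner. *)
subst T; have EC : C = i0 |: col @: (S :\ x).
  apply/eqP; rewrite eqEcard CT cardsU1 iT (card_in_imset injT) -cSC.
  by rewrite [X in _ <= X](cardsD1 x S) xS leqnn.
have ES : col @: S = col x |: col @: (S :\ x) by rewrite -imsetU1 setD1K.
have xi0 : col x != i0.
  by apply: contraNneq NSC => E; rewrite EC ES E.
have iS : i0 \notin col @: S.
  by rewrite -(setD1K xS) imsetU1 !inE negb_or eq_sym xi0.
have : col x \in col @: (S :\ x).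
  apply: contraNT SNF => xT; apply: Fin => //.
    by apply: subset_trans CT _; apply/setUS/imsetS/subsetDl.
  by apply/imset_injP; rewrite ES cardsU1 xT (card_in_imset injT) (cardsD1 x S) xS.
case/imsetP => x'; rewrite !inE => /andP[x'x x'S] xx'.
have EI : col @: (S :\ x') = col @: (S :\ x).
  apply/setP => j; apply/imsetP/imsetP => -[y]; rewrite !inE => /andP[yn yS] ->.
    have [->|yx] := eqVneq y x; last by exists y; rewrite ?inE ?yx.
    by exists x'; rewrite ?inE ?x'x.
  have [->|yx] := eqVneq y x'; last by exists y; rewrite ?inE ?yx.
  by exists x; rewrite ?inE 1?eq_sym ?x'x.
exists (S :\ x), (S :\ x'); split.
  apply/eqP => E; have : x' \in S :\ x by rewrite !inE x'x.
  by rewrite E !inE eqxx.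
apply/setP => T'; rewrite in_set2; apply/idP/orP => [T'F|[/eqP->//|/eqP->]]; last first.
  apply: Fin; rewrite ?EI ?subsetDl //; apply/imset_injP.
  rewrite EI (card_in_imset injT); have := cardsD1 x S; rewrite (cardsD1 x') xS x'S.
  by move/eqP; rewrite !add1n eqSS eq_sym.
have [E|[y yS ET']] := faces T' T'F; first by rewrite -E T'F in SNF.
have [_ _ _ injT'] := inF T' T'F.
have : (y == x) || (y == x').
  apply/negPn/negP; rewrite negb_or => /andP[yx yx'].
  have xT' : x \in T' by rewrite ET' !inE eq_sym yx.
  have x'T' : x' \in T' by rewrite ET' !inE eq_sym yx'.
  by move: x'x; rewrite (injT' x x' xT' x'T' xx') eqxx.
by case/orP => /eqP <-; [left|right]; rewrite ET'.
Qed.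

(** As in Sperner's lemma, [i0] is the one index whose colour is missing. The only such door without
    points is the first one. *)
Definition coloured_door i0 (q : {set V} * {set I}) :=
  [&& q.2 == i0 |: col @: q.1, i0 \notin col @: q.1 & #|col @: q.1| == #|q.1|].

(** Incidences of coloured doors and cells are counted twice. By doors the number is odd, since all
    have degree two except the first, which has degree one; by cells its parity is that of the
    number of cells whose colours are their indices. *)
Theorem scarf (v0 : V) (i0 : I) :
  exists S C, [/\ S != set0, dominates C S & col @: S = C].
Proof.
pose cells := [set p | is_cell p].
pose doors := [set q | door q && coloured_door i0 q].
have odd_doors : odd (\sum_(q in doors) \sum_(p in cells) incident p q).
  have d0 : (set0, [set i0]) \in doors.
    rewrite inE /coloured_door /= imset0 setU0 !cards0 inE !eqxx /= andbT.
    rewrite /door /= cards0 cards1 eqxx andbT; apply/dominatesP => y.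
    by exists i0; rewrite ?set11 //; apply/belowP => x; rewrite inE.
  have deg q : \sum_(p in cells) incident p q = #|[set p | is_cell p && incident p q]|.
    rewrite -sum1_card big_mkcond [RHS]big_mkcond /=; apply: eq_bigr => p _.
    by rewrite !inE; case: is_cell; case: incident.
  rewrite (bigD1 _ d0) deg first_door_degree // oddD addTb.
  elim/big_ind: _ => [//|m n /negPf om /negPf on|[T D]]; first by rewrite oddD om on.
  case/andP=> qd q0; have : (T, D) \in doors := qd.
  rewrite inE => /andP[dq cq]; rewrite deg.
  have [T0|[x0 x0T]] := set_0Vmem T; last by rewrite (door_degree x0T dq).
  move: cq q0; rewrite T0 /coloured_door /= imset0 setU0 => /andP[/eqP -> _].
  by rewrite eqxx.
have deg p : p \in cells ->
    odd (\sum_(q in doors) incident p q) = (col @: p.1 == p.2).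
  rewrite inE => cp; have /andP[dp /eqP card_p] := cp.
  rewrite -(facet_parity i0 card_p); congr odd.
  (* A coloured door is determined by its point set, so those incident to p are counted by the sets
     of [facet_parity]. *)
  pose h T := (T, i0 |: col @: T); rewrite -(card_imset _ (_ : injective h)); last first.
    by move=> T T' [].
  rewrite -sum1_card big_mkcond [RHS]big_mkcond /=; apply: eq_bigr => -[T D] _.
  rewrite inE; suff -> : ((T, D) \in h @: [set T0 in powerset p.1 |
      [&& p.2 \subset i0 |: col @: T0, i0 \notin col @: T0
        & #|col @: T0| == #|T0|]]) =
      door (T, D) && coloured_door i0 (T, D) && incident p (T, D).
    by case: (_ && coloured_door _ _); case: incident.
  rewrite /coloured_door /incident /=; apply/imsetP/idP => [[T']|].
    rewrite inE powersetE => /and4P[T'S pT' iT' cT'] [-> ->].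
    rewrite eqxx iT' cT' T'S pT' /= !andbT /door /= cardsU1 iT' (eqP cT') add1n eqxx.
    by rewrite andbT; apply: dominates_sub dp.
  case/andP=> /andP[dq /and3P[/eqP ED iT cT]] /andP[TS CD].
  exists T; last by rewrite /h -ED.
  by rewrite inE powersetE TS -ED CD iT cT.
have [/existsP[[S C] /andP[cp /eqP Ep]]|/existsPn none] :=
    boolP [exists p, is_cell p && (col @: p.1 == p.2)].
  exists S, C; have /andP[dC /eqP cSC] := cp; split=> //.
  have /dominatesP/(_ v0)[i iC _] := dC.
  by rewrite -card_gt0 cSC card_gt0; apply/set0Pn; exists i.
suff /negPf : ~~ odd (\sum_(q in doors) \sum_(p in cells) incident p q).
  by rewrite odd_doors.
rewrite exchange_big; elim/big_ind: _ => [//|m n /negPf om /negPf on|p pc].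
  by rewrite oddD om on.
by rewrite deg //; have := none p; move: pc; rewrite inE => ->.
Qed.

End Scarf.

(** * Labelled grid points of a simplex *)

Section GridLabelling.
Variables n k : nat.
Let grid := {v : {ffun 'I_n.+1 -> 'I_k.+1} | \sum_i v i == k}.

(** A number with two digits: the coordinate leads and the enumeration of the grid breaks ties, so
    the order is linear and still compares coordinates. *)
Let grid_rank (i : 'I_n.+1) (v : grid) := val v i * #|{: grid}| + enum_rank v.

Let grid_rank_inj i : injective (grid_rank i).
Proof.
move=> v w /(congr1 (modn^~ #|{: grid}|)); rewrite /grid_rank /= !modnMDl.
by rewrite !modn_small // => /val_inj/enum_rank_inj.
Qed.

Let grid_rank_le i v w : grid_rank i v <= grid_rank i w -> val v i <= val w i.
Proof.
rewrite leqNgt; apply: contraNleq => lt_wv; rewrite /grid_rank.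
apply: (@leq_trans ((val w i).+1 * #|{: grid}|)).
  by rewrite mulSn addnC ltn_add2r ltn_ord.
by apply: leq_trans (leq_addr _ _); rewrite leq_mul2r lt_wv orbT.
Qed.

Let grid_point (a : 'I_n.+1 -> nat) : \sum_i a i = k -> {v : grid | forall i, val v i = a i :> nat}.
Proof.
move=> ak; have ale i : a i < k.+1 by rewrite ltnS -ak (bigD1 i) ?leq_addr.
pose v := [ffun i => Ordinal (ale i)].
have vk : \sum_i v i == k by apply/eqP; rewrite -[RHS]ak; apply: eq_bigr => i _; rewrite ffunE.
by exists (Sub v vk) => i; rewrite SubK ffunE.
Qed.

(* Scarf's lemma for the coordinate orders, with ties broken arbitrarily: a
   dominating set of labelled grid points has small diameter, and its
   coordinates without a label are small. *)
Lemma grid_labelling (col : {ffun 'I_n.+1 -> 'I_k.+1} -> 'I_n.+1) :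
  exists (x : {ffun 'I_n.+1 -> 'I_k.+1}) (C : {set 'I_n.+1}),
  [/\ \sum_i x i = k, forall i, i \notin C -> x i <= n &
    forall i, i \in C -> exists y : {ffun 'I_n.+1 -> 'I_k.+1},
      [/\ \sum_i y i = k, col y = i &
        forall j, y j <= x j + n /\ x j <= y j + n]].
Proof.
have [v0 _] : {v : grid | forall i, val v i = (if i == ord0 then k else 0) :> nat}.
  by apply: grid_point; rewrite -big_mkcond big_pred1_eq.
have [S [C [/set0Pn[x xS] /dominatesP dom EC]]] :=
  scarf (col \o val) grid_rank_inj v0 ord0.
pose a i := val (owner grid_rank x S i) i : nat.
have a_min i y : y \in S -> a i <= val y i.
  move=> yS; apply: grid_rank_le.
  by have /belowP := owner_below grid_rank i xS; apply.
(* Otherwise raising every minimum [a i] with i in C by one, and putting the rest of k on an index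
   of C, would give a grid point above the minima in all orders of C. *)
have large : k < \sum_(i in C) (a i).+1.
  rewrite ltnNge; apply/negP => le_k.
  have [i0 i0C _] := dom v0.
  pose b i := (if i \in C then (a i).+1 else 0) +
              (if i == i0 then k - \sum_(i in C) (a i).+1 else 0).
  have [y yE] : {v : grid | forall i, val v i = b i :> nat}.
    apply: grid_point; rewrite big_split /= -!big_mkcond /= big_pred1_eq.
    exact: subnKC.
  have [i iC /belowP/(_ _ (owner_in grid_rank i xS))/grid_rank_le] := dom y.
  by rewrite yE /b iC leqNgt addSn ltnS leq_addr.
(* The coordinates of y sum to k, while the minima over C sum to at least k - n, so the total excess
   of y over them is at most n. This one bound gives both the diameter and the smallness outside
   C. *)
have slack y : y \in S ->
    \sum_(i in C) (val y i - a i) + \sum_(i | i \notin C) val y i <= n.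
  move=> yS; rewrite -(leq_add2l (\sum_(i in C) a i)) addnA -big_split /=.
  rewrite (eq_bigr (fun i => val y i : nat)); last by move=> i _; rewrite subnKC ?a_min.
  have -> : \sum_(i in C) val y i + \sum_(i | i \notin C) val y i = k.
    by apply: etrans (eqP (valP y)); rewrite [RHS](bigID (mem C)).
  rewrite -ltnS -addnS; apply: leq_trans large _.
  under eq_bigr do rewrite -addn1.
  rewrite big_split /= sum1_card leq_add2l.
  by apply: leq_trans (max_card _) _; rewrite card_ord.
have in_C y i : y \in S -> i \in C -> val y i <= a i + n.
  move=> yS iC; rewrite -leq_subLR; apply: leq_trans (slack y yS).
  by rewrite (bigD1 i) //= -addnA leq_addr.
have notin_C y i : y \in S -> i \notin C -> val y i <= n.
  move=> yS iC; apply: leq_trans (slack y yS).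
  by rewrite [X in _ + X](bigD1 i) //= addnCA leq_addr.
exists (val x), C; split; first exact: (eqP (valP x)).
  by move=> i; apply: notin_C.
move=> i; rewrite -EC => /imsetP[y yS iy].
exists (val y); split; [exact: (eqP (valP y))|by []|move=> j].
have [jC|jC] := boolP (j \in C); split.
- by apply: leq_trans (in_C y j yS jC) _; rewrite leq_add2r a_min.
- by apply: leq_trans (in_C x j xS jC) _; rewrite leq_add2r a_min.
- by apply: leq_trans (notin_C y j yS jC) (leq_addl _ _).
- by apply: leq_trans (notin_C x j xS jC) (leq_addl _ _).
Qed.

End GridLabelling.

From mathcomp Require Import all_classical all_reals all_analysis.
From mathcomp Require Import measurable_realfun ring lra.
Import Order.TTheory GRing.Theory Num.Theory.
Import numFieldNormedType.Exports.
Local Open Scope classical_set_scope.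
Local Open Scope ring_scope.

(** * Complementarity and zeros of coercive maps *)

Section Matrices.
Variable R : realType.

Lemma ler_mx_norm m n (x : 'M[R]_(m, n)) i j : `|x i j| <= `|x|.
Proof.
rewrite [leRHS]/Num.norm /= mx_normrE; apply/bigmax_geP; right => /=.
by exists (i, j).
Qed.

Lemma mx_norm_le m n (x : 'M[R]_(m, n)) (r : R) :
  0 <= r -> (forall i j, `|x i j| <= r) -> `|x| <= r.
Proof.
move=> r0 xr; rewrite [leLHS]/Num.norm /= mx_normrE.
by apply/bigmax_leP; split=> // -[i j] _; exact: xr.
Qed.

Lemma mx_norm_lt m n (x : 'M[R]_(m, n)) (r : R) :
  0 < r -> (forall i j, `|x i j| < r) -> `|x| < r.
Proof.
move=> r0 xr; rewrite [ltLHS]/Num.norm /= mx_normrE.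
by apply/bigmax_ltP; split=> // -[i j] _; exact: xr.
Qed.

Lemma continuous_cst (T U : topologicalType) (c : U) : continuous (fun _ : T => c).
Proof. by move=> x; exact: cvg_cst. Qed.

Lemma continuous_add (T : topologicalType) (V : normedModType R) (f g : T -> V) :
  continuous f -> continuous g -> continuous (fun x => f x + g x).
Proof. by move=> cf cg x; exact: cvgD (cf x) (cg x). Qed.

Lemma continuous_mul (T : topologicalType) (f g : T -> R) :
  continuous f -> continuous g -> continuous (fun x => f x * g x).
Proof. by move=> cf cg x; exact: cvgM (cf x) (cg x). Qed.

Lemma continuous_pair (T U V : topologicalType) (f : T -> U) (g : T -> V) :
  continuous f -> continuous g -> continuous (fun x => (f x, g x)).
Proof. by move=> cf cg x; exact: (cvg_pair (cf x) (cg x)). Qed.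

Lemma continuous_compose (T U V : topologicalType) (f : T -> U) (g : U -> V) :
  continuous f -> continuous g -> continuous (fun x => g (f x)).
Proof. by move=> cf cg x; exact: continuous_comp (cf x) (cg (f x)). Qed.

Lemma continuous_sum (T : topologicalType) (V : normedModType R) (I : Type)
    (r : seq I) (P : pred I) (F : I -> T -> V) :
  (forall i, continuous (F i)) -> continuous (fun x => \sum_(i <- r | P i) F i x).
Proof. by move=> cF; apply: continuous_big => //; exact: add_continuous. Qed.

Lemma continuous_mx (T : topologicalType) m n (F : T -> 'M[R]_(m, n)) :
  (forall i j, continuous (fun x => F x i j)) -> continuous F.
Proof.
move=> cF x; apply/cvgrPdist_lt => e e0.
have : \forall y \near x, forall ij : 'I_m * 'I_n, `|F x ij.1 ij.2 - F y ij.1 ij.2| < e.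
  apply: filter_forall => -[i j].
  by have /cvgrPdist_lt/(_ e e0) := cF i j x.
apply: filterS => y xy; apply: mx_norm_lt => // i j.
by rewrite !mxE; exact: (xy (i, j)).
Qed.

End Matrices.

(** * The standard simplex and coercive maps *)

Section Zero.
Variable R : realType.

Definition stdsimplex n : set 'rV[R]_n :=
  [set y | (forall i, 0 <= y 0 i) /\ \sum_i y 0 i = 1].

Lemma stdsimplex_le1 n (y : 'rV[R]_n) i : stdsimplex y -> y 0 i <= 1.
Proof.
by case=> y0 <-; rewrite (bigD1 i) //= lerDl sumr_ge0.
Qed.

Lemma stdsimplex_compact n : compact (@stdsimplex n).
Proof.
have cube : compact [set v : 'rV[R]_n | forall i, `[0, 1]%classic (v ord0 i)].
  by apply: (@rV_compact R n (fun=> `[0, 1]%classic)) => _; exact: segment_compact.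
apply: subclosed_compact cube _ => [|y Dy i]; last first.
  by rewrite /= in_itv /= (stdsimplex_le1 _ Dy) andbT; case: Dy.
rewrite (_ : @stdsimplex n = (\bigcap_i [set y : 'rV[R]_n | 0 <= y 0 i]) `&`
   [set y | \sum_i y 0 i = 1]); last first.
  apply/seteqP; split=> y [y0 y1]; split=> //; first by move=> i _; exact: y0.
  by move=> i; exact: y0.
apply: closedI; first apply: closed_bigI => i _.
  apply: (@closed_comp _ _ (fun y : 'rV[R]_n => y 0 i) [set x | 0 <= x]).
    by move=> y _; exact: coord_continuous.
  exact: closed_ge.
apply: (@closed_comp _ _ (fun y : 'rV[R]_n => \sum_i y 0 i) [set 1]).
  by move=> y _; apply: continuous_sum => i z; exact: coord_continuous.
exact: closed_eq.
Qed.

(* Label a grid point by an index that minimizes H: at a cluster point of the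
   sets given by [grid_labelling], the labelled coordinates minimize H and the
   others vanish. *)
Theorem complementarity n (H : 'rV[R]_n.+1 -> 'rV[R]_n.+1) : continuous H ->
  exists2 y, stdsimplex y & forall j, \sum_i y 0 i * H y 0 i <= H y 0 j.
Proof.
move=> cH.
have near_sol (k : nat) : exists x : 'rV[R]_n.+1, stdsimplex x /\
    exists C : {set 'I_n.+1}, (forall i, i \notin C -> x 0 i <= n%:R / k.+1%:R) /\
    forall i, i \in C -> exists z : 'rV[R]_n.+1,
      (forall j, `|z 0 j - x 0 j| <= n%:R / k.+1%:R) /\
      forall j, H z 0 i <= H z 0 j.
  (* The k-th grid has k + 1 subdivisions, so the denominator never vanishes. *)
  pose pt (v : {ffun 'I_n.+1 -> 'I_k.+2}) : 'rV[R]_n.+1 := \row_i ((v i)%:R / k.+1%:R).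
  pose col v := [arg min_(i < ord0) H (pt v) 0 i]%O.
  have colP v j : H (pt v) 0 (col v) <= H (pt v) 0 j.
    by rewrite /col; case: arg_minP => // i _; apply.
  have k0 : 0 < k.+1%:R :> R by rewrite ltr0n.
  have [x [C [xk xC Cx]]] := grid_labelling col.
  exists (pt x); split.
    split=> [i|]; first by rewrite mxE divr_ge0.
    under eq_bigr do rewrite mxE.
    by rewrite -mulr_suml -natr_sum xk divff // gt_eqF.
  exists C; split=> i iC; first by rewrite mxE ler_pM2r ?invr_gt0 // ler_nat xC.
  have [y [yk <- yx]] := Cx i iC; exists (pt y); split=> j; last exact: colP.
  rewrite !mxE -mulrBl normrM [X in _ * X]gtr0_norm ?invr_gt0 //.
  rewrite ler_pM2r ?invr_gt0 // ler_norml; have [yj xj] := yx j.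
  have : (y j)%:R <= (x j)%:R + n%:R :> R by rewrite -natrD ler_nat.
  have : (x j)%:R <= (y j)%:R + n%:R :> R by rewrite -natrD ler_nat.
  by lra.
have [X XP] := choice near_sol.
have [y [Dy cly]] : @stdsimplex n.+1 `&` cluster (X @ \oo) !=set0.
  by apply: stdsimplex_compact; exists 0%N => // k _; have [] := XP k.
exists y => // j; rewrite -subr_le0; apply/ler_addgt0Pr => e' e'0; rewrite add0r.
pose B := \sum_i `|H y 0 i - H y 0 j|.
have B0 : 0 <= B by apply: sumr_ge0.
(* Labelled indices contribute at most 2 e times their weight and the others at most 2 e
   [|H y 0 i - H y 0 j|]; the sum of all these bounds is 2 e (1 + B) = e'. *)
pose e := e' / (2 * (1 + B)).
have e0 : 0 < e by rewrite divr_gt0 // mulr_gt0 // ltr_pwDl.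
have /cvgrPdist_lt/(_ e e0)/nbhs_normP[d /= d0 Hd] := cH y.
have d2 : 0 < d / 2 by rewrite divr_gt0.
have [k [ky kn]] : exists k, `|y - X k| < Num.min (d / 2) e /\
    n%:R / k.+1%:R < Num.min (d / 2) e.
  have m0 : 0 < Num.min (d / 2) e by rewrite lt_min d2.
  (* Restricting the sequence to fine grids before using the cluster property gives a term that is
     both close to y and of small mesh size. *)
  pose A := [set X k | k in [set k | n%:R / k.+1%:R < Num.min (d / 2) e]].
  have FA : (X @ \oo) A.
    have /cvgrPdist_lt/(_ _ m0) : (n%:R : R) / k.+1%:R @[k --> \oo] --> (0 : R).
      rewrite -[X in _ --> X](mulr0 n%:R); apply: cvgMr.
      exact: (@cvg_harmonic R).
    apply: filterS => k; rewrite sub0r normrN => kn; exists k => //=.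
    by apply: le_lt_trans kn; exact: ler_norm.
  have [_ [[k kn <-] ky]] := cly _ _ FA (nbhsx_ballx y _ m0).
  by exists k; split=> //; move: ky; rewrite -ball_normE.
have [_ [C [notC inC]]] := XP k.
have le_dist (i : 'I_n.+1) : `|y 0 i - X k 0 i| < Num.min (d / 2) e.
  by have := le_lt_trans (ler_mx_norm (y - X k) 0 i) ky; rewrite !mxE.
have inC_le i : i \in C -> H y 0 i - H y 0 j <= 2 * e.
  move=> iC; have [z [zx zmin]] := inC i iC.
  have zd : `|y - z| < d.
    apply: mx_norm_lt => // i' l; rewrite ord1 !mxE.
    have := le_dist l; rewrite lt_min => /andP[h1 _].
    have := zx l; rewrite distrC => h2; move: kn; rewrite lt_min => /andP[h3 _].
    have := ler_distD (X k 0 l) (y 0 l) (z 0 l); move: (n%:R / _) h2 h3 => nk; lra.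
  have Hz l : `|H y 0 l - H z 0 l| < e.
    by have := le_lt_trans (ler_mx_norm (H y - H z) 0 l) (Hd z zd); rewrite !mxE.
  have := Hz i; have := Hz j; rewrite !ltr_norml => /andP[? ?] /andP[? ?].
  by have := zmin j; lra.
have {Dy} [y0 y1] := Dy.
have -> : \sum_i y 0 i * H y 0 i - H y 0 j = \sum_i y 0 i * (H y 0 i - H y 0 j).
  rewrite -[in LHS](mul1r (H y 0 j)) -y1 mulr_suml -sumrB.
  by apply: eq_bigr => i _; rewrite mulrBr.
have -> : e' = \sum_i (y 0 i * (2 * e) + 2 * e * `|H y 0 i - H y 0 j|).
  rewrite big_split /= -mulr_suml -mulr_sumr y1 -/B /e; field.
  by rewrite gt_eqF // ltr_pwDl.
apply: ler_sum => i _; have [iC|iC] := boolP (i \in C).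
  rewrite -[leLHS]addr0 lerD // ?ler_wpM2l ?inC_le //.
  by rewrite mulr_ge0 // mulr_ge0 // ltW.
have yi : y 0 i <= 2 * e.
  have := notC i iC; have := le_dist i; move: (n%:R / _) kn => nk.
  rewrite !lt_min =>  /andP[_ ?] /andP[_]; rewrite ltr_norml => /andP[_ ?] ?; lra.
rewrite -[leLHS]add0r lerD //; first by rewrite mulr_ge0 // mulr_ge0 // ltW.
by apply: le_trans (ler_wpM2l (y0 i) (ler_norm _)) _; rewrite ler_wpM2r.
Qed.

(* Complementarity on a simplex that contains the ball of radius r0, whose
   vertex ord0 gets the value 0: coercivity excludes the boundary. *)
Theorem coercive_zero m (G : 'rV[R]_m -> 'rV[R]_m) (r0 : R) : continuous G ->
  (forall x : 'rV[R]_m, r0 <= `|x| -> 0 < \sum_i x 0 i * G x 0 i) -> exists x, G x = 0.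
Proof.
move=> cG coer; pose r1 := `|r0| + 1; pose r := m.+1%:R * r1.
have r1_gt0 : 0 < r1 by rewrite ltr_wpDl.
have r_gt0 : 0 < r by rewrite mulr_gt0.
have m1 : (m.+1%:R : R) = m%:R + 1 by rewrite -natr1.
have m0 : 0 < (m.+1%:R : R) by rewrite ltr0n.
(* The image of [pt] is the simplex of all x with coordinates at least - r and sum at most r, and
   its barycentre is 0. The factor m + 1 in r ensures that the sum stays below r when all
   coordinates are below r1, which keeps the weight of the vertex [ord0] positive. *)
pose pt (y : 'rV[R]_m.+1) : 'rV[R]_m :=
  \row_i (r * (m.+1%:R * y 0 (lift ord0 i) - 1)).
have cpt : continuous pt.
  apply: continuous_mx => i j; under eq_fun do rewrite mxE.
  apply: continuous_mul; first exact: continuous_cst.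
  apply: continuous_add; last exact: continuous_cst.
  by apply: continuous_mul; [exact: continuous_cst|exact: coord_continuous].
pose H (y : 'rV[R]_m.+1) : 'rV[R]_m.+1 :=
  \row_i (if unlift ord0 i is Some j then G (pt y) 0 j else 0).
have cH : continuous H.
  apply: continuous_mx => i j; under eq_fun do rewrite mxE.
  case: unliftP => [k _|_]; last exact: continuous_cst.
  apply: (@continuous_compose _ _ _ (G \o pt) (fun M => M 0 k)).
    exact: continuous_compose cpt cG.
  exact: coord_continuous.
have [y [y0 y1] yH] := complementarity cH.
have H0 : H y 0 ord0 = 0 by rewrite mxE unlift_none.
have HS i : H y 0 (lift ord0 i) = G (pt y) 0 i by rewrite mxE liftK.
set x := pt y in HS *.
have xE i : x 0 i = r * (m.+1%:R * y 0 (lift ord0 i) - 1) by rewrite mxE.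
pose q := \sum_i y 0 i * H y 0 i.
have qE : q = \sum_i y 0 (lift ord0 i) * G x 0 i.
  rewrite /q big_ord_recl H0 mulr0 add0r.
  by apply: eq_bigr => i _; rewrite HS.
have q0 : q <= 0 by rewrite -H0 yH.
have qG i : q <= G x 0 i by rewrite -HS yH.
have sumG : m%:R * q <= \sum_i G x 0 i.
  rewrite -[X in X%:R * q]card_ord mulrC mulr_natr -sumr_const; apply: ler_sum => i _.
  exact: qG.
(* In barycentric coordinates the pairing is r times (m + 1) q minus the sum of the entries of G.
   Complementarity bounds q by each entry, and by the value 0 at [ord0], so the pairing is at most r
   q, hence nonpositive. *)
have xG : \sum_i x 0 i * G x 0 i <= 0.
  have -> : \sum_i x 0 i * G x 0 i = r * (m.+1%:R * q - \sum_i G x 0 i).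
    rewrite qE mulr_sumr -sumrB mulr_sumr; apply: eq_bigr => i _.
    by rewrite xE; ring.
  by rewrite pmulr_rle0 // m1; lra.
have xr1 : `|x| < r1.
  rewrite ltNge; apply/negP => r1x; have r0r1 : r0 <= r1 by rewrite /r1; have := ler_norm r0; lra.
  by have := coer x (le_trans r0r1 r1x); rewrite ltNge xG.
have xi i : `|x 0 i| < r1 by apply: le_lt_trans xr1; exact: ler_mx_norm.
have r1r : r1 <= r by rewrite /r m1 mulrDl mul1r lerDr mulr_ge0 // ltW.
have yS i : 0 < y 0 (lift ord0 i).
  have := xi i; rewrite ltr_norml xE => /andP[h _].
  have : 0 < r * (m.+1%:R * y 0 (lift ord0 i)) by lra.
  by rewrite !pmulr_rgt0.
have yO : 0 < y 0 ord0.
  have Ey : m.+1%:R * r * y 0 ord0 = r - \sum_i x 0 i.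
    have -> : y 0 ord0 = 1 - \sum_(i < m) y 0 (lift ord0 i).
      by rewrite -y1 big_ord_recl addrK.
    have -> : \sum_i x 0 i = r * (m.+1%:R * (\sum_(i < m) y 0 (lift ord0 i)) - m%:R).
      rewrite -[X in _ - X%:R]card_ord -sumr_const mulr_sumr -sumrB mulr_sumr.
      by apply: eq_bigr => i _; rewrite xE.
    by rewrite m1; ring.
  have : \sum_i x 0 i <= m%:R * r1.
    rewrite -[X in X%:R * _]card_ord mulrC mulr_natr -sumr_const; apply: ler_sum => i _.
    by apply: le_trans (ler_norm _) (ltW (xi i)).
  move=> xs; have : 0 < m.+1%:R * r * y 0 ord0.
    by rewrite Ey /r m1; lra.
  by rewrite pmulr_rgt0 // mulr_gt0.
have yi i : 0 < y 0 i by case: (unliftP ord0 i) => [j|] ->.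
(* The average of the nonnegative differences [H y 0 i - q] with positive weights is 0, so all
   vanish; the entry at [ord0] then identifies q as 0. *)
have Hq i : H y 0 i = q.
  have : \sum_i y 0 i * (H y 0 i - q) = 0.
    under eq_bigr do rewrite mulrBr.
    by rewrite sumrB -mulr_suml y1 mul1r subrr.
  have ge0 k : true -> 0 <= y 0 k * (H y 0 k - q).
    by move=> _; rewrite mulr_ge0 // subr_ge0 yH.
  move=> s0; have /eqP : y 0 i * (H y 0 i - q) = 0 by apply: (psumr_eq0P ge0 s0).
  by rewrite mulf_eq0 gt_eqF //= subr_eq0 => /eqP.
exists x; apply/rowP => i; rewrite mxE -HS Hq -H0.
by rewrite Hq.
Qed.

End Zero.

(** * Integrals of continuous functions on bounded sets *)

Section Integration.
Variable R : realType.

Definition tuple_set n (D : set 'rV[R]_n) : set (n.-tuple (measurableTypeR R)) :=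
  [set t | D (row_of_tuple t)].

Lemma mx_norm_dist n (y z : 'rV[R]_n) (r : R) : 0 <= r ->
  (forall i, `|y 0 i - z 0 i| <= r) -> `|y - z| <= r.
Proof. by move=> r0 H; apply: mx_norm_le => // i j; rewrite ord1 !mxE. Qed.

(** This links the topology of row vectors with the product sigma-algebra of tuples: an open set is
    the union of the countably many rational cubes inside it. *)
Lemma open_tuple_set_measurable n (U : set 'rV[R]_n) :
  open U -> measurable (tuple_set U).
Proof.
move=> oU; pose K : countType := ({ffun 'I_n -> rat} * rat)%type.
pose box (k : K) : set 'rV[R]_n := [set y | forall i, `|y 0 i - ratr (k.1 i)| < ratr k.2].
pose F (k : K) := if pselect (box k `<=` U) then tuple_set (box k) else set0.
suff -> : tuple_set U = \bigcup_k F k.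
  apply: (@countable_bigcupT_measurable _ _ K) => [|k]; first exact: countableP.
  rewrite /F; case: pselect => [?|?]; last exact: measurable0.
  rewrite (_ : tuple_set (box k) =
      \bigcap_(i in [set: 'I_n]) [set t | `|tnth t i - ratr (k.1 i)| < ratr k.2]).
    apply: fin_bigcap_measurable => // i _.
    have mb : measurable [set x : measurableTypeR R | `|x - ratr (k.1 i)| < ratr k.2].
      rewrite (_ : [set x | _] = ball (ratr (k.1 i) : R) (ratr k.2)).
        by rewrite ball_itv; exact: measurable_itv.
      by apply/seteqP; split => x; rewrite -ball_normE /= distrC.
    rewrite -[X in measurable X]setTI.
    exact: (@measurable_tnth _ (measurableTypeR R) n i measurableT _ mb).
  apply/seteqP; split => t H i; first by have := H i; rewrite mxE.
    by rewrite mxE; exact: H.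
apply/seteqP; split => [t Ut|t [k _]]; last first.
  by rewrite /F; case: pselect => // kU; exact: kU.
have /nbhs_normP[d /= d0 Hd] : nbhs (row_of_tuple t) U by exact: open_nbhs_nbhs.
(* A cube of radius e < d / 2 whose centre is within e of the point stays in the ball of radius
   d. *)
have /rat_in_itvoo[e] : 0 < d / 2 by rewrite divr_gt0.
rewrite in_itv /= => /andP[e0 ed].
have /choice[q Hq] i : exists q : rat, `|tnth t i - ratr q| < ratr e :> R.
  have /rat_in_itvoo[q] : tnth t i - ratr e < tnth t i + ratr e :> R by lra.
  by rewrite in_itv /= => /andP[? ?]; exists q; rewrite ltr_norml; lra.
exists ([ffun i => q i], e) => //; rewrite /F; case: pselect => [?|[]].
  by move=> i; rewrite !mxE ffunE.
move=> y ye; apply: Hd => /=.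
apply: (@le_lt_trans _ _ (2 * ratr e)); last by lra.
apply: mx_norm_dist => [|i]; first by lra.
have := ye i; have := Hq i; rewrite !mxE ffunE => h1 h2.
by have := ler_distD (ratr (q i)) (tnth t i : R) (y 0 i); rewrite (distrC (ratr (q i))); lra.
Qed.

Lemma closed_tuple_set_measurable n (U : set 'rV[R]_n) :
  closed U -> measurable (tuple_set U).
Proof.
move=> /closed_openC/open_tuple_set_measurable/measurableC.
by congr measurable; apply/seteqP; split => t /=; rewrite /tuple_set /=; [move/contrapT|move=> ?].
Qed.

Lemma continuous_measurable_row n (D : set 'rV[R]_n) (g : 'rV[R]_n -> R) :
  measurable (tuple_set D) -> continuous g ->
  measurable_fun (tuple_set D) (fun t => g (row_of_tuple t)).
Proof.
move=> mD /continuousP cg; apply: (measurability _ (RGenOpens.measurableE R)).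
move=> _ [_ [a [b ->] <-]]; apply: measurableI => //.
have oU : open (g @^-1` `]a, b[%classic) by exact/cg/interval_open.
exact: (open_tuple_set_measurable oU).
Qed.

(** Each section of a cube is a lower-dimensional cube or empty. The value is used as an upper
    bound, for finiteness on bounded sets, and as a lower bound, for positivity near an interior
    point. *)
Lemma lebesgue_tuple_box n (a : 'I_n -> R) (r : R) : 0 <= r ->
  lebesgue_tuple n [set t | forall i, `|tnth t i - a i| <= r] = ((2 * r) ^+ n)%:E.
Proof.
move=> r0; elim: n a => [|n IH] a /=.
  by rewrite diracE mem_set // => -[].
pose c := (((2 * r) ^+ n)%:E : \bar R); pose I := `[a ord0 - r, a ord0 + r]%classic.
transitivity (\int[@lebesgue_measure R]_x ((fun=> c) \_ I) x)%E.
  apply: eq_integral => x _; rewrite patchE.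
  have E : (x \in I) = (`|x - a ord0| <= r).
    by rewrite ler_distl; apply/idP/idP; rewrite inE /I /= in_itv.
  case: ifPn; rewrite E => xr.
    rewrite /c -(IH (fun i => a (lift ord0 i))); congr lebesgue_tuple.
    apply/seteqP; split=> t /= H i; first by have := H (lift ord0 i); rewrite tnthS.
    by case: (unliftP ord0 i) => [j|] ->; rewrite ?tnthS // tnth0.
  rewrite (_ : [set t | _] = set0) ?measure0 //.
  by apply/seteqP; split=> // t /= /(_ ord0); rewrite tnth0 (negPf xr).
rewrite -integral_mkcond integral_cst; last exact: measurable_itv.
transitivity (c * (2 * r)%:E)%E; last by rewrite /c -EFinM exprS mulrC.
congr (_ * _)%E; rewrite [LHS]lebesgue_measure_itv /= lte_fin; case: ltP => [_|h].
  by rewrite -EFinD; congr (_%:E); lra.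
by congr (_%:E); lra.
Qed.

Definition bounded_measurable n (E : set 'rV[R]_n) :=
  measurable (tuple_set E) /\ exists r : R, forall x, E x -> `|x| <= r.

Section FiniteSet.
Variables (n : nat) (E : set 'rV[R]_n).
Hypothesis hE : bounded_measurable E.

Let ball_compact (r : R) : compact [set x : 'rV[R]_n | `|x| <= r].
Proof.
apply: bounded_closed_compact.
  exists r; split=> [|M rM x /= xr]; first exact: num_real.
  by apply: le_trans xr _; exact: ltW.
apply: (@closed_comp _ _ (fun x : 'rV[R]_n => `|x|) [set x | x <= r]).
  by move=> x _; exact: norm_continuous.
exact: closed_le.
Qed.

Lemma lebesgue_tuple_finite : (lebesgue_tuple n (tuple_set E) < +oo)%E.
Proof.
have [mE [r Er]] := hE.
have r0 : 0 <= `|r| by [].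
apply: (@le_lt_trans _ _ ((2 * `|r|) ^+ n)%:E); last by rewrite ltry.
rewrite -(lebesgue_tuple_box (fun _ : 'I_n => 0) r0); apply: le_measure.
- by rewrite inE.
- rewrite inE (_ : [set t | _] = tuple_set [set x : 'rV[R]_n | `|x| <= `|r|]).
    apply: closed_tuple_set_measurable.
    apply: (@compact_closed _ [set x : 'rV[R]_n | `|x| <= `|r|]); first exact: norm_hausdorff.
    exact: ball_compact.
  apply/seteqP; split=> t /= H.
    by apply: mx_norm_le => // i j; rewrite mxE; have := H j; rewrite subr0.
  move=> i; rewrite subr0; apply: le_trans H.
  by have := ler_mx_norm (row_of_tuple t) 0 i; rewrite mxE.
- move=> t /Er tr i; rewrite subr0; apply: le_trans (le_trans tr (ler_norm r)).
  by have := ler_mx_norm (row_of_tuple t) 0 i; rewrite mxE.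
Qed.

Lemma continuous_bounded (g : 'rV[R]_n -> R) : continuous g ->
  exists M : R, 0 <= M /\ forall x, E x -> `|g x| <= M.
Proof.
move=> cg; have [_ [r Er]] := hE.
have cgK : {within [set x : 'rV[R]_n | `|x| <= r], continuous g}.
  exact: continuous_subspaceT.
have /compact_bounded[M [_ HM]] := continuous_compact cgK (ball_compact (r:=r)).
exists (`|M| + 1); split=> [|x /Er xr]; first by rewrite addr_ge0.
apply: HM; last by exists x.
by rewrite ltr_pwDr // ler_norm.
Qed.

Lemma continuous_integrable (g : 'rV[R]_n -> R) : continuous g ->
  (lebesgue_tuple n).-integrable (tuple_set E) (EFin \o (fun t => g (row_of_tuple t))).
Proof.
move=> cg; have [mE _] := hE; apply: measurable_bounded_integrable => //.
- exact: lebesgue_tuple_finite.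
- exact: continuous_measurable_row.
- have [M [M0 HM]] := continuous_bounded cg.
  exists M; split=> [|M' MM' t Et]; first exact: num_real.
  by apply: le_trans (HM _ Et) (ltW MM').
Qed.

Lemma integral_on_lin (a : R) (g h : 'rV[R]_n -> R) : continuous g -> continuous h ->
  integral_on E (fun x => a * g x + h x) = a * integral_on E g + integral_on E h.
Proof.
move=> cg ch; have [mE _] := hE.
have cag : continuous (fun x => a * g x).
  by apply: continuous_mul => //; exact: continuous_cst.
rewrite /integral_on (RintegralD mE (continuous_integrable cag) (continuous_integrable ch)).
by rewrite (RintegralZl _ mE (continuous_integrable cg)).
Qed.

Lemma ler_integral_on (g h : 'rV[R]_n -> R) : continuous g -> continuous h ->
  (forall x, E x -> g x <= h x) -> integral_on E g <= integral_on E h.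
Proof.
move=> cg ch gh; have [mE _] := hE.
by apply: le_Rintegral => // [||t]; [exact: continuous_integrable|exact: continuous_integrable|exact: gh].
Qed.

Lemma integral_on_cst (c : R) :
  integral_on E (fun=> c) = c * fine (lebesgue_tuple n (tuple_set E)).
Proof. by have [mE _] := hE; rewrite /integral_on Rintegral_cst. Qed.

Lemma integral_on_norm_le (g : 'rV[R]_n -> R) (c : R) : continuous g ->
  (forall x, E x -> `|g x| <= c) ->
  `|integral_on E g| <= c * fine (lebesgue_tuple n (tuple_set E)).
Proof.
move=> cg gc; rewrite -integral_on_cst ler_norml; apply/andP; split.
  rewrite -subr_ge0 opprK -[X in X + _]mul1r -integral_on_lin //; last exact: continuous_cst.
  apply: Rintegral_ge0 => t /gc; rewrite ler_norml mul1r => /andP[? _]; lra.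
apply: ler_integral_on => //; first exact: continuous_cst.
by move=> x /gc; rewrite ler_norml => /andP[].
Qed.

(* A continuous nonnegative integrand that is positive at an interior point is
   bounded below by a positive constant on a small cube. *)
Lemma integral_on_gt0 (U : set 'rV[R]_n) (g : 'rV[R]_n -> R) x :
  open U -> U `<=` E -> continuous g -> (forall y, 0 <= g y) -> U x -> 0 < g x ->
  0 < integral_on E g.
Proof.
move=> oU UE cg g0 Ux gx; have [mE _] := hE.
have [d d0 Hd] : exists2 d : R, 0 < d & forall y, `|x - y| < d -> U y /\ g x / 2 < g y.
  have gx2 : 0 < g x / 2 by lra.
  have /cvgrPdist_lt/(_ _ gx2) : g @ x --> g x := cg x.
  move=> /(filterI (open_nbhs_nbhs (conj oU Ux)))/nbhs_normP[d /= d0 Hd].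
  exists d => // y xy; have [Uy gy] := Hd y xy; split=> //.
  by move: gy; rewrite ltr_norml => /andP[]; lra.
have d2 : 0 <= d / 2 by lra.
pose B := [set y : 'rV[R]_n | forall i, `|y 0 i - x 0 i| <= d / 2].
have BU y : B y -> U y /\ g x / 2 < g y.
  move=> By; apply: Hd; apply: (@le_lt_trans _ _ (d / 2)); last by lra.
  by apply: mx_norm_dist => // i; rewrite distrC; exact: By.
have BE : tuple_set B `<=` tuple_set E by move=> t /BU[/UE].
have muB : lebesgue_tuple n (tuple_set B) = ((2 * (d / 2)) ^+ n)%:E.
  rewrite -(lebesgue_tuple_box (fun i => x 0 i) d2); congr (lebesgue_tuple n _).
  by apply/seteqP; split=> t /= H i; have := H i; rewrite mxE.
have mB : measurable (tuple_set B).
  apply: closed_tuple_set_measurable.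
  rewrite (_ : B = \bigcap_i [set y : 'rV[R]_n | `|y 0 i - x 0 i| <= d / 2]); last first.
    by apply/seteqP; split=> y By; [move=> i _; exact: By|move=> i; exact: By].
  apply: closed_bigI => i _.
  apply: (@closed_comp _ _ (fun y : 'rV[R]_n => `|y 0 i - x 0 i|) [set z | z <= d / 2]).
    move=> y _.
    apply: (@continuous_compose _ _ _ (fun y : 'rV[R]_n => y 0 i - x 0 i) _ _ (@norm_continuous _ R)).
    by apply: continuous_add; [exact: coord_continuous|exact: continuous_cst].
  exact: closed_le.
rewrite /integral_on -lte_fin /Rintegral fineK; last first.
  exact: integrable_fin_num (continuous_integrable cg).
apply: (@lt_le_trans _ _ (\int[lebesgue_tuple n]_(t in tuple_set B) (g x / 2)%:E)%E).
  rewrite integral_cst //; apply: (@lt_le_trans _ _ ((g x / 2)%:E * ((2 * (d / 2)) ^+ n)%:E)%E).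
    by rewrite -EFinM lte_fin mulr_gt0 ?exprn_gt0 //; lra.
  by rewrite -muB.
apply: (@le_trans _ _ (\int[lebesgue_tuple n]_(t in tuple_set B) (g (row_of_tuple t))%:E)%E).
  apply: ge0_le_integral => //.
  - by move=> t ?; rewrite lee_fin; lra.
  - by apply/measurable_EFinP; exact: continuous_measurable_row.
  - by move=> t /BU[_ /ltW]; rewrite lee_fin.
apply: ge0_subset_integral => //.
- by apply/measurable_EFinP; exact: continuous_measurable_row.
- by move=> t ?; rewrite lee_fin.
Qed.

(** Joint continuity and compactness of a ball containing E make the integrands uniformly close for
    nearby parameters (the tube lemma). *)
Lemma continuous_parametric_integral (V : normedModType R) (F : V -> 'rV[R]_n -> R) :
  continuous (fun q : V * 'rV[R]_n => F q.1 q.2) ->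
  continuous (fun v => integral_on E (F v)).
Proof.
move=> cF; have [_ [r Er]] := hE.
have cFv v : continuous (F v).
  apply: (@continuous_compose _ _ _ (fun x => (v, x)) (fun q => F q.1 q.2)) => //.
  by apply: continuous_pair; [exact: continuous_cst|move=> x; exact: cvg_id].
move=> v0; apply/cvgrPdist_le => e e0.
pose mu := fine (lebesgue_tuple n (tuple_set E)).
have mu0 : 0 <= mu by rewrite fine_ge0.
(* The summand 1 keeps the quotient meaningful for a null set. *)
pose e' := e / (mu + 1).
have e'0 : 0 < e' by rewrite divr_gt0 // ltr_wpDl.
have : \forall v \near v0, [set x : 'rV[R]_n | `|x| <= r] `<=` [set x | `|F v0 x - F v x| <= e'].
  have /compact_near_coveringP cov := ball_compact (r:=r).
  apply: cov => x _.
  have e'2 : 0 < e' / 2 by lra.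
  have /cvgrPdist_lt/(_ _ e'2) := cF (v0, x).
  have /cvgrPdist_lt/(_ _ e'2) := cFv v0 x.
  move=> nx [[A B] /= [nA nB] AB].
  exists ([set y | `|F v0 x - F v0 y| < e' / 2] `&` B, A).
    by split=> //=; apply: filterI.
  move=> [y v] /= [[xy By] Av]; have /= := AB (v, y) (conj Av By) => vy.
  have := ler_distD (F v0 x) (F v0 y) (F v y); rewrite (distrC (F v0 y) (F v0 x)); lra.
apply: filterS => v Hv.
have -> : integral_on E (F v0) - integral_on E (F v) =
    integral_on E (fun x => (-1) * F v x + F v0 x).
  by rewrite integral_on_lin // mulN1r addrC.
apply: (@le_trans _ _ (e' * mu)).
  apply: integral_on_norm_le.
    apply: continuous_add => //; apply: continuous_mul => //; exact: continuous_cst.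
  by move=> x /Er xr; rewrite mulN1r addrC; exact: Hv.
by rewrite /e' mulrAC ler_pdivrMr ?ltr_wpDl // ler_wpM2l ?lerDl // ltW.
Qed.

End FiniteSet.

End Integration.

(** Uniqueness of digits in base B, for the exponents of Kronecker's substitution. *)
Lemma base_expansion_inj B n (u v : nat -> nat) :
  (forall i, (i < n)%N -> (u i < B)%N /\ (v i < B)%N) ->
  (\sum_(i < n) u i * B ^ i = \sum_(i < n) v i * B ^ i)%N ->
  forall i, (i < n)%N -> u i = v i.
Proof.
elim: n u v => [//|n IH] u v uv; rewrite !big_ord_recl !expn0 !muln1 /=.
have shift w : (\sum_(i < n) w (bump 0 i) * B ^ bump 0 i = (\sum_(i < n) w i.+1 * B ^ i) * B)%N.
  by rewrite big_distrl /=; apply: eq_bigr => i _; rewrite expnSr mulnA.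
have [u0 v0] := uv 0%N isT; rewrite !shift => E.
have B0 : (0 < B)%N by apply: leq_trans u0.
have E0 : u 0%N = v 0%N.
  by move/(congr1 (modn^~ B)): (E); rewrite !(addnC _ (_ * B)%N) !modnMDl !modn_small.
case=> [//|i]; rewrite ltnS => lt_in; apply: (IH (u \o succn) (v \o succn)) => //.
  by move=> j lt_jn; apply: uv.
by move/eqP: E; rewrite E0 eqn_add2l eqn_pmul2r // => /eqP.
Qed.

(** * Piecewise polynomials *)

Section Polynomials.
Variable R : realType.

Lemma poly_eq0_interval (q : {poly R}) (d : R) : 0 < d ->
  (forall t, 0 < t < d -> q.[t] = 0) -> q = 0.
Proof.
move=> d0 H; apply/eqP/negPn/negP => q0.
(* As many distinct roots as the size of q, one more than its degree allows; the shift by two keeps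
   them strictly below d. *)
pose s := [seq d / k.+2%:R | k <- iota 0 (size q)].
have : (size s < size q)%N.
  apply: max_poly_roots => //.
    apply/allP => _ /mapP[k _ ->]; apply/eqP/H.
    by rewrite divr_gt0 //= ltr_pdivrMr // ltr_pMr // ltr1n.
  rewrite map_inj_uniq ?iota_uniq // => k l /(mulfI (lt0r_neq0 d0))/invr_inj/eqP.
  by rewrite eqr_nat => /eqP [].
by rewrite size_map size_iota ltnn.
Qed.

Section Degree.
Variables n p : nat.

Definition low_degree := [pred a : {ffun 'I_n -> 'I_p.+1} | (\sum_i a i <= p)%N].

Definition mono := {a in low_degree}.

Definition monomial (a : {ffun 'I_n -> 'I_p.+1}) (x : 'rV[R]_n) : R :=
  \prod_i x 0 i ^+ a i.

Lemma polynomial_funP (g : 'rV[R]_n -> R) :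
  polynomial_fun p g <->
  exists c : mono -> R, forall x, g x = \sum_a c a * monomial (val a) x.
Proof.
split=> [[c gE]|[c gE]].
  exists (c \o val) => x; rewrite gE.
  exact: (big_sub low_degree (fun a => c a * monomial a x)).
exists (fun a => if insub a is Some b then c b else 0) => x; rewrite gE.
rewrite [RHS](big_sub low_degree
  (fun a => (if insub a is Some b then c b else 0) * monomial a x)).
by apply: eq_bigr => a _; rewrite valK.
Qed.

Lemma polynomial_fun_lin (a : R) (g h : 'rV[R]_n -> R) :
  polynomial_fun p g -> polynomial_fun p h -> polynomial_fun p (fun x => a * g x + h x).
Proof.
move=> [c gE] [c' hE]; exists (fun b => a * c b + c' b) => x.
rewrite gE hE mulr_sumr -big_split /=.
by apply: eq_bigr => b _; rewrite mulrA -mulrDl.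
Qed.

(** The three properties are carried together because the product rule needs the continuity of the
    factors to make the derivative of a product continuous. *)
Let C1_dir (v : 'rV[R]_n) (g : 'rV[R]_n -> R) :=
  [/\ continuous g, forall x, derivable g x v & continuous (fun x => 'D_v g x)].

Let C1_dir_cst v c : C1_dir v (fun=> c).
Proof.
split=> [|x|]; [exact: continuous_cst|exact: (derivable_cst c)|].
have -> : (fun x => 'D_v (fun=> c) x) = (fun=> 0).
  by apply/funext => x; exact: (derive_cst c).
exact: continuous_cst.
Qed.

Let C1_dir_add v g h : C1_dir v g -> C1_dir v h -> C1_dir v (fun x => g x + h x).
Proof.
move=> [cg dg cdg] [ch dh cdh]; split=> [|x|].
- exact: continuous_add.
- exact: derivableD.
- have -> : (fun x => 'D_v (fun x => g x + h x) x) = (fun x => 'D_v g x + 'D_v h x).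
    by apply/funext => x; exact: deriveD.
  exact: continuous_add.
Qed.

Let C1_dir_mul v g h : C1_dir v g -> C1_dir v h -> C1_dir v (fun x => g x * h x).
Proof.
move=> [cg dg cdg] [ch dh cdh]; split=> [|x|].
- exact: continuous_mul.
- exact: derivableM.
- have -> : (fun x => 'D_v (fun x => g x * h x) x) =
      (fun x => g x * 'D_v h x + h x * 'D_v g x).
    by apply/funext => x; exact: deriveM.
  by apply: continuous_add; exact: continuous_mul.
Qed.

Let C1_dir_coord v i : C1_dir v (fun x => x 0 i).
Proof.
split=> [|x|]; first exact: coord_continuous.
  exact: ((derivable_mxP (@id 'rV[R]_n) x v).1 (derivable_id (x:=x) (v:=v)) 0 i).
have -> : (fun x : 'rV[R]_n => 'D_v (fun x : 'rV[R]_n => x 0 i) x) = (fun=> v 0 i).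
  apply/funext => x; have := derive_mx (derivable_id (x:=x) (v:=v)).
  by rewrite derive_id => /matrixP/(_ 0 i); rewrite mxE.
exact: continuous_cst.
Qed.

Lemma polynomial_fun_C1 v (g : 'rV[R]_n -> R) : polynomial_fun p g ->
  [/\ continuous g, forall x, derivable g x v & continuous (fun x => 'D_v g x)].
Proof.
move=> [c gE]; have -> : g = (fun x => \sum_(a : {ffun 'I_n -> 'I_p.+1} | (\sum_i a i <= p)%N)
            c a * \prod_i x 0 i ^+ a i) by apply/funext.
have C1_sum (I : Type) (r : seq I) (P : pred I) (F : I -> 'rV[R]_n -> R) :
    (forall i, C1_dir v (F i)) -> C1_dir v (fun x => \sum_(i <- r | P i) F i x).
  move=> CF; elim: r => [|i r IH].
    by under eq_fun do rewrite big_nil; exact: C1_dir_cst.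
  under eq_fun do rewrite big_cons; case: (P i) => //.
  exact: C1_dir_add.
have C1_prod (I : Type) (r : seq I) (F : I -> 'rV[R]_n -> R) :
    (forall i, C1_dir v (F i)) -> C1_dir v (fun x => \prod_(i <- r) F i x).
  move=> CF; elim: r => [|i r IH].
    by under eq_fun do rewrite big_nil; exact: C1_dir_cst.
  under eq_fun do rewrite big_cons.
  exact: C1_dir_mul.
apply: C1_sum => a; apply: C1_dir_mul; first exact: C1_dir_cst.
apply: C1_prod => i; elim: (a i : nat) => [|k IH].
  by under eq_fun do rewrite expr0; exact: C1_dir_cst.
under eq_fun do rewrite exprS; apply: C1_dir_mul => //; exact: C1_dir_coord.
Qed.

(* Restrict the polynomial to the line through two points. *)
Lemma polynomial_fun_eq0 (U : set 'rV[R]_n) (g : 'rV[R]_n -> R) : open U -> U !=set0 ->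
  polynomial_fun p g -> (forall x, U x -> g x = 0) -> forall x, g x = 0.
Proof.
move=> oU [x0 Ux0] [c gE] gU x.
pose line t : 'rV[R]_n := x0 + t *: (x - x0).
pose q : {poly R} := \sum_(a : {ffun 'I_n -> 'I_p.+1} | (\sum_i a i <= p)%N)
   (c a)%:P * \prod_i ((x0 0 i)%:P + (x 0 i - x0 0 i)%:P * 'X) ^+ a i.
have qE t : q.[t] = g (line t).
  rewrite gE horner_sum; apply: eq_bigr => a _.
  rewrite hornerM hornerC horner_prod; congr (_ * _); apply: eq_bigr => i _.
  by rewrite horner_exp !hornerE /line !mxE [t * _]mulrC.
have cl : continuous line.
  move=> t; apply: cvgD; first exact: cvg_cst.
  by apply: cvgZr_tmp; exact: cvg_id.
have /nbhs_normP[d /= d0 Hd] : nbhs (0 : R) (line @^-1` U).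
  by apply: (cl 0); rewrite /line scale0r addr0; exact: open_nbhs_nbhs.
have q0 : q = 0.
  apply: (poly_eq0_interval d0) => t /andP[t0 td]; rewrite qE gU //.
  by apply: Hd; rewrite /= sub0r normrN gtr0_norm.
by have := qE 1; rewrite q0 horner0 /line scale1r addrC subrK.
Qed.

(* Kronecker's substitution x_i = t ^ ((p + 1) ^ i) makes distinct monomials
   into distinct powers of t. *)
Lemma monomial_free (c : mono -> R) :
  (forall x, \sum_a c a * monomial (val a) x = 0) -> forall a, c a = 0.
Proof.
move=> H a0; pose code (a : mono) := (\sum_(i < n) val a i * p.+1 ^ i)%N.
have code_inj : injective code.
  move=> a b; rewrite /code => E; apply/val_inj/ffunP => i.
  pose ext (u : {ffun 'I_n -> 'I_p.+1}) (k : nat) : nat :=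
    if insub k is Some j then u j else 0%N.
  have extE u (j : 'I_n) : ext u j = u j by rewrite /ext valK.
  have : ext (val a) i = ext (val b) i.
    apply: (@base_expansion_inj p.+1 n) => //; last first.
      by under eq_bigr do rewrite extE; under [RHS]eq_bigr do rewrite extE.
    by move=> k kn; rewrite /ext insubT !ltn_ord.
  by rewrite !extE => /val_inj.
pose q : {poly R} := \sum_a (c a)%:P * 'X^(code a).
have q0 : q = 0.
  apply: (@poly_eq0_interval _ 1) => // t _; rewrite horner_sum.
  rewrite -[RHS](H (\row_i t ^+ (p.+1 ^ i))); apply: eq_bigr => a _.
  rewrite hornerM hornerC hornerXn; congr (_ * _).
  rewrite /monomial /code -prodrXr; apply: eq_bigr => i _.
  by rewrite mxE -exprM mulnC.
have := congr1 (fun r : {poly R} => r`_(code a0)) q0.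
rewrite coef0 coef_sum (bigD1 a0) //= coefCM coefXn eqxx mulr1 big1 ?addr0 // => b ba0.
by rewrite coefCM coefXn (inj_eq code_inj) eq_sym (negPf ba0) mulr0.
Qed.

End Degree.

Section Basis.
Variables (d : nat) (M : mesh R d) (p m n : nat).

Lemma Sp_mx_lin a (v w : broken M m n) : Sp_mx p v -> Sp_mx p w ->
  Sp_mx p (fun K x => a *: v K x + w K x).
Proof.
move=> Sv Sw i j K; rewrite (_ : (fun x => _) = (fun x => a * v K x i j + w K x i j)).
  exact: polynomial_fun_lin (Sv i j K) (Sw i j K).
by apply/funext => x; rewrite !mxE.
Qed.

(** One field for each cell, matrix entry and monomial. Branches are functions on the whole space,
    so freeness of the monomials suffices for independence. *)
Lemma Sp_mx_basis : exists (q : nat) (B : 'I_q -> broken M m n),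
  [/\ forall k, Sp_mx p (B k),
      forall w, Sp_mx p w -> exists c : 'rV_q, forall K x, w K x = \sum_k c 0 k *: B k K x &
      forall c : 'rV_q, (forall K x, \sum_k c 0 k *: B k K x = 0) -> c = 0].
Proof.
pose J : finType := (cell M * 'I_m * 'I_n * mono d.+1 p)%type.
pose field (c : J -> R) : broken M m n :=
  fun K x => \matrix_(i, j) \sum_a c (K, i, j, a) * monomial (val a) x.
pose B (k : 'I_#|J|) := field (fun l => (l == enum_val k)%:R).
have sumB (c : 'rV_#|J|) K x : \sum_k c 0 k *: B k K x = field (fun l => c 0 (enum_rank l)) K x.
  apply/matrixP => i j; rewrite summxE mxE.
  under eq_bigr do rewrite !mxE mulr_sumr.
  rewrite exchange_big; apply: eq_bigr => a _ /=.
  rewrite (bigD1 (enum_rank (K, i, j, a))) //= enum_rankK eqxx mul1r big1 ?addr0 // => k kn.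
  suff /negPf -> : (K, i, j, a) != enum_val k by rewrite mul0r mulr0.
  by apply: contraNneq kn => ->; rewrite enum_valK.
have Sfield c : Sp_mx p (field c).
  move=> i j K; apply/polynomial_funP; exists (fun a => c (K, i, j, a)) => x.
  by rewrite mxE.
exists #|J|, B; split=> [k|w Sw|c c0]; first exact: Sfield.
  have /choice[c Hc] (k : cell M * 'I_m * 'I_n) : exists c : mono d.+1 p -> R,
      forall x, w k.1.1 x k.1.2 k.2 = \sum_a c a * monomial (val a) x.
    by apply/polynomial_funP; exact: Sw.
  exists (\row_k c (enum_val k).1 (enum_val k).2) => K x; rewrite sumB.
  apply/matrixP => i j; rewrite mxE (Hc (K, i, j)).
  by apply: eq_bigr => a _; rewrite mxE enum_rankK.
apply/rowP => k; rewrite mxE -[k]enum_valK; case: (enum_val k) => [[[K i] j] a].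
apply: (@monomial_free _ _ (fun a => c 0 (enum_rank (K, i, j, a)))) => x.
by have := c0 K x; rewrite sumB => /matrixP/(_ i j); rewrite !mxE.
Qed.

End Basis.

End Polynomials.

(** * Symmetry of second derivatives *)

Section Schwarz.
Variables (R : realType) (V : normedModType R).

Lemma is_derive_line (f : V -> R) (y v : V) (t : R) : derivable f (y + t *: v) v ->
  is_derive t 1 (fun t => f (y + t *: v)) ('D_v f (y + t *: v)).
Proof.
move=> df; pose L t := f (y + t *: v).
have E : (fun h : R => h^-1 *: (L (h *: (1 : R) + t) - L t)) =
    (fun h => h^-1 *: (f (h *: v + (y + t *: v)) - f (y + t *: v))).
  apply/funext => h; rewrite /L; congr (_ *: (f _ - _)).
  by rewrite [h *: 1]mulr1 scalerDl addrCA.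
by apply: DeriveDef; [rewrite /derivable|rewrite /derive]; rewrite -/L E.
Qed.

Lemma MVT_line (f : V -> R) (y v : V) (h : R) : 0 < h ->
  (forall t, 0 <= t <= h -> derivable f (y + t *: v) v) ->
  exists2 t, 0 < t < h & f (y + h *: v) - f y = h * 'D_v f (y + t *: v).
Proof.
move=> h0 df.
have [||t th E] := @MVT R (fun t => f (y + t *: v)) (fun t => 'D_v f (y + t *: v)) 0 h h0.
- by move=> t; rewrite in_itv /= => /andP[? ?]; apply/is_derive_line/df; rewrite !ltW.
- apply: derivable_within_continuous => t; rewrite in_itv /= => th.
  by have [] := is_derive_line (df t th).
exists t; first by move: th; rewrite in_itv.
by move: E; rewrite scale0r addr0 subr0 mulrC.
Qed.

(** The mean value theorem is applied twice: along v to the increment of s in direction w, then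
    along w to the derivative of s in direction v. *)
Lemma second_difference (U : set V) (s : V -> R) (x v w : V) (h : R) : C2_on U s -> 0 < h ->
  (forall a b, 0 <= a <= h -> 0 <= b <= h -> U (x + a *: v + b *: w)) ->
  exists a b, [/\ 0 < a < h, 0 < b < h &
    s (x + h *: v + h *: w) - s (x + h *: v) - s (x + h *: w) + s x =
    h ^+ 2 * 'D_w (fun y => 'D_v s y) (x + a *: v + b *: w)].
Proof.
move=> [s1 s2] h0 HU; have h0h : 0 <= h <= h by rewrite lexx ltW.
have h00 : 0 <= (0 : R) <= h by rewrite lexx ltW.
have HU0 a : 0 <= a <= h -> U (x + a *: v).
  by move=> ah; have := HU a 0 ah h00; rewrite scale0r addr0.
have ds y z : U y -> derivable s y z by move=> /s1[/diff_derivable].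
pose phi y := s (y + h *: w) - s y.
have dshift y : derivable s (y + h *: w) v ->
    is_derive y v (fun y => s (y + h *: w)) ('D_v s (y + h *: w)).
  move=> dy; have E : (fun k : R => k^-1 *: (s (k *: v + y + h *: w) - s (y + h *: w))) =
      (fun k => k^-1 *: (s (k *: v + (y + h *: w)) - s (y + h *: w))).
    by apply/funext => k; rewrite addrA.
  by apply: DeriveDef; [rewrite /derivable|rewrite /derive] => /=; rewrite E.
have dphi a : 0 <= a <= h -> is_derive (x + a *: v) v phi
    ('D_v s (x + a *: v + h *: w) - 'D_v s (x + a *: v)).
  move=> ah; apply: is_deriveB; first by apply: dshift; exact/ds/HU.
  by apply: derivableP; exact/ds/HU0.
have [a ah Ea] : exists2 a, 0 < a < h & phi (x + h *: v) - phi x = h * 'D_v phi (x + a *: v).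
  by apply: MVT_line => // a /dphi[].
have ah' : 0 <= a <= h by case/andP: ah => ? ?; rewrite !ltW.
have [b bh Eb] : exists2 b, 0 < b < h &
    'D_v s (x + a *: v + h *: w) - 'D_v s (x + a *: v) =
    h * 'D_w (fun y => 'D_v s y) (x + a *: v + b *: w).
  apply: (@MVT_line (fun y => 'D_v s y)) => // b bh.
  by apply: diff_derivable; have [] := s2 v _ (HU a b ah' bh).
exists a, b; split=> //; have [_ E] := dphi a ah'.
by rewrite expr2 -mulrA -Eb -E -Ea /phi; ring.
Qed.

(** The second difference is symmetric in v and w, so the two mixed derivatives agree at two
    different points near x; their continuity carries this over to x. *)
Lemma derive_sym (U : set V) (s : V -> R) (x v w : V) : open U -> C2_on U s -> U x ->
  'D_v (fun y => 'D_w s y) x = 'D_w (fun y => 'D_v s y) x.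
Proof.
move=> oU s2 Ux; apply/eqP; rewrite -subr_eq0 -normr_le0; apply/ler_addgt0Pr => e e0.
rewrite add0r; have e2 : 0 < e / 2 by lra.
have scale_inj (k u1 u2 y z : R) : k != 0 -> u1 = k * y -> u2 = k * z -> u1 = u2 -> y = z.
  by move=> k0 -> -> /(mulfI k0).
have triangle (y z q : R) : `|y - q| < e / 2 -> `|z - q| < e / 2 -> `|y - z| <= e.
  by move=> yq zq; have := ler_distD q y z; rewrite (distrC q z); lra.
have /cvgrPdist_lt/(_ _ e2) c1 := (s2.2 w x Ux).2 v.
have /cvgrPdist_lt/(_ _ e2) c2 := (s2.2 v x Ux).2 w.
have [d /= d0 Hd] := iffLR (nbhs_normP _ _) (filterI (open_nbhs_nbhs (conj oU Ux)) (filterI c1 c2)).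
pose c := 1 + `|v| + `|w|; have c0 : 0 < c by rewrite /c -addrA ltr_pwDl // addr_ge0.
(* The parallelogram with sides [h *: v] and [h *: w] then stays within distance d / 2 of x. *)
pose h := d / (2 * c); have h0 : 0 < h by rewrite divr_gt0 // mulr_gt0.
have near a b : 0 <= a <= h -> 0 <= b <= h -> `|x - (x + a *: v + b *: w)| < d.
  move=> /andP[a0 ah] /andP[b0 bh].
  rewrite -addrA opprD addNKr normrN; apply: le_lt_trans (ler_normD _ _) _.
  rewrite !normrZ !ger0_norm //.
  have : a * `|v| <= h * `|v| by rewrite ler_wpM2r.
  have : b * `|w| <= h * `|w| by rewrite ler_wpM2r.
  have -> : d = 2 * (h * c) by rewrite /h; field; rewrite gt_eqF.
  have : 0 < h * c by rewrite mulr_gt0.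
  have -> : h * c = h + h * `|v| + h * `|w| by rewrite /c; ring.
  by move=> ? ? ?; lra.
have lt_le t : 0 < t < h -> 0 <= t <= h by case/andP=> ? ?; rewrite !ltW.
have [a [b [ah bh E]]] := @second_difference U s x v w h s2 h0
  (fun a b ah bh => (Hd _ (near a b ah bh)).1).
have sw a' b' : x + a' *: v + b' *: w = x + b' *: w + a' *: v by rewrite addrAC.
have HU' a' b' : 0 <= a' <= h -> 0 <= b' <= h -> U (x + a' *: w + b' *: v).
  by move=> ah' bh'; rewrite -sw; exact: (Hd _ (near b' a' bh' ah')).1.
have [a' [b' [ah' bh' E']]] := second_difference s2 h0 HU'.
have [_ [_ H1]] := Hd _ (near a b (lt_le _ ah) (lt_le _ bh)).
have [_ [H2 _]] := Hd _ (near b' a' (lt_le _ bh') (lt_le _ ah')).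
rewrite sw in H2.
apply: triangle H2 _; rewrite -(scale_inj _ _ _ _ _ _ E E') //.
  by rewrite expf_neq0 // gt_eqF.
by rewrite -[x + h *: w + h *: v]sw; congr (_ + _); rewrite -!addrA; congr (_ + _); exact: addrC.
Qed.

End Schwarz.

Lemma hess_sym (R : realType) N (U : set 'cV[R]_N) (s : 'cV[R]_N -> R) rho :
  open U -> C2_on U s -> U rho -> (hess s rho)^T = hess s rho.
Proof.
by move=> oU s2 Ur; apply/matrixP => i j; rewrite !mxE; exact: (derive_sym _ _ oU s2 Ur).
Qed.

(** * The Frobenius product *)

Section Frobenius.
Variable R : realType.

Lemma frobE m n (P Q : 'M[R]_(m, n)) : frob P Q = \sum_i \sum_j P i j * Q i j.
Proof.
rewrite /frob /mxtrace exchange_big; apply: eq_bigr => j _; rewrite mxE.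
by apply: eq_bigr => i _; rewrite mxE mulrC.
Qed.

Lemma frobC m n (P Q : 'M[R]_(m, n)) : frob P Q = frob Q P.
Proof.
by rewrite !frobE; apply: eq_bigr => i _; apply: eq_bigr => j _; rewrite mulrC.
Qed.

Lemma frob_linl m n a (P P' Q : 'M[R]_(m, n)) :
  frob (a *: P + P') Q = a * frob P Q + frob P' Q.
Proof. by rewrite /frob mulmxDr -scalemxAr mxtraceD mxtraceZ. Qed.

Lemma frob_linr m n a (P Q Q' : 'M[R]_(m, n)) :
  frob P (a *: Q + Q') = a * frob P Q + frob P Q'.
Proof. by rewrite frobC frob_linl ![frob _ P]frobC. Qed.

Lemma frob_ge0 m n (P : 'M[R]_(m, n)) : 0 <= frob P P.
Proof. by rewrite frobE; do 2 apply: sumr_ge0 => ? _; rewrite -expr2 sqr_ge0. Qed.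

Lemma frob_eq0 m n (P : 'M[R]_(m, n)) : frob P P = 0 -> P = 0.
Proof.
rewrite frobE => /eqP; rewrite psumr_eq0 => [/allP P0|i _]; last first.
  by apply: sumr_ge0 => j _; rewrite -expr2 sqr_ge0.
apply/matrixP => i j; have := P0 i (mem_index_enum i); rewrite /= psumr_eq0; last first.
  by move=> k _; rewrite -expr2 sqr_ge0.
by move=> /allP/(_ j (mem_index_enum j)); rewrite /= mulf_eq0 orbb mxE => /eqP.
Qed.

(** This adjunction serves both the cancellation of the coupling terms and the passage from the
    transposed diffusion matrix to the coercivity hypothesis. *)
Lemma frob_mulmx_tr m n k (B : 'M[R]_(k, m)) (P : 'M[R]_(k, n)) (Q : 'M[R]_(m, n)) :
  frob (B^T *m P) Q = frob (B *m Q) P.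
Proof. by rewrite frobC /frob trmx_mul trmxK mulmxA. Qed.

Lemma frob_col m n (P Q : 'M[R]_(m, n)) : frob P Q = \sum_k frob (col k P) (col k Q).
Proof.
rewrite frobE exchange_big; apply: eq_bigr => k _.
by rewrite frobE; apply: eq_bigr => i _; rewrite big_ord1 !mxE.
Qed.

Lemma continuous_entry (T : topologicalType) m n (F : T -> 'M[R]_(m, n)) i j :
  continuous F -> continuous (fun x => F x i j).
Proof.
move=> cF.
exact: (@continuous_compose _ _ _ F (fun A => A i j) cF (@coord_continuous _ _ _ i j)).
Qed.

Lemma continuous_frob (T : topologicalType) m n (P Q : T -> 'M[R]_(m, n)) :
  continuous P -> continuous Q -> continuous (fun x => frob (P x) (Q x)).
Proof.
move=> cP cQ; under eq_fun do rewrite frobE.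
by do 2 apply: continuous_sum => ?; apply: continuous_mul; exact: continuous_entry.
Qed.

Lemma continuous_mulmx (T : topologicalType) m n k (P : T -> 'M[R]_(m, n))
    (Q : T -> 'M[R]_(n, k)) :
  continuous P -> continuous Q -> continuous (fun x => P x *m Q x).
Proof.
move=> cP cQ; apply: continuous_mx => i j; under eq_fun do rewrite mxE.
by apply: continuous_sum => l; apply: continuous_mul; exact: continuous_entry.
Qed.

Lemma continuous_trmx (T : topologicalType) m n (P : T -> 'M[R]_(m, n)) :
  continuous P -> continuous (fun x => (P x)^T).
Proof.
move=> cP; apply: continuous_mx => i j; under eq_fun do rewrite mxE.
exact: continuous_entry.
Qed.

Lemma continuous_scale (T : topologicalType) (V : normedModType R) (a : T -> R) (f : T -> V) :
  continuous a -> continuous f -> continuous (fun x => a x *: f x).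
Proof. by move=> ca cf x; exact: cvgZ (ca x) (cf x). Qed.

Lemma continuous_opp (T : topologicalType) (V : normedModType R) (f : T -> V) :
  continuous f -> continuous (fun x => - f x).
Proof. by move=> cf x; exact: cvgN (cf x). Qed.

End Frobenius.

(** * Linearity of the discrete forms *)

Section FiniteElements.
Variables (R : realType) (d : nat) (M : mesh R d).

(** The hull is the image of the standard simplex under a continuous map, hence compact. *)
Lemma hull_bounded_closed (I : finType) n (v : I -> 'rV[R]_n) :
  closed (hull predT v) /\ exists r, forall x, hull predT v x -> `|x| <= r.
Proof.
pose comb (y : 'rV[R]_#|I|) : 'rV[R]_n := \sum_k y 0 k *: v (enum_val k).
have -> : hull predT v = comb @` @stdsimplex R #|I|.
  apply/seteqP; split => x.
    case=> l [l0 _ l1 ->]; exists (\row_k l (enum_val k)).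
      split=> [k|]; first by rewrite mxE.
      rewrite -[RHS]l1 [RHS](reindex_onto enum_val enum_rank) /=; last by move=> ? _; exact: enum_rankK.
      by apply: eq_big => k; rewrite ?enum_valK ?eqxx // => _; rewrite mxE.
    rewrite /comb [RHS](reindex_onto enum_val enum_rank) /=; last by move=> ? _; exact: enum_rankK.
    by apply: eq_big => k; rewrite ?enum_valK ?eqxx // => _; rewrite mxE.
  case=> y [y0 y1] <-; exists (fun i => y 0 (enum_rank i)); split=> //.
    rewrite -[RHS]y1 (reindex_onto enum_val enum_rank) /=; last by move=> ? _; exact: enum_rankK.
    by apply: eq_big => k; rewrite ?enum_valK ?eqxx.
  rewrite /comb [RHS](reindex_onto enum_val enum_rank) /=; last by move=> ? _; exact: enum_rankK.
  by apply: eq_big => k; rewrite ?enum_valK ?eqxx.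
have ccomb : continuous comb.
  apply: continuous_sum => k; apply: continuous_scale; last exact: continuous_cst.
  exact: coord_continuous.
have cpt : compact (comb @` @stdsimplex R #|I|).
  apply: continuous_compact; last exact: stdsimplex_compact.
  exact: continuous_subspaceT.
split; first by apply: compact_closed cpt; exact: norm_hausdorff.
have [r [_ rP]] := compact_bounded cpt; exists (`|r| + 1) => x xC.
by apply: rP xC; rewrite ltr_pwDr // ler_norm.
Qed.

Lemma simplex_bounded_measurable (K : cell M) : bounded_measurable (simplex K).
Proof.
have [cK bK] := hull_bounded_closed (vertex K).
by split=> //; exact: closed_tuple_set_measurable.
Qed.

Lemma facet_parameters_bounded_measurable :
  bounded_measurable [set t : 'rV[R]_d | (forall k, 0 <= t 0 k) /\ \sum_k t 0 k <= 1].
Proof.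
split; last first.
  exists 1 => t [t0 t1]; apply: mx_norm_le => // i j; rewrite ord1 ger0_norm //.
  by apply: le_trans t1; rewrite (bigD1 j) //= lerDl sumr_ge0.
apply: closed_tuple_set_measurable.
rewrite (_ : [set t | _] = (\bigcap_k [set t : 'rV[R]_d | 0 <= t 0 k]) `&`
    [set t : 'rV[R]_d | \sum_k t 0 k <= 1]); last first.
  by apply/seteqP; split=> t [t0 t1]; split=> // k; [move=> _|]; exact: t0.
apply: closedI; first apply: closed_bigI => k _.
  apply: (@closed_comp _ _ (fun t : 'rV[R]_d => t 0 k) [set x | 0 <= x]).
    by move=> t _; exact: coord_continuous.
  exact: closed_ge.
apply: (@closed_comp _ _ (fun t : 'rV[R]_d => \sum_k t 0 k) [set x | x <= 1]).
  by move=> t _; apply: continuous_sum => k s; exact: coord_continuous.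
exact: closed_le.
Qed.

Lemma facet_integral_lin (F : facet M) a (g h : 'rV[R]_d.+1 -> R) :
  continuous g -> continuous h ->
  facet_integral F (fun x => a * g x + h x) = a * facet_integral F g + facet_integral F h.
Proof.
move=> cg ch; rewrite /facet_integral.
set v := vertex F.1 _; set E := \matrix_(_, _) _.
have caff : continuous (fun t : 'rV[R]_d => v + t *m E).
  apply: continuous_add; first exact: continuous_cst.
  by apply: continuous_mulmx; [move=> t; exact: cvg_id|exact: continuous_cst].
rewrite (integral_on_lin facet_parameters_bounded_measurable a (continuous_compose caff cg)
  (continuous_compose caff ch)).
by rewrite mulrDr mulrCA.
Qed.

Lemma facet_integral_ge0 (F : facet M) (g : 'rV[R]_d.+1 -> R) :
  (forall x, 0 <= g x) -> 0 <= facet_integral F g.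
Proof.
move=> g0; apply: mulr_ge0; first exact: sqrtr_ge0.
by apply: Rintegral_ge0 => t _.
Qed.

Lemma interior_integral_lin (fx : flux M) a (g h : facet M * facet M -> 'rV[R]_d.+1 -> R) :
  (forall F, continuous (g F)) -> (forall F, continuous (h F)) ->
  interior_integral fx (fun F x => a * g F x + h F x) =
  a * interior_integral fx g + interior_integral fx h.
Proof.
move=> cg ch; rewrite /interior_integral mulr_sumr -big_split /=.
by apply: eq_bigr => F _; exact: facet_integral_lin.
Qed.

Lemma boundary_integral_lin Omega a (g h : facet M -> 'rV[R]_d.+1 -> R) :
  (forall F, continuous (g F)) -> (forall F, continuous (h F)) ->
  boundary_integral Omega (fun F x => a * g F x + h F x) =
  a * boundary_integral Omega g + boundary_integral Omega h.
Proof.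
move=> cg ch; rewrite /boundary_integral mulr_sumr -big_split /=.
by apply: eq_bigr => F _; exact: facet_integral_lin.
Qed.

Section Forms.
Variables (Omega : set 'rV[R]_d.+1) (fx : flux M) (p : nat).

Lemma Sp_mx_continuous m n (w : broken M m n) K : Sp_mx p w -> continuous (w K).
Proof.
move=> Sw; apply: continuous_mx => i j.
by have [] := polynomial_fun_C1 0 (Sw i j K).
Qed.

Lemma Sp_mx0 m n : Sp_mx p ((fun _ _ => 0) : broken M m n).
Proof.
move=> i j K; exists (fun=> 0) => x; rewrite mxE big1 // => a _.
by rewrite mul0r.
Qed.

Lemma Sp_component N (w : broken M N 1) i : Sp_mx p w -> Sp p (component w i).
Proof. by move=> Sw; exact: Sw. Qed.

Lemma Sp_row_component N (w : broken M N d.+1) i : Sp_mx p w -> Sp_mx p (row_component w i).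
Proof.
move=> Sw k j K; rewrite (_ : (fun x => _) = (fun x => w K x i j)); first exact: Sw.
by apply/funext => x; rewrite mxE.
Qed.

Lemma Sp_continuous (w : scalar_broken M) K : Sp p w -> continuous (w K).
Proof. by move=> Sw; have [] := polynomial_fun_C1 0 (Sw K). Qed.

Lemma continuous_divergence (psi : broken M 1 d.+1) K : Sp_mx p psi ->
  continuous (divergence (psi K)).
Proof.
move=> Spsi; apply: continuous_sum => k.
by have [_ _] := polynomial_fun_C1 (delta_mx 0 k) (Spsi 0 k K).
Qed.

Lemma divergence_lin a (psi psi' : broken M 1 d.+1) K x : Sp_mx p psi -> Sp_mx p psi' ->
  divergence (fun x => a *: psi K x + psi' K x) x =
  a * divergence (psi K) x + divergence (psi' K) x.
Proof.
move=> Spsi Spsi'; rewrite /divergence mulr_sumr -big_split /=; apply: eq_bigr => k _.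
have [_ d1 _] := polynomial_fun_C1 (delta_mx 0 k) (Spsi 0 k K).
have [_ d2 _] := polynomial_fun_C1 (delta_mx 0 k) (Spsi' 0 k K).
rewrite (_ : (fun y => _) = (a *: (fun y => psi K y 0 k)) + (fun y => psi' K y 0 k)).
  by rewrite deriveD ?deriveZ //; exact: derivableZ.
by apply/funext => y; rewrite !mxE.
Qed.

Let average_continuous (w : scalar_broken M) (F : facet M * facet M) : Sp p w ->
  continuous (fun x => (1 - weight fx F.1.1 F.2.1) * w F.1.1 x + weight fx F.1.1 F.2.1 * w F.2.1 x).
Proof.
move=> Sw; apply: continuous_add; apply: continuous_mul;
  by [exact: continuous_cst|exact: Sp_continuous].
Qed.

Let flux_continuous (psi : broken M 1 d.+1) (F : facet M * facet M) nu : Sp_mx p psi ->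
  continuous (fun x => frob (psi F.1.1 x - psi F.2.1 x) nu).
Proof.
move=> Sw; apply: continuous_frob; last exact: continuous_cst.
by apply: continuous_add; [|apply: continuous_opp]; exact: Sp_mx_continuous Sw.
Qed.

Let trace_continuous (psi : broken M 1 d.+1) (F : facet M) nu : Sp_mx p psi ->
  continuous (fun x => frob (psi F.1 x) nu).
Proof.
by move=> Sw; apply: continuous_frob; [exact: Sp_mx_continuous Sw|exact: continuous_cst].
Qed.

Let lin_comb3 (a x y z x' y' z' : R) :
  - (a * x + x') - (a * y + y') + (a * z + z') = a * (- x - y + z) + (- x' - y' + z').
Proof. ring. Qed.

Let flux_term (w : scalar_broken M) (psi : broken M 1 d.+1) :=
  interior_integral fx (fun F x =>
    ((1 - weight fx F.1.1 F.2.1) * w F.1.1 x + weight fx F.1.1 F.2.1 * w F.2.1 x) *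
    frob (psi F.1.1 x - psi F.2.1 x) (facet_normal F.1)).

Let trace_term (w : scalar_broken M) (psi : broken M 1 d.+1) :=
  boundary_integral Omega (fun F x => w F.1 x * frob (psi F.1 x) (facet_normal F)).

Let volume_term (w : scalar_broken M) (psi : broken M 1 d.+1) :=
  \sum_K integral_on (simplex K) (fun x => w K x * divergence (psi K) x).

Let b_hE w psi :
  b_h Omega fx w psi = - flux_term w psi - trace_term w psi + volume_term w psi.
Proof. by []. Qed.

Lemma b_h_linl a (w w' : scalar_broken M) (psi : broken M 1 d.+1) :
  Sp p w -> Sp p w' -> Sp_mx p psi ->
  b_h Omega fx (fun K x => a * w K x + w' K x) psi =
  a * b_h Omega fx w psi + b_h Omega fx w' psi.
Proof.
move=> Sw Sw' Spsi; rewrite !b_hE -lin_comb3; congr (- _ - _ + _).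
- rewrite /flux_term -interior_integral_lin => [|F|F].
  + by congr interior_integral; apply/funext => F; apply/funext => x /=; ring.
  + by apply: continuous_mul; [exact: average_continuous|exact: flux_continuous].
  + by apply: continuous_mul; [exact: average_continuous|exact: flux_continuous].
- rewrite /trace_term -boundary_integral_lin => [|F|F].
  + congr boundary_integral; apply/funext => F; apply/funext => x /=.
    by rewrite mulrDl mulrA.
  + by apply: continuous_mul; [exact: Sp_continuous|exact: trace_continuous].
  + by apply: continuous_mul; [exact: Sp_continuous|exact: trace_continuous].
- rewrite /volume_term mulr_sumr -big_split /=; apply: eq_bigr => K _.
  rewrite -(integral_on_lin (simplex_bounded_measurable K)).
  + by congr integral_on; apply/funext => x; rewrite mulrDl mulrA.
  + by apply: continuous_mul; [exact: Sp_continuous|exact: continuous_divergence].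
  + by apply: continuous_mul; [exact: Sp_continuous|exact: continuous_divergence].
Qed.

Lemma b_h_linr a (w : scalar_broken M) (psi psi' : broken M 1 d.+1) :
  Sp p w -> Sp_mx p psi -> Sp_mx p psi' ->
  b_h Omega fx w (fun K x => a *: psi K x + psi' K x) =
  a * b_h Omega fx w psi + b_h Omega fx w psi'.
Proof.
move=> Sw Spsi Spsi'; rewrite !b_hE -lin_comb3; congr (- _ - _ + _).
- rewrite /flux_term -interior_integral_lin => [|F|F].
  + congr interior_integral; apply/funext => F; apply/funext => x /=.
    by rewrite opprD addrACA -scalerBr frob_linl mulrDr mulrCA.
  + by apply: continuous_mul; [exact: average_continuous|exact: flux_continuous].
  + by apply: continuous_mul; [exact: average_continuous|exact: flux_continuous].
- rewrite /trace_term -boundary_integral_lin => [|F|F].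
  + congr boundary_integral; apply/funext => F; apply/funext => x /=.
    by rewrite frob_linl mulrDr mulrCA.
  + by apply: continuous_mul; [exact: Sp_continuous|exact: trace_continuous].
  + by apply: continuous_mul; [exact: Sp_continuous|exact: trace_continuous].
- rewrite /volume_term mulr_sumr -big_split /=; apply: eq_bigr => K _.
  rewrite -(integral_on_lin (simplex_bounded_measurable K)).
  + by congr integral_on; apply/funext => x; rewrite divergence_lin // mulrDr mulrCA.
  + by apply: continuous_mul; [exact: Sp_continuous|exact: continuous_divergence].
  + by apply: continuous_mul; [exact: Sp_continuous|exact: continuous_divergence].
Qed.

Lemma s_hC nA (w l : scalar_broken M) : s_h fx nA w l = s_h fx nA l w.
Proof.
by congr interior_integral; apply/funext => F; apply/funext => x /=; rewrite frobC.
Qed.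

Lemma s_h_linl nA a (w w' l : scalar_broken M) : Sp p w -> Sp p w' -> Sp p l ->
  s_h fx nA (fun K x => a * w K x + w' K x) l = a * s_h fx nA w l + s_h fx nA w' l.
Proof.
have cs (v v' : scalar_broken M) (F : facet M * facet M) : Sp p v -> Sp p v' ->
   continuous (fun x => eta_F fx nA F * frob ((v F.1.1 x - v F.2.1 x) *: facet_normal F.1)
     ((v' F.1.1 x - v' F.2.1 x) *: facet_normal F.1)).
  move=> Sv Sv'; apply: continuous_mul; first exact: continuous_cst.
  apply: continuous_frob; apply: continuous_scale; try exact: continuous_cst;
   by apply: continuous_add; [|apply: continuous_opp]; exact: Sp_continuous.
move=> Sw Sw' Sl; rewrite /s_h -interior_integral_lin; try by move=> F; exact: cs.
congr interior_integral; apply/funext => F; apply/funext => x /=.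
by rewrite opprD addrACA -mulrBr scalerDl -scalerA frob_linl mulrDr mulrCA.
Qed.

Lemma s_h_linr nA a (w l l' : scalar_broken M) : Sp p w -> Sp p l -> Sp p l' ->
  s_h fx nA w (fun K x => a * l K x + l' K x) = a * s_h fx nA w l + s_h fx nA w l'.
Proof. 
move=> Sw Sl Sl'; rewrite (s_hC _ w) s_h_linl //.
by rewrite (s_hC _ l w) (s_hC _ l' w).
 Qed.

Lemma s_h_ge0 nA (w : scalar_broken M) : admissible_flux fx -> 0 <= nA -> 0 <= s_h fx nA w w.
Proof.
move=> [_ _ fx0] nA0; apply: sumr_ge0 => F _; apply: facet_integral_ge0 => x.
(* A set of distances without a supremum gets the default value 0 of [sup]. *)
have diam_ge0 (D : set 'rV[R]_d.+1) : 0 <= diam D.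
  rewrite /diam; have [[[r rD] ubD]|/sup_out -> //] :=
    pselect (has_sup [set enorm (x - y) | x in D & y in D]).
  apply: le_trans (ub_le_sup ubD rD).
  by case: rD => y _ [z _ <-]; exact: sqrtr_ge0.
apply: mulr_ge0; last exact: frob_ge0.
apply: mulr_ge0 => //; rewrite invr_ge0 mulr_ge0 ?invr_ge0 ?(ltW fx0) //.
by rewrite le_min !diam_ge0.
Qed.

End Forms.
End FiniteElements.

(** * Linear functionals on the discrete spaces and the lifting [zeta_h] *)

Section Functionals.
Variables (R : realType) (d : nat) (M : mesh R d) (p : nat).

(** Restricted to polynomial fields, since arbitrary branches need not be integrable or
    differentiable and the forms are not additive on them. *)
Definition linear_on m n (F : broken M m n -> R) := forall a (v w : broken M m n),
  Sp_mx p v -> Sp_mx p w -> F (fun K x => a *: v K x + w K x) = a * F v + F w.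

Definition lincomb m n q (B : 'I_q -> broken M m n) (c : 'rV[R]_q) : broken M m n :=
  fun K x => \sum_k c 0 k *: B k K x.

Section Lincomb.
Variables (m n q : nat) (B : 'I_q -> broken M m n).
Hypothesis SB : forall k, Sp_mx p (B k).

Let lincomb_seq (F : broken M m n -> R) (r : seq 'I_q) (c : 'rV[R]_q) : linear_on F ->
  Sp_mx p ((fun K x => \sum_(k <- r) c 0 k *: B k K x) : broken M m n) /\
  F (fun K x => \sum_(k <- r) c 0 k *: B k K x) = \sum_(k <- r) c 0 k * F (B k).
Proof.
move=> lF; have S0 := @Sp_mx0 R d M p m n.
elim: r => [|k r [Sr Fr]].
  have E0 : (fun K x => \sum_(k <- [::]) c 0 k *: B k K x) = (fun _ _ => 0) :> broken M m n.
    by apply/funext => K; apply/funext => x; rewrite big_nil.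
  (* The coefficient - 1 on two zero fields gives F(0) = - F(0) + F(0) = 0. *)
  rewrite E0 big_nil; split=> //; have := lF (- 1) _ _ S0 S0.
  have -> : (fun (K : cell M) (x : 'rV[R]_d.+1) => (-1) *: (0 : 'M[R]_(m, n)) + 0) = (fun _ _ => 0).
    by apply/funext => K; apply/funext => x; rewrite scaler0 addr0.
  by move=> E; have : F (fun _ _ => 0) = 0 by rewrite E mulN1r addNr.
have E1 : (fun K x => \sum_(j <- k :: r) c 0 j *: B j K x) =
    (fun K x => c 0 k *: B k K x + \sum_(j <- r) c 0 j *: B j K x) :> broken M m n.
  by apply/funext => K; apply/funext => x; rewrite big_cons.
rewrite E1 big_cons; split; first exact: Sp_mx_lin.
by rewrite lF // Fr.
Qed.

Lemma Sp_mx_lincomb c : Sp_mx p (lincomb B c).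
Proof.
have l0 : linear_on (fun _ : broken M m n => 0) by move=> a v w _ _; rewrite mulr0 addr0.
by have [] := lincomb_seq (index_enum 'I_q) c l0.
Qed.

Lemma linear_on_lincomb F c : linear_on F ->
  F (lincomb B c) = \sum_k c 0 k * F (B k).
Proof. by move=> lF; have [_] := lincomb_seq (index_enum 'I_q) c lF. Qed.

Lemma continuous_lincomb (T : topologicalType) (c : T -> 'rV[R]_q) (x : T -> 'rV[R]_d.+1) K :
  continuous c -> continuous x -> continuous (fun t => lincomb B (c t) K (x t)).
Proof.
move=> cc cx; apply: continuous_sum => k; apply: continuous_scale.
  exact: continuous_entry.
by apply: (continuous_compose cx) => y; exact: Sp_mx_continuous (SB k) y.
Qed.

End Lincomb.

Lemma linear_onD m n (F G : broken M m n -> R) :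
  linear_on F -> linear_on G -> linear_on (fun v => F v + G v).
Proof. by move=> lF lG a v w Sv Sw; rewrite lF // lG // mulrDr addrACA. Qed.

Lemma linear_onZ m n b (F : broken M m n -> R) :
  linear_on F -> linear_on (fun v => b * F v).
Proof. by move=> lF a v w Sv Sw; rewrite lF // mulrDr mulrCA. Qed.

Lemma linear_on_sum m n (I : finType) (F : I -> broken M m n -> R) :
  (forall i, linear_on (F i)) -> linear_on (fun v => \sum_i F i v).
Proof.
move=> lF a v w Sv Sw; rewrite mulr_sumr -big_split /=.
by apply: eq_bigr => i _; rewrite lF.
Qed.

Lemma component_lin N a (v w : broken M N 1) i :
  component (fun K x => a *: v K x + w K x) i =
  (fun K x => a * component v i K x + component w i K x).
Proof. by apply/funext => K; apply/funext => x; rewrite /component !mxE. Qed.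

Lemma row_component_lin N a (v w : broken M N d.+1) i :
  row_component (fun K x => a *: v K x + w K x) i =
  (fun K x => a *: row_component v i K x + row_component w i K x).
Proof.
apply/funext => K; apply/funext => x; apply/rowP => j.
by rewrite /row_component !mxE.
Qed.

Section Omega.
Variables (Omega : set 'rV[R]_d.+1) (fx : flux M).
Hypotheses (oOmega : open Omega) (hM : conforming_mesh M Omega).

Lemma cell_bounded_measurable (K : cell M) : bounded_measurable (Omega `&` simplex K).
Proof.
have [mK [r Kr]] := simplex_bounded_measurable K; split; last by exists r => x [_ /Kr].
rewrite (_ : tuple_set _ = tuple_set Omega `&` tuple_set (simplex K)) //.
by apply: measurableI => //; exact: open_tuple_set_measurable.
Qed.

(** The inverse edge matrix gives barycentric coordinates, and their positivity cuts out a nonempty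
    open part of the simplex. It lies in the closure of Omega, so it meets Omega itself. *)
Lemma cell_open (K : cell M) : exists U, [/\ open U, U !=set0 & U `<=` Omega `&` simplex K].
Proof.
have [/(_ K) + cover _ _] := hM; set E := \matrix_(_, _) _ => uE.
pose v0 := vertex K ord0.
pose y (x : 'rV[R]_d.+1) := (x - v0) *m invmx E.
have cy : continuous y.
  apply: continuous_mulmx; last exact: continuous_cst.
  apply: continuous_add; [move=> x; exact: cvg_id|exact: continuous_cst].
pose U := (\bigcap_k [set x | 0 < y x 0 k]) `&` [set x | \sum_k y x 0 k < 1].
have oU : open U.
  apply: openI.
    rewrite (_ : \bigcap_k _ = ~` \bigcup_k [set x | y x 0 k <= 0]); last first.
      rewrite setC_bigcup; apply: eq_bigcapr => k _; apply/seteqP; split => x /=.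
        by rewrite ltNge => /negP.
      by move/negP; rewrite -ltNge.
    apply: closed_openC; apply: closed_bigcup => [|k _]; first exact: finite_finset.
    apply: (@closed_comp _ _ (fun x => y x 0 k) [set z | z <= 0]).
      by move=> x _; exact: (continuous_entry cy).
    exact: closed_le.
  rewrite (_ : [set x | _] = ~` [set x | 1 <= \sum_k y x 0 k]); last first.
    apply/seteqP; split => x /=; first by rewrite ltNge => /negP.
    by move/negP; rewrite -ltNge.
  apply: closed_openC.
  apply: (@closed_comp _ _ (fun x => \sum_k y x 0 k) [set z | 1 <= z]).
    by move=> x _; apply: continuous_sum => k z; exact: (continuous_entry cy).
  exact: closed_ge.
have US : U `<=` simplex K.
  move=> x [y0 y1].
  exists (fun i => if unlift ord0 i is Some k then y x 0 k else 1 - \sum_k y x 0 k).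
  split=> // [i||].
  - by case: unliftP => [k _|_]; [rewrite ltW // y0|rewrite subr_ge0 ltW].
  - rewrite big_ord_recl unlift_none -[RHS](subrK (\sum_k y x 0 k)); congr (_ + _).
    by apply: eq_bigr => k _; rewrite liftK.
  - rewrite big_ord_recl unlift_none.
    rewrite (eq_bigr (fun k => y x 0 k *: vertex K (lift ord0 k))); last first.
      by move=> k _; rewrite liftK.
    rewrite scalerBl scale1r -addrA scaler_suml -sumrN -big_split /= -/v0.
    have -> : x = v0 + y x *m E by rewrite mulmxKV // addrC subrK.
    congr (_ + _); have -> : y (v0 + y x *m E) = y x by rewrite mulmxKV // [v0 + _]addrC subrK.
    apply/rowP => l; rewrite summxE mxE; apply: eq_bigr => k _.
    by rewrite !mxE mulrBr addrC.
have U0 : U !=set0.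
  (* The witness is the barycentre: d + 1 coordinates equal to 1 / (d + 2) have sum below 1. *)
  pose b := (d.+2%:R : R)^-1.
  have b0 : 0 < b by rewrite invr_gt0 ltr0n.
  exists (v0 + const_mx b *m E).
  have yE : y (v0 + const_mx b *m E) = const_mx b by rewrite /y addrAC subrr add0r mulmxK.
  split; first by move=> k _; rewrite /= yE mxE.
  rewrite /= yE; under eq_bigr do rewrite mxE.
  rewrite sumr_const card_ord -[_ *+ _]mulr_natl ltr_pdivrMr ?ltr0n // mul1r.
  by rewrite ltr_nat.
have [x Ux] := U0.
have : closure Omega x by rewrite cover; exists K => //; exact: US.
move=> /(_ U (open_nbhs_nbhs (conj oU Ux)))[z [Oz Uz]].
exists (Omega `&` U); split; [exact: openI|by exists z|].
by move=> w [Ow Uw]; split=> //; exact: US.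
Qed.

Lemma integral_Omega_lin a (g h : scalar_broken M) :
  (forall K, continuous (g K)) -> (forall K, continuous (h K)) ->
  integral_Omega Omega (fun K x => a * g K x + h K x) =
  a * integral_Omega Omega g + integral_Omega Omega h.
Proof.
move=> cg ch; rewrite /integral_Omega mulr_sumr -big_split /=; apply: eq_bigr => K _.
exact: (integral_on_lin (cell_bounded_measurable K) a (cg K) (ch K)).
Qed.

Lemma continuous_integral_Omega (V : normedModType R) (F : V -> scalar_broken M) :
  (forall K, continuous (fun q : V * 'rV[R]_d.+1 => F q.1 K q.2)) ->
  continuous (fun v => integral_Omega Omega (F v)).
Proof.
move=> cF; apply: continuous_sum => K.
exact: (continuous_parametric_integral (cell_bounded_measurable K) (F := fun v => F v K)).
Qed.

Lemma linear_on_inner m n (P : broken M m n) : (forall K, continuous (P K)) ->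
  linear_on (fun v : broken M m n => integral_Omega Omega (fun K x => frob (P K x) (v K x))).
Proof.
move=> cP a v w Sv Sw; rewrite -integral_Omega_lin => [|K|K].
- by congr integral_Omega; apply/funext => K; apply/funext => x; rewrite frob_linr.
- by apply: continuous_frob; [exact: cP|exact: Sp_mx_continuous Sv].
- by apply: continuous_frob; [exact: cP|exact: Sp_mx_continuous Sw].
Qed.

(** A vanishing integral gives z = 0 on an open part of each cell only; the polynomial branch is
    then zero on the whole space. *)
Lemma inner_pos m n (z : broken M m n) : Sp_mx p z ->
  0 <= integral_Omega Omega (fun K x => frob (z K x) (z K x)) /\
  (integral_Omega Omega (fun K x => frob (z K x) (z K x)) = 0 -> forall K x, z K x = 0).
Proof.
move=> Sz; have ge0 K : 0 <= integral_on (Omega `&` simplex K) (fun x => frob (z K x) (z K x)).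
  by apply: Rintegral_ge0 => t _; exact: frob_ge0.
split=> [|z0 K x]; first by apply: sumr_ge0 => K _.
have cz : continuous (fun x => frob (z K x) (z K x)).
  by apply: continuous_frob; exact: Sp_mx_continuous Sz.
have [U [oU U0 UK]] := cell_open K.
have zU y : U y -> z K y = 0.
  move=> Uy; apply: frob_eq0; apply/eqP/negPn/negP => zy.
  have := integral_on_gt0 (cell_bounded_measurable K) oU UK cz (fun y => frob_ge0 _) Uy.
  rewrite lt0r zy frob_ge0 => /(_ isT).
  suff -> : integral_on (Omega `&` simplex K) (fun x => frob (z K x) (z K x)) = 0 by rewrite ltxx.
  by apply: (psumr_eq0P (fun K _ => ge0 K) z0).
apply/matrixP => i j; rewrite mxE.
apply: (polynomial_fun_eq0 oU U0 (Sz i j K)) => y Uy.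
by rewrite zU // mxE.
Qed.

(* The Gram matrix of a basis is invertible. *)
Lemma riesz m n (F : broken M m n -> R) : linear_on F -> exists z : broken M m n, Sp_mx p z /\
  forall psi : broken M m n, Sp_mx p psi ->
    integral_Omega Omega (fun K x => frob (z K x) (psi K x)) = F psi.
Proof.
move=> lF; have [q [B [SB Bgen Bfree]]] := @Sp_mx_basis R d M p m n.
pose ip (v w : broken M m n) := integral_Omega Omega (fun K x => frob (v K x) (w K x)).
have ipl (v : broken M m n) : Sp_mx p v -> linear_on (ip v).
  by move=> Sv; apply: linear_on_inner => K; exact: Sp_mx_continuous Sv.
have ipC v w : ip v w = ip w v.
  by congr integral_Omega; apply/funext => K; apply/funext => x; exact: frobC.
pose G : 'M[R]_q := \matrix_(k, l) ip (B k) (B l).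
have ipB c l : ip (lincomb B c) (B l) = (c *m G) 0 l.
  rewrite ipC (linear_on_lincomb SB _ (ipl _ (SB l))) mxE; apply: eq_bigr => k _.
  by rewrite mxE ipC.
have uG : G \in unitmx.
  rewrite -row_free_unit; apply: inj_row_free => c cG; apply: Bfree.
  have [_] := inner_pos (Sp_mx_lincomb SB c); apply.
  rewrite [LHS](linear_on_lincomb SB c (ipl _ (Sp_mx_lincomb SB c))).
  by rewrite big1 // => k _; rewrite ipB cG mxE mulr0.
pose c := \row_l F (B l) *m invmx G.
exists (lincomb B c); split=> [|psi Spsi]; first exact: Sp_mx_lincomb.
have [e eE] := Bgen psi Spsi.
have -> : psi = lincomb B e by apply/funext => K; apply/funext => x; rewrite eE.
rewrite [LHS](linear_on_lincomb SB e (ipl _ (Sp_mx_lincomb SB c))) (linear_on_lincomb SB e lF).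
by apply: eq_bigr => k _; rewrite ipB mulmxKV // mxE.
Qed.

(** [zeta_h] is selected by [get], so its defining property is available once [riesz] provides a
    representative. *)
Lemma zeta_hP N (v : broken M N 1) : Sp_mx p v ->
  Sp_mx p (zeta_h Omega fx p v) /\
  forall psi : broken M N d.+1, Sp_mx p psi ->
    integral_Omega Omega (fun K x => frob (zeta_h Omega fx p v K x) (psi K x)) =
    \sum_i b_h Omega fx (component v i) (row_component psi i).
Proof.
move=> Sv; have lb : linear_on (fun psi : broken M N d.+1 =>
    \sum_i b_h Omega fx (component v i) (row_component psi i)).
  apply: linear_on_sum => i a psi psi' Spsi Spsi'; rewrite row_component_lin.
  by apply: (@b_h_linr R d M Omega fx p); [exact: Sp_component|exact: Sp_row_component..].
exact: (getPex (riesz lb)).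
Qed.

(** Representatives are unique: the difference e of the two sides is orthogonal to every test field,
    in particular to itself. *)
Lemma zeta_h_lin N a (v w : broken M N 1) : Sp_mx p v -> Sp_mx p w ->
  zeta_h Omega fx p (fun K x => a *: v K x + w K x) =
  (fun K x => a *: zeta_h Omega fx p v K x + zeta_h Omega fx p w K x).
Proof.
move=> Sv Sw; have [Szv zvE] := zeta_hP Sv; have [Szw zwE] := zeta_hP Sw.
have [Sz zE] := zeta_hP (Sp_mx_lin a Sv Sw).
set z := zeta_h _ _ _ (fun K x => _) in Sz zE *.
set z' := (fun K x => _ + _).
have Sz' : Sp_mx p z' by exact: Sp_mx_lin.
pose e : broken M N d.+1 := fun K x => (-1) *: z' K x + z K x.
have Se : Sp_mx p e by exact: Sp_mx_lin.
have [_ e0] := inner_pos Se.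
suff /e0 H : integral_Omega Omega (fun K x => frob (e K x) (e K x)) = 0.
  apply/funext => K; apply/funext => x; have := H K x.
  by rewrite /e scaleN1r addrC => /eqP; rewrite subr_eq0 => /eqP.
have ce K (y : broken M N d.+1) : Sp_mx p y -> continuous (fun x => frob (y K x) (e K x)).
  by move=> Sy; apply: continuous_frob; [exact: Sp_mx_continuous Sy|exact: Sp_mx_continuous Se].
have E1 : integral_Omega Omega (fun K x => frob (e K x) (e K x)) =
   (-1) * integral_Omega Omega (fun K x => frob (z' K x) (e K x)) +
   integral_Omega Omega (fun K x => frob (z K x) (e K x)).
  rewrite -integral_Omega_lin => [|K|K]; [|exact: ce|exact: ce].
  by congr integral_Omega; apply/funext => K; apply/funext => x; rewrite -frob_linl.
have E2 : integral_Omega Omega (fun K x => frob (z' K x) (e K x)) =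
   a * integral_Omega Omega (fun K x => frob (zeta_h Omega fx p v K x) (e K x)) +
   integral_Omega Omega (fun K x => frob (zeta_h Omega fx p w K x) (e K x)).
  rewrite -integral_Omega_lin => [|K|K]; [|exact: ce|exact: ce].
  by congr integral_Omega; apply/funext => K; apply/funext => x; rewrite -frob_linl.
have comb (I X Y V W v' w' y' : R) : I = (-1) * X + Y -> X = a * V + W ->
    V = v' -> W = w' -> Y = y' -> y' = a * v' + w' -> I = 0.
  by move=> -> -> -> -> -> ->; rewrite mulN1r addNr.
apply: (comb _ _ _ _ _ _ _ _ E1 E2 (zvE e Se) (zwE e Se) (zE e Se)).
rewrite mulr_sumr -big_split /=; apply: eq_bigr => i _; rewrite component_lin.
by apply: (@b_h_linl R d M Omega fx p); [exact: Sp_component..|exact: Sp_row_component].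
Qed.

End Omega.
End Functionals.

(** Compactness of the unit sphere gives a uniform positive lower bound there, and homogeneity
    extends it. The covering form of compactness includes the empty sphere of R^0. *)
Lemma quadratic_coercive (R : realType) m (Q : 'rV[R]_m -> R) : continuous Q ->
  (forall a z, Q (a *: z) = a ^+ 2 * Q z) -> (forall z, z != 0 -> 0 < Q z) ->
  exists2 delta, 0 < delta & forall z, delta * `|z| ^+ 2 <= Q z.
Proof.
move=> cQ homQ posQ; pose S := [set z : 'rV[R]_m | `|z| = 1].
have cS : compact S.
  apply: bounded_closed_compact.
    exists 1; split=> [|r r1 z /= ->]; [exact: num_real|exact: ltW].
  apply: (@closed_comp _ _ (fun z : 'rV[R]_m => `|z|) [set 1]); last exact: closed_eq.
  by move=> z _; exact: norm_continuous.
have : \forall delta \near (0 : R)^'+, S `<=` [set z | delta <= Q z].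
  move/compact_near_coveringP: cS; apply => z Sz.
  have Qz : 0 < Q z by apply: posQ; rewrite -normr_gt0 Sz.
  have Qz2 : 0 < Q z / 2 by lra.
  have /cvgrPdist_lt/(_ _ Qz2) near_z := cQ z.
  exists ([set y | `|Q z - Q y| < Q z / 2], [set delta | delta < Q z / 2]).
    by split=> //=; exact: nbhs_right_lt.
  move=> [y delta] /= [zy dz]; move: zy; rewrite ltr_norml => /andP[_ zy]; lra.
move=> near0; have [delta [d0 dS]] : exists delta : R, 0 < delta /\ S `<=` [set z | delta <= Q z].
  have : \forall delta \near (0 : R)^'+, 0 < delta /\ S `<=` [set z | delta <= Q z].
    by apply: filterI => //; exact: nbhs_right_gt.
  exact: filter_ex.
exists delta => // z; have [->|z0] := eqVneq z 0.
  have := homQ 0 0; rewrite scaler0 expr0n mul0r => ->.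
  by rewrite normr0 expr0n mulr0.
have nz : 0 < `|z| by rewrite normr_gt0.
have zS : S (`|z|^-1 *: z).
  by rewrite /S /= normrZ normfV normr_id mulVf // gt_eqF.
have := dS _ zS; rewrite /= homQ exprVn mulrC ler_pdivlMr //.
by rewrite exprn_gt0.
Qed.

(** * Existence for one step *)

Section DiscreteStep.
Variables (R : realType) (d N : nat).
Variables (Omega : set 'rV[R]_d.+1) (D : set 'cV[R]_N).
Variables (A : 'cV[R]_N -> 'M[R]_N) (f u : 'cV[R]_N -> 'cV[R]_N) (s : 'cV[R]_N -> R).
Variables (gamma Cf : R) (M : mesh R d) (fx : flux M) (p : nat).
Variable c_h : scalar_broken M -> scalar_broken M -> R.
Hypotheses (oOmega : open Omega) (hM : conforming_mesh M Omega).
Hypothesis hstr : structural_assumptions D A f s u gamma Cf.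
Hypotheses (hfx : admissible_flux fx) (hc : spd_form p c_h).

Lemma u_continuous : continuous u.
Proof. by move=> w; have [/differentiable_continuous] := u_C1 hstr (I : setT w). Qed.

(** Continuity within the closure becomes ordinary continuity at points of the open set D, where [u]
    takes its values. *)
Lemma continuous_comp_u (T : topologicalType) (g : 'cV[R]_N -> T) :
  {within closure D, continuous g} -> continuous (fun w => g (u w)).
Proof.
have [oD _ _] := D_domain hstr.
move=> /(continuous_subspaceW (@subset_closure _ D)); rewrite continuous_open_subspace //.
move=> cg w; apply: (@continuous_comp _ _ _ u g); first exact: u_continuous.
by apply: cg; apply/mem_set; exact: u_in_D hstr w.
Qed.

Lemma hess_u_continuous : continuous (fun w => hess s (u w)).
Proof.
apply: continuous_mx => i j; under eq_fun do rewrite mxE.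
move=> w.
apply: (@continuous_comp _ _ _ u (fun rho => 'D_(delta_mx i 0) (fun r => 'D_(delta_mx j 0) s r) rho)).
  exact: u_continuous.
have [_ s2] := s_C2 hstr.
by have [_] := s2 (delta_mx j 0) _ (u_in_D hstr w); apply.
Qed.

(** The scheme contains A^T [hess s], the hypothesis [hess s] A. By symmetry of the Hessian they are
    transposes of each other and have the same quadratic form, which is summed over the columns of
    sigma. *)
Lemma hess_coercive n (sigma : 'M[R]_(N, n)) w :
  gamma * frob sigma sigma <= frob ((A (u w))^T *m hess s (u w) *m sigma) sigma.
Proof.
have [oD _ _] := D_domain hstr; have Duw := u_in_D hstr w.
rewrite -(hess_sym oD (s_C2 hstr) Duw) -trmx_mul !frob_col mulr_sumr.
apply: ler_sum => k _; have := coercivity hstr (col k sigma) Duw.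
rewrite /enorm sqr_sqrtr ?frob_ge0 // => /le_trans; apply.
have -> : col k ((hess s (u w) *m A (u w))^T *m sigma) = (hess s (u w) *m A (u w))^T *m col k sigma.
  by rewrite !colE mulmxA.
by rewrite frob_mulmx_tr frobC.
Qed.

Lemma Linfty_norm_ge0 : 0 <= Linfty_norm D A.
Proof.
rewrite /Linfty_norm; set B := [set _ | _]; have [B0|B0] := pselect (B !=set0).
  by apply: lb_le_inf => // x [].
(* Without an essential bound the norm is the infimum of the empty set, which is 0 by convention. *)
have -> : B = set0 by apply/seteqP; split=> // x Bx; apply: B0; exists x.
by rewrite inf0.
Qed.

Lemma Sp0 : Sp p ((fun _ _ => 0) : scalar_broken M).
Proof. by move=> K; exists (fun=> 0) => x; rewrite big1 // => a _; rewrite mul0r. Qed.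

Lemma spd_form_ge0 v : Sp p v -> 0 <= c_h v v /\ (c_h v v = 0 -> v = (fun _ _ => 0)).
Proof.
move=> Sv; have [->|nv] := pselect (v = (fun _ _ => 0)).
  split=> //; have := spd_linear hc (- 1) Sp0 Sp0 Sp0.
  have -> : (fun (K : cell M) (x : 'rV[R]_d.+1) => (-1) * (0 : R) + 0) = (fun _ _ => 0).
    by apply/funext => K; apply/funext => x; rewrite mulr0 addr0.
  by rewrite mulN1r addNr => ->.
by have := spd_positive hc Sv nv; rewrite lt0r => /andP[/eqP ? ?].
Qed.

Definition c_form (w l : broken M N 1) := \sum_i c_h (component w i) (component l i).

Lemma c_form_linl l : Sp_mx p l -> linear_on p (c_form ^~ l).
Proof.
move=> Sl; apply: linear_on_sum => i a v w Sv Sw; rewrite component_lin.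
by apply: (spd_linear hc); exact: Sp_component.
Qed.

Lemma c_form_linr w : Sp_mx p w -> linear_on p (c_form w).
Proof.
move=> Sw; apply: linear_on_sum => i a v l Sv Sl.
have Sm : Sp_mx p (fun K x => a *: v K x + l K x) by exact: Sp_mx_lin.
rewrite (spd_symmetric hc (Sp_component i Sw) (Sp_component i Sm)) component_lin.
rewrite (spd_linear hc a (Sp_component i Sv) (Sp_component i Sl) (Sp_component i Sw)).
by rewrite !(spd_symmetric hc (Sp_component i Sw)) //; exact: Sp_component.
Qed.

Lemma c_form_ge0 w : Sp_mx p w ->
  0 <= c_form w w /\ (c_form w w = 0 -> forall K x, w K x = 0).
Proof.
move=> Sw; have ge0 i : true -> 0 <= c_h (component w i) (component w i).
  by move=> _; have [] := spd_form_ge0 (Sp_component i Sw).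
split=> [|w0 K x]; first by apply: sumr_ge0 => i _; exact: ge0.
apply/matrixP => i j; rewrite ord1 mxE.
have /(proj2 (spd_form_ge0 (Sp_component i Sw))) : c_h (component w i) (component w i) = 0.
  by apply: (psumr_eq0P ge0 w0).
by move/(congr1 (fun v : scalar_broken M => v K x)).
Qed.

Definition s_form (w l : broken M N 1) :=
  \sum_i s_h fx (Linfty_norm D A) (component w i) (component l i).

Lemma s_form_linl l : Sp_mx p l -> linear_on p (s_form ^~ l).
Proof.
move=> Sl; apply: linear_on_sum => i a v w Sv Sw; rewrite component_lin.
by apply: (@s_h_linl R d M fx p); exact: Sp_component.
Qed.

Lemma s_form_linr w : Sp_mx p w -> linear_on p (s_form w).
Proof.
move=> Sw; apply: linear_on_sum => i a v l Sv Sl; rewrite component_lin.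
by apply: (@s_h_linr R d M fx p); exact: Sp_component.
Qed.

Lemma s_form_ge0 w : 0 <= s_form w w.
Proof. by apply: sumr_ge0 => i _; apply: s_h_ge0 => //; exact: Linfty_norm_ge0. Qed.

(** Makes the quadratic form an explicit polynomial in the coefficients, from which continuity and
    homogeneity follow. *)
Lemma bilinear_lincomb m n q (e : 'I_q -> broken M m n) (B : broken M m n -> broken M m n -> R) c :
  (forall k, Sp_mx p (e k)) -> (forall v, Sp_mx p v -> linear_on p (B v)) ->
  (forall v, Sp_mx p v -> linear_on p (B ^~ v)) ->
  B (lincomb e c) (lincomb e c) = \sum_k \sum_l c 0 k * c 0 l * B (e k) (e l).
Proof.
move=> Se Br Bl; rewrite (linear_on_lincomb Se c (Bl _ (Sp_mx_lincomb Se c))).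
apply: eq_bigr => k _; rewrite (linear_on_lincomb Se c (Br _ (Se k))) mulr_sumr.
by apply: eq_bigr => l _; rewrite mulrA.
Qed.

(** Evaluation of one entry of [zeta_h] at a point is a linear functional. The formula makes
    [zeta_h] jointly continuous in coefficients and position. *)
Lemma zeta_h_lincomb q (e : 'I_q -> broken M N 1) c K x : (forall k, Sp_mx p (e k)) ->
  zeta_h Omega fx p (lincomb e c) K x = lincomb (fun k => zeta_h Omega fx p (e k)) c K x.
Proof.
move=> Se; apply/matrixP => i j; rewrite /lincomb summxE.
have lz : linear_on p (fun v : broken M N 1 => zeta_h Omega fx p v K x i j).
  by move=> a v w Sv Sw; rewrite zeta_h_lin // !mxE.
rewrite (linear_on_lincomb Se c lz); apply: eq_bigr => k _.
by rewrite mxE.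
Qed.

(** The difference of the two sides, nested to the right so that linearity and continuity are proved
    one summand at a time. *)
Definition balance_residual (eps tau : R) (rho w : broken M N 1) (sigma : broken M N d.+1)
    (l : broken M N 1) :=
  eps * tau * c_form w l +
  (integral_Omega Omega (fun K x => frob (u (w K x) - rho K x) (l K x)) +
  (tau * integral_Omega Omega (fun K x =>
     frob (A (u (w K x)) *m sigma K x) (zeta_h Omega fx p l K x)) +
  (tau * s_form w l +
  (- tau) * integral_Omega Omega (fun K x => frob (f (u (w K x))) (l K x))))).

Definition flux_residual (w : broken M N 1) (sigma phi : broken M N d.+1) :=
  integral_Omega Omega (fun K x =>
    frob ((A (u (w K x)))^T *m hess s (u (w K x)) *m sigma K x) (phi K x)) +
  (- 1) * integral_Omega Omega (fun K x =>
    frob ((A (u (w K x)))^T *m zeta_h Omega fx p w K x) (phi K x)).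

Section Residuals.
Variables (eps tau : R) (rho : broken M N 1).
Hypotheses (heps : 0 < eps) (htau : 0 < tau) (crho : forall K, continuous (rho K)).

Let cu := u_continuous.

Let cA : continuous (fun w => A (u w)).
Proof. exact/continuous_comp_u/(A_continuous hstr). Qed.

Let cf : continuous (fun w => f (u w)).
Proof. exact/continuous_comp_u/(f_continuous hstr). Qed.

Let cdiff (T : topologicalType) (w : T -> 'cV[R]_N) (x : T -> 'rV[R]_d.+1) K :
  continuous w -> continuous x -> continuous (fun t => u (w t) - rho K (x t)).
Proof.
move=> cw cx; apply: continuous_add; first exact: (continuous_compose cw cu).
by apply: continuous_opp; exact: (continuous_compose cx (@crho K)).
Qed.

Let cAs (T : topologicalType) (w : T -> 'cV[R]_N) (sg : T -> 'M[R]_(N, d.+1)) :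
  continuous w -> continuous sg -> continuous (fun t => A (u (w t)) *m sg t).
Proof. by move=> cw cs; apply: continuous_mulmx => //; exact: (continuous_compose cw cA). Qed.

Let cATs (T : topologicalType) (w : T -> 'cV[R]_N) (sg : T -> 'M[R]_(N, d.+1)) :
  continuous w -> continuous sg -> continuous (fun t => (A (u (w t)))^T *m sg t).
Proof.
move=> cw cs; apply: continuous_mulmx => //.
by apply: continuous_trmx; exact: (continuous_compose cw cA).
Qed.

Let cATHs (T : topologicalType) (w : T -> 'cV[R]_N) (sg : T -> 'M[R]_(N, d.+1)) :
  continuous w -> continuous sg ->
  continuous (fun t => (A (u (w t)))^T *m hess s (u (w t)) *m sg t).
Proof.
move=> cw cs; apply: continuous_mulmx => //; apply: continuous_mulmx.
  by apply: continuous_trmx; exact: (continuous_compose cw cA).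
exact: (continuous_compose cw hess_u_continuous).
Qed.

Let cfw (T : topologicalType) (w : T -> 'cV[R]_N) :
  continuous w -> continuous (fun t => f (u (w t))).
Proof. by move=> cw; exact: (continuous_compose cw cf). Qed.

Let cSp m n (w : broken M m n) : Sp_mx p w -> forall K, continuous (w K).
Proof. by move=> Sw K; exact: Sp_mx_continuous Sw. Qed.

Let Szeta (w : broken M N 1) : Sp_mx p w -> Sp_mx p (zeta_h Omega fx p w).
Proof. by move=> Sw; have [] := zeta_hP fx oOmega hM Sw. Qed.

Lemma balance_residual_lin (w : broken M N 1) (sigma : broken M N d.+1) :
  Sp_mx p w -> Sp_mx p sigma ->
  linear_on p (balance_residual eps tau rho w sigma).
Proof.
move=> Sw Ss; apply: linear_onD; first by apply: linear_onZ; exact: c_form_linr.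
apply: linear_onD.
  by apply: linear_on_inner => // K; apply: cdiff; [exact: cSp|move=> x; exact: cvg_id].
apply: linear_onD.
  apply: linear_onZ => a v l Sv Sl; rewrite zeta_h_lin //.
  have lin := @linear_on_inner R d M p Omega oOmega N d.+1
    (fun K x => A (u (w K x)) *m sigma K x) (fun K => cAs (@cSp _ _ _ Sw K) (@cSp _ _ _ Ss K)).
  exact: lin a _ _ (Szeta Sv) (Szeta Sl).
apply: linear_onD; first by apply: linear_onZ; exact: s_form_linr.
apply: linear_onZ; apply: linear_on_inner => // K.
exact: cfw (@cSp _ _ _ Sw K).
Qed.

Lemma flux_residual_lin (w : broken M N 1) (sigma : broken M N d.+1) :
  Sp_mx p w -> Sp_mx p sigma ->
  linear_on p (flux_residual w sigma).
Proof.
move=> Sw Ss; apply: linear_onD; first apply: linear_on_inner => // K.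
  exact: cATHs (@cSp _ _ _ Sw K) (@cSp _ _ _ Ss K).
apply: linear_onZ; apply: linear_on_inner => // K.
exact: cATs (@cSp _ _ _ Sw K) (@cSp _ _ _ (Szeta Sw) K).
Qed.

Lemma integral_Omega_ge0 (g : scalar_broken M) : (forall K x, 0 <= g K x) ->
  0 <= integral_Omega Omega g.
Proof. by move=> g0; apply: sumr_ge0 => K _; apply: Rintegral_ge0 => t _. Qed.

(* The coupling terms of the two equations cancel. *)
Lemma residual_lower_bound (w : broken M N 1) (sigma : broken M N d.+1) :
  Sp_mx p w -> Sp_mx p sigma ->
  eps * tau * c_form w w +
  tau * gamma * integral_Omega Omega (fun K x => frob (sigma K x) (sigma K x)) +
  integral_Omega Omega (fun K x => frob (u (w K x) - rho K x) (w K x)) -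
  tau * integral_Omega (M := M) Omega (fun _ _ => Cf)
  <= balance_residual eps tau rho w sigma w + tau * flux_residual w sigma sigma.
Proof.
move=> Sw Ss; rewrite /balance_residual /flux_residual.
have Iz : integral_Omega Omega (fun K x =>
      frob (A (u (w K x)) *m sigma K x) (zeta_h Omega fx p w K x)) =
    integral_Omega Omega (fun K x =>
      frob ((A (u (w K x)))^T *m zeta_h Omega fx p w K x) (sigma K x)).
  by congr integral_Omega; apply/funext => K; apply/funext => x; rewrite frob_mulmx_tr.
have Ig : gamma * integral_Omega Omega (fun K x => frob (sigma K x) (sigma K x)) <=
    integral_Omega Omega (fun K x =>
      frob ((A (u (w K x)))^T *m hess s (u (w K x)) *m sigma K x) (sigma K x)).
  rewrite -subr_ge0 addrC -mulNr -integral_Omega_lin // => [|K|K].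
  - apply: integral_Omega_ge0 => K x; rewrite mulNr addrC subr_ge0.
    exact: hess_coercive.
  - by apply: continuous_frob; exact: cSp.
  - by apply: continuous_frob; [exact: cATHs (@cSp _ _ _ Sw K) (@cSp _ _ _ Ss K)|exact: cSp].
(* The test field w is the entropy variable, w = [grad s] at u(w), so the pointwise bound on f
   applies to it. *)
have If : integral_Omega Omega (fun K x => frob (f (u (w K x))) (w K x)) <=
    integral_Omega (M := M) Omega (fun _ _ => Cf).
  rewrite -subr_ge0 addrC -mulN1r -integral_Omega_lin // => [|K|K].
  - apply: integral_Omega_ge0 => K x; rewrite mulN1r addrC subr_ge0.
    by have := f_bound hstr (u_in_D hstr (w K x)); rewrite (grad_u hstr).
  - by apply: continuous_frob; [exact: cfw (@cSp _ _ _ Sw K)|exact: cSp].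
  - exact: continuous_cst.
have s0 := s_form_ge0 w.
rewrite Iz; move: (c_form w w) (s_form w w) s0 Ig If => cw sw s0.
move: (integral_Omega _ _) (integral_Omega _ _) (integral_Omega _ _) (integral_Omega _ _)
  (integral_Omega _ _) (integral_Omega _ _) => I1 I2 I3 I4 I5 I6 Ig If.
have := ler_wpM2l (ltW htau) Ig; have := ler_wpM2l (ltW htau) If.
have := mulr_ge0 (ltW htau) s0; lra.
Qed.

Section Existence.
Variables (q r : nat) (e : 'I_q -> broken M N 1) (E : 'I_r -> broken M N d.+1).
Hypotheses (Se : forall k, Sp_mx p (e k)) (SE : forall k, Sp_mx p (E k)).
Hypothesis e_free : forall c : 'rV_q, (forall K x, \sum_k c 0 k *: e k K x = 0) -> c = 0.
Hypothesis E_free : forall c : 'rV_r, (forall K x, \sum_k c 0 k *: E k K x = 0) -> c = 0.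

Let W (z : 'rV[R]_(q + r)) := lincomb e (lsubmx z).
Let S (z : 'rV[R]_(q + r)) := lincomb E (rsubmx z).

Let SW z : Sp_mx p (W z). Proof. exact: Sp_mx_lincomb. Qed.
Let SS z : Sp_mx p (S z). Proof. exact: Sp_mx_lincomb. Qed.

Let clsubmx : continuous (fun z : 'rV[R]_(q + r) => lsubmx z).
Proof.
apply: continuous_mx => i j; under eq_fun do rewrite mxE.
exact: coord_continuous.
Qed.

Let crsubmx : continuous (fun z : 'rV[R]_(q + r) => rsubmx z).
Proof.
apply: continuous_mx => i j; under eq_fun do rewrite mxE.
exact: coord_continuous.
Qed.

Let cfst : continuous (fun t : 'rV[R]_(q + r) * 'rV[R]_d.+1 => t.1).
Proof. by move=> t; exact: cvg_fst. Qed.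

Let csnd : continuous (fun t : 'rV[R]_(q + r) * 'rV[R]_d.+1 => t.2).
Proof. by move=> t; exact: cvg_snd. Qed.

Let cW K : continuous (fun t : 'rV[R]_(q + r) * 'rV[R]_d.+1 => W t.1 K t.2).
Proof. by apply: continuous_lincomb => //; exact: (continuous_compose cfst clsubmx). Qed.

Let cS K : continuous (fun t : 'rV[R]_(q + r) * 'rV[R]_d.+1 => S t.1 K t.2).
Proof. by apply: continuous_lincomb => //; exact: (continuous_compose cfst crsubmx). Qed.

Let cfield m n (v : broken M m n) K : Sp_mx p v ->
  continuous (fun t : 'rV[R]_(q + r) * 'rV[R]_d.+1 => v K t.2).
Proof. by move=> Sv; apply: (continuous_compose csnd) => y; exact: cSp. Qed.

Let czeta K : continuous (fun t : 'rV[R]_(q + r) * 'rV[R]_d.+1 => zeta_h Omega fx p (W t.1) K t.2).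
Proof.
under eq_fun do rewrite /W zeta_h_lincomb //.
apply: continuous_lincomb => //; last exact: (continuous_compose cfst clsubmx).
by move=> k; exact: Szeta.
Qed.

Let clin (F : broken M N 1 -> R) : linear_on p F -> continuous (fun z => F (W z)).
Proof.
move=> lF; under eq_fun do rewrite (linear_on_lincomb Se _ lF).
apply: continuous_sum => k; apply: continuous_mul; last exact: continuous_cst.
exact: (continuous_entry clsubmx).
Qed.

Let balance_continuous l : Sp_mx p l ->
  continuous (fun z => balance_residual eps tau rho (W z) (S z) l).
Proof.
move=> Sl; have Szl := Szeta Sl; apply: continuous_add.
  by apply: continuous_mul; [exact: continuous_cst|exact: (clin (c_form_linl Sl))].
apply: continuous_add.
  apply: continuous_integral_Omega => // K; apply: continuous_frob; last exact: cfield.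
  exact: cdiff.
apply: continuous_add.
  apply: continuous_mul; first exact: continuous_cst.
  apply: continuous_integral_Omega => // K; apply: continuous_frob; last exact: cfield.
  exact: cAs.
apply: continuous_add.
  by apply: continuous_mul; [exact: continuous_cst|exact: (clin (s_form_linl Sl))].
apply: continuous_mul; first exact: continuous_cst.
apply: continuous_integral_Omega => // K; apply: continuous_frob; last exact: cfield.
exact: cfw.
Qed.

Let flux_continuous phi : Sp_mx p phi ->
  continuous (fun z => flux_residual (W z) (S z) phi).
Proof.
move=> Sphi; apply: continuous_add.
  apply: continuous_integral_Omega => // K; apply: continuous_frob; last exact: cfield.
  exact: cATHs.
apply: continuous_mul; first exact: continuous_cst.
apply: continuous_integral_Omega => // K; apply: continuous_frob; last exact: cfield.
exact: cATs.
Qed.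

Let Q (z : 'rV[R]_(q + r)) := eps * tau * c_form (W z) (W z) +
  tau * gamma * integral_Omega Omega (fun K x => frob (S z K x) (S z K x)).

Let inner (v w : broken M N d.+1) := integral_Omega Omega (fun K x => frob (v K x) (w K x)).

Let inner_linr v : Sp_mx p v -> linear_on p (inner v).
Proof. by move=> Sv; apply: linear_on_inner => // K; exact: cSp. Qed.

Let innerC v w : inner v w = inner w v.
Proof. by congr integral_Omega; apply/funext => K; apply/funext => x; exact: frobC. Qed.

Let inner_linl v : Sp_mx p v -> linear_on p (inner ^~ v).
Proof. by move=> Sv a w w' Sw Sw'; rewrite ![inner _ v]innerC inner_linr. Qed.

Let QE z : Q z =
  eps * tau * (\sum_k \sum_l z 0 (lshift r k) * z 0 (lshift r l) * c_form (e k) (e l)) +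
  tau * gamma * (\sum_k \sum_l z 0 (rshift q k) * z 0 (rshift q l) * inner (E k) (E l)).
Proof.
have h1 := bilinear_lincomb (lsubmx z) Se c_form_linr c_form_linl.
have h2 := bilinear_lincomb (rsubmx z) SE inner_linr inner_linl.
rewrite /Q /W h1 -/(inner (S z) (S z)) /S h2; congr (_ * _ + _ * _).
  by apply: eq_bigr => k _; apply: eq_bigr => l _; rewrite !mxE.
by apply: eq_bigr => k _; apply: eq_bigr => l _; rewrite !mxE.
Qed.

(** The regularization detects w and the L^2 product detects sigma; if both vanish, freeness of the
    two bases makes all coefficients zero. *)
Let Q_coercive : exists2 delta, 0 < delta & forall z, delta * `|z| ^+ 2 <= Q z.
Proof.
apply: quadratic_coercive => [|a z|z z0].
- rewrite (funext QE).
  apply: continuous_add; (apply: continuous_mul; first exact: continuous_cst);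
    do 2 apply: continuous_sum => ?; (apply: continuous_mul; last exact: continuous_cst);
    by apply: continuous_mul; exact: coord_continuous.
- rewrite !QE mulrDr; congr (_ + _); rewrite mulrCA; congr (_ * _);
    rewrite mulr_sumr; apply: eq_bigr => k _; rewrite mulr_sumr; apply: eq_bigr => l _;
    by rewrite !mxE; ring.
- have [c0 c0E] := c_form_ge0 (SW z); have [i0 i0E] := inner_pos oOmega hM (SS z).
  have et : 0 < eps * tau by rewrite mulr_gt0.
  have tg : 0 < tau * gamma by rewrite mulr_gt0 // (gamma_positive hstr).
  have [cz|cz] := eqVneq (c_form (W z) (W z)) 0; last first.
    apply: ltr_wpDr; first by rewrite mulr_ge0 // ltW.
    by rewrite mulr_gt0 // lt0r cz.
  have [iz|iz] := eqVneq (integral_Omega Omega (fun K x => frob (S z K x) (S z K x))) 0.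
    case/eqP: z0; rewrite -[z]hsubmxK (e_free (c0E cz)) (E_free (i0E iz)).
    exact: row_mx0.
  apply: ltr_wpDl; first by rewrite mulr_ge0 // ltW.
  by rewrite mulr_gt0 // lt0r iz.
Qed.

Let D_bound : exists2 Cu, 0 <= Cu & forall w, `|u w| <= Cu.
Proof.
have [m [_ Dm]] := D_bounded hstr; exists (`|m| + 1) => [|w]; first by rewrite addr_ge0.
by apply: (Dm _ _ (u w) (u_in_D hstr w)); rewrite ltr_pwDr // ler_norm.
Qed.

(** Growth is only linear because [u] is bounded: entrywise, the first factor is at most [Cu] plus
    the modulus of rho, and the second at most the norm of z times the sum of the moduli of the
    basis fields. *)
Let data_bound : exists2 K1, 0 <= K1 & forall z,
  - (`|z| * K1) <= integral_Omega Omega (fun K x => frob (u (W z K x) - rho K x) (W z K x)).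
Proof.
have [Cu Cu0 uCu] := D_bound.
pose h : scalar_broken M := fun K x =>
  \sum_(i < N) (Cu + `|rho K x i 0|) * \sum_k `|e k K x i 0|.
have cnorm (g : 'rV[R]_d.+1 -> R) : continuous g -> continuous (fun x => `|g x|).
  by move=> cg; exact: (continuous_compose cg (@norm_continuous _ R)).
have ch K : continuous (h K).
  apply: continuous_sum => i; apply: continuous_mul.
    apply: continuous_add; first exact: continuous_cst.
    by apply: cnorm; exact: (continuous_entry (@crho K)).
  apply: continuous_sum => k; apply: cnorm.
  by apply: continuous_entry => y; exact: (cSp (Se k)).
have h0 K x : 0 <= h K x.
  apply: sumr_ge0 => i _; apply: mulr_ge0; first by rewrite addr_ge0.
  by apply: sumr_ge0.
exists (integral_Omega Omega h); first by apply: integral_Omega_ge0.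
move=> z; rewrite -subr_ge0 opprK addrC -integral_Omega_lin // => [|K].
  apply: integral_Omega_ge0 => K x; rewrite -lerBlDr sub0r.
  have Wz i : `|W z K x i 0| <= `|z| * \sum_k `|e k K x i 0|.
    rewrite /W /lincomb summxE; apply: le_trans (ler_norm_sum _ _ _) _.
    rewrite mulr_sumr; apply: ler_sum => k _; rewrite mxE normrM ler_wpM2r //.
    by rewrite mxE ler_mx_norm.
  suff : `|frob (u (W z K x) - rho K x) (W z K x)| <= `|z| * h K x.
    by rewrite ler_norml => /andP[]; rewrite lerNl.
  rewrite frobE /h mulr_sumr; apply: le_trans (ler_norm_sum _ _ _) _.
  apply: ler_sum => i _; rewrite big_ord1 normrM mulrCA ler_pM //.
  rewrite !mxE; apply: le_trans (ler_normB _ _) _; rewrite lerD2r.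
  exact: le_trans (ler_mx_norm _ _ _) (uCu _).
apply: continuous_frob; last exact: cSp.
by apply: cdiff; [exact: cSp|move=> x; exact: cvg_id].
Qed.

(** Multiplying the linear inequality by nz leaves delta nz after the terms with K1 and K2 are
    absorbed. *)
Let quadratic_dominates (delta K1 K2 nz Qz I T : R) : 1 <= nz -> 0 < delta -> 0 <= K2 ->
  delta + K1 + K2 <= delta * nz -> delta * nz ^+ 2 <= Qz -> - (nz * K1) <= I -> T <= K2 ->
  0 < Qz + I - T.
Proof.
move=> z1 d0 K20 zd Qd HI HT.
have := ler_wpM2r (le_trans ler01 z1) zd.
have : K2 <= K2 * nz by rewrite ler_peMr.
have : 0 < delta * nz by rewrite mulr_gt0 // (lt_le_trans ltr01).
move: Qd; rewrite expr2 mulrA !mulrDl (mulrC K1); lra.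
Qed.

Lemma residual_zero : exists z,
  (forall j, balance_residual eps tau rho (W z) (S z) (e j) = 0) /\
  (forall k, flux_residual (W z) (S z) (E k) = 0).
Proof.
pose G z : 'rV[R]_(q + r) := row_mx
  (\row_j balance_residual eps tau rho (W z) (S z) (e j))
  (\row_k (tau * flux_residual (W z) (S z) (E k))).
have cG : continuous G.
  apply: continuous_mx => i j; case: (split_ordP j) => k ->.
    under eq_fun do rewrite row_mxEl mxE.
    exact: balance_continuous.
  under eq_fun do rewrite row_mxEr mxE.
  by apply: continuous_mul; [exact: continuous_cst|exact: flux_continuous].
have GE (z : 'rV[R]_(q + r)) : \sum_i z 0 i * G z 0 i =
    balance_residual eps tau rho (W z) (S z) (W z) +
    tau * flux_residual (W z) (S z) (S z).
  rewrite big_split_ord /=; congr (_ + _).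
    rewrite [RHS](linear_on_lincomb Se _ (balance_residual_lin (SW z) (SS z))).
    by apply: eq_bigr => k _; rewrite row_mxEl !mxE.
  rewrite [in RHS](linear_on_lincomb SE _ (flux_residual_lin (SW z) (SS z))) mulr_sumr.
  by apply: eq_bigr => k _; rewrite row_mxEr !mxE mulrCA.
have [delta d0 Qd] := Q_coercive; have [K1 K10 HK1] := data_bound.
pose K2 := tau * `|integral_Omega (M := M) Omega (fun _ _ => Cf)|.
have K20 : 0 <= K2 by rewrite mulr_ge0 // ltW.
(* The radius is chosen so that beyond it both [1 <= |z|] and [delta + K1 + K2 <= delta * |z|]
   hold. *)
have [|z Gz] := @coercive_zero R _ G (1 + (K1 + K2) / delta) cG.
  move=> z zr; rewrite GE.
  apply: lt_le_trans (residual_lower_bound (SW z) (SS z)).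
  have z1 : 1 <= `|z|.
    by apply: le_trans zr; rewrite lerDl divr_ge0 ?addr_ge0 // ltW.
  have zd : delta + K1 + K2 <= delta * `|z|.
    apply: le_trans (ler_wpM2l (ltW d0) zr).
    by rewrite mulrDr mulr1 mulrCA mulfV ?gt_eqF // mulr1 addrA.
  have CK2 : tau * integral_Omega (M := M) Omega (fun _ _ => Cf) <= K2.
    by rewrite ler_wpM2l ?(ltW htau) // ler_norm.
  exact: quadratic_dominates z1 d0 K20 zd (Qd z) (HK1 z) CK2.
exists z; split=> k.
  by have /rowP/(_ (lshift r k)) := Gz; rewrite row_mxEl !mxE.
have /rowP/(_ (rshift q k)) := Gz; rewrite row_mxEr !mxE => /eqP.
by rewrite mulf_eq0 gt_eqF //= => /eqP.
Qed.

End Existence.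

(** Both residuals are linear in the test field, so vanishing on the bases is enough. *)
Theorem scheme_step_exists :
  exists w sigma, scheme_step Omega fx p D A f u s c_h eps tau rho w sigma.
Proof.
have [q [e [Se e_gen e_free]]] := @Sp_mx_basis R d M p N 1.
have [r [E [SE E_gen E_free]]] := @Sp_mx_basis R d M p N d.+1.
have [z [balance flux]] := residual_zero Se SE e_free E_free.
pose w := lincomb e (lsubmx z); pose sigma := lincomb E (rsubmx z).
have Sw : Sp_mx p w by exact: Sp_mx_lincomb.
have Ss : Sp_mx p sigma by exact: Sp_mx_lincomb.
exists w, sigma; split=> // [phi Sphi|l Sl].
  have [c cE] := E_gen phi Sphi.
  have -> : phi = lincomb E c by apply/funext => K; apply/funext => x; rewrite cE.
  have : flux_residual w sigma (lincomb E c) = 0.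
    rewrite (linear_on_lincomb SE _ (flux_residual_lin Sw Ss)) big1 // => k _.
    by rewrite flux mulr0.
  by rewrite /flux_residual mulN1r => /eqP; rewrite subr_eq0 => /eqP.
have [c cE] := e_gen l Sl.
have -> : l = lincomb e c by apply/funext => K; apply/funext => x; rewrite cE.
have : balance_residual eps tau rho w sigma (lincomb e c) = 0.
  rewrite (linear_on_lincomb Se _ (balance_residual_lin Sw Ss)) big1 // => k _.
  by rewrite balance mulr0.
rewrite /balance_residual !addrA mulNr => /eqP.
by rewrite subr_eq0 => /eqP.
Qed.

End Residuals.

End DiscreteStep.

(** * Continuity of the previous density and the step from one time level to the next *)

Lemma discrete_density_continuous (R : realType) (d N p : nat) (M : mesh R d)
    (Omega : set 'rV[R]_d.+1) (u : 'cV[R]_N -> 'cV[R]_N) (rho0 : 'rV[R]_d.+1 -> 'cV[R]_N)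
    (w : nat -> broken M N 1) n K :
  continuous u -> (forall k, (k < n)%N -> Sp_mx p (w k.+1)) ->
  continuous (discrete_density Omega p u rho0 w n K).
Proof.
move=> cu Sw; case: n Sw => [_|n Sw] /=; last first.
  by apply: continuous_compose cu => x; exact: Sp_mx_continuous (Sw n _) x.
rewrite /L2_projection; set P := [set _ | _].
have [exP|noP] := pselect (exists q, P q).
  by have [Sq _] := getPex exP; move=> x; exact: Sp_mx_continuous Sq x.
(* If there were no projection, [get] would return a constant field. *)
rewrite getPN; last by move=> q Pq; apply: noP; exists q.
exact: continuous_cst.
Qed.

Theorem theorem3p2 (R : realType) (d N : nat)
  (Omega : set 'rV[R]_d.+1) (D : set 'cV[R]_N)
  (A : 'cV[R]_N -> 'M[R]_N) (f u : 'cV[R]_N -> 'cV[R]_N) (s : 'cV[R]_N -> R)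
  (gamma Cf : R) (rho0 : 'rV[R]_d.+1 -> 'cV[R]_N)
  (M : mesh R d) (Upsilon : R) (fx : flux M) (p : nat)
  (c_h : scalar_broken M -> scalar_broken M -> R)
  (eps T : R) (Nt : nat) (t : nat -> R)
  (hd : d.+1 \in [:: 1; 2; 3]%N)
  (hOmega : polytopic_lipschitz_domain Omega)
  (hstr : structural_assumptions D A f s u gamma Cf)
  (hrho0 : admissible_datum Omega D rho0)
  (hM : conforming_mesh M Omega)
  (hUpsilon : 0 < Upsilon)
  (hshape : d.+1 \in [:: 2; 3]%N -> shape_regular M Upsilon)
  (hfx : admissible_flux fx)
  (hc : spd_form p c_h)
  (heps : 0 < eps) (hT : 0 < T)
  (ht : time_partition T Nt t) :
  forall n : nat, (n < Nt)%N ->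
  forall (w : nat -> broken M N 1) (sigma : nat -> broken M N d.+1),
    (forall k : nat, (k < n)%N ->
      scheme_step Omega fx p D A f u s c_h eps (t k.+1 - t k)
        (discrete_density Omega p u rho0 w k) (w k.+1) (sigma k.+1)) ->
  exists (w' : broken M N 1) (sigma' : broken M N d.+1),
    scheme_step Omega fx p D A f u s c_h eps (t n.+1 - t n)
      (discrete_density Omega p u rho0 w n) w' sigma'.
Proof.
move=> n ltn w sigma steps.
have [[oOmega _ _] _ _ _] := hOmega.
have [_ _ t_incr] := ht.
apply: (scheme_step_exists oOmega hM hstr hfx hc heps) => [|K].
  by rewrite subr_gt0 t_incr.
apply: discrete_density_continuous => [|k ltkn]; first exact: u_continuous hstr.
by have [] := steps k ltkn.
Qed.
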